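(* Let $(X_n)_{n\in\mathbb Z}$ be a stationary augmented GARCH(1,1) process (as defined in the context) with $\mathbb E(X_0^4)<\infty$ and $\sum_{k=1}^\infty\operatorname{Cov}(X_1^2,X_k^2)<\infty$, and let $T_n=\frac1{\sqrt n}\sum_{k=1}^n[X_k^2-\mathbb E(X_0^2)]$. Then for every $t\in\mathbb R$, $$\lim_{n\to\infty}\Big|\mathbb P(T_n\le t)-\frac1{\log n}\sum_{k=1}^n\frac1k\mathbb 1_{\{T_k\le t\}}\Big|=0\quad\text{almost surely.}$$
   Context: A stationary augmented GARCH(1,1) process: there is an i.i.d. real sequence $(\xi_n)_{n\in\mathbb Z}$ with $\mathbb E\xi_0=0$, $\mathbb E\xi_0^2=1$, a positive stationary process $(\sigma_n)_{n\in\mathbb Z}$ with $\sigma_n$ measurable with respect to $\sigma(\xi_k:k\le n-1)$, a coordinatewise nondecreasing measurable function $\varphi:\mathbb R^2\to\mathbb R$ and a strictly increasing measurable function $\Lambda:\mathbb R_+\to\mathbb R$ such that $X_n=\sigma_n\xi_n$ and $\Lambda(\sigma_n^2)=\varphi(\Lambda(\sigma_{n-1}^2),\xi_{n-1}^2)$ for all $n$. *)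

(* Defs.v *)
From HB Require Import structures.
From mathcomp Require Import all_boot all_order all_algebra.
From mathcomp Require Import all_classical all_reals all_analysis.
Set Implicit Arguments. Unset Strict Implicit. Unset Printing Implicit Defensive.
Import Order.TTheory GRing.Theory Num.Theory.
Import numFieldNormedType.Exports.
Local Open Scope classical_set_scope.
Local Open Scope ring_scope.

Section defs.
Context {d : measure_display} {T : measurableType d} {R : realType}.

Definition mutually_independent (P : probability T R) (Y : int -> T -> R) :=
  forall (I : seq int) (B : int -> set R), uniq I ->
    (forall i, measurable (B i)) ->
    P (\bigcap_(i in [set` I]) (Y i @^-1` B i)) =
    (\prod_(i <- I) P (Y i @^-1` B i))%E.

Definition identically_distributed (P : probability T R) (Y : int -> T -> R) :=
  forall i (B : set R), measurable B -> P (Y i @^-1` B) = P (Y 0 @^-1` B).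

Definition stationary (P : probability T R) (Y : int -> T -> R) :=
  forall (h : int) (I : seq int) (B : int -> set R),
    (forall i, measurable (B i)) ->
    P (\bigcap_(i in [set` I]) (Y (i + h) @^-1` B i)) =
    P (\bigcap_(i in [set` I]) (Y i @^-1` B i)).

Definition past_sigma (Y : int -> T -> R) (n : int) : set (set T) :=
  <<s [set A | exists k : int, k <= n - 1 /\
         exists B : set R, measurable B /\ A = Y k @^-1` B] >>.

Definition measurable_wrt (F : set (set T)) (f : T -> R) :=
  forall B : set R, measurable B -> F (f @^-1` B).

End defs.

(* Main.v *)
Require Import Defs.
From HB Require Import structures.
From mathcomp Require Import all_boot all_order all_algebra.
From mathcomp Require Import all_classical all_reals all_analysis.
From mathcomp Require Import measurable_realfun ring lra.
Import Order.TTheory GRing.Theory Num.Theory.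
Import numFieldNormedType.Exports.
Local Open Scope classical_set_scope.
Local Open Scope ring_scope.
Set Implicit Arguments. Unset Strict Implicit. Unset Printing Implicit Defensive.

(* With L_n = Lambda(sigma_n^2) the recursion reads L_(n+1) = phi(L_n, xi_n^2), so
   a stretch of squares X_j^2, ..., X_(j+n)^2 is a coordinatewise nondecreasing
   image of the independent variables L_j, xi_j^2, ..., xi_(j+n)^2; by Harris'
   inequality it is associated, and its law does not depend on j. Association
   bounds the covariance of Lipschitz functions of partial sums by the covariance
   of the sums themselves, which is used twice.

   Central limit theorem: splitting the sum into q blocks of fixed length, the
   Stein expression E[v f'(T_n) - T_n f(T_n)], with v the limiting variance, tends
   to 0 for every C^1 function f with f and f' Lipschitz. Choosing f = G / p with
   p(x) = exp(-x^2 / 2v) and G compactly supported with derivative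
   p k, k = trapezoid * (ramp - c), shows that E[ramp(T_n)] stays close to a
   constant c, and the constants of two nearby ramps are close. No limit law has
   to be identified, and Gaussian tails never intervene.

   Logarithmic averages: for a ramp g, the sum of the (g(T_k) - E g(T_k)) / k,
   k <= n, has variance O(ln n); a subsequence argument gives almost sure
   convergence to 0 after division by ln n, and sandwiching the indicator of
   (-oo, t] between two ramps concludes. *)

(** * Real-valued expectations and covariances *)

(** Three obstacles shape the proof. [Lambda] is merely strictly increasing, so sigma_n^2 has to be
    recovered from Lambda(sigma_n^2) by a measurable monotone map defined on the whole line; its
    values off the range of [Lambda] may spoil monotonicity, which is repaired by restricting to a
    lower set that carries the law. Only second moments of the X_k^2 are available: squares of block
    sums are clipped before any covariance bound is applied to them, and Taylor remainders are cut
    off at their Lipschitz bound. The blocks in Stein's method are dependent. Treating them as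
    independent costs Var(T_n) minus the variance of one block, and for long blocks both are close
    to v. The theorem compares P(T_n <= t) with an average over k of indicators, so it suffices that
    P(T_n <= t) hardly varies for large n. The Gaussian weight serves only to show that shifting a
    ramp by its width changes its constant little. If v = 0 the Stein equation degenerates, but then
    T_n = 0 almost surely, because Var(T_n) never exceeds v. *)

Section expectation.
Context d (T : measurableType d) (R : realType) (P : probability T R).
Implicit Types f g : T -> R.

Definition itg f := P.-integrable setT (EFin \o f).
Definition Ex f : R := \int[P]_x f x.

Lemma itg_meas f : itg f -> measurable_fun setT f.
Proof. by move=> /integrableP[/measurable_EFinP]. Qed.

Lemma itg_cst (c : R) : itg (fun=> c).
Proof. exact: finite_measure_integrable_cst. Qed.

Lemma itgD f g : itg f -> itg g -> itg (fun x => f x + g x).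
Proof. by move=> hf hg; exact: (integrableD measurableT hf hg). Qed.

Lemma itgZ c f : itg f -> itg (fun x => c * f x).
Proof. by move=> hf; exact: (integrableZl measurableT c hf). Qed.

Lemma itgB f g : itg f -> itg g -> itg (fun x => f x - g x).
Proof. by move=> hf hg; exact: (integrableB measurableT hf hg). Qed.

Lemma itg_sum (I : Type) (s : seq I) (F : I -> T -> R) :
  (forall i, itg (F i)) -> itg (fun x => \sum_(i <- s) F i x).
Proof.
move=> h; elim: s => [|a s IH].
  by under eq_fun do rewrite big_nil; exact: itg_cst.
by under eq_fun do rewrite big_cons; exact: itgD.
Qed.

Lemma itg_le f g : measurable_fun setT f -> itg g ->
  (forall x, `|f x| <= g x) -> itg f.
Proof.
move=> mf ig h; apply: (le_integrable measurableT _ _ ig).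
  exact/measurable_EFinP.
by move=> x _ /=; rewrite lee_fin (le_trans (h x))// ler_norm.
Qed.

Lemma itg_bounded f (M : R) : measurable_fun setT f ->
  (forall x, `|f x| <= M) -> itg f.
Proof. by move=> mf h; apply: (itg_le mf (itg_cst M)). Qed.

Lemma itg_norm f : itg f -> itg (fun x => `|f x|).
Proof. exact: integrable_norm. Qed.

Lemma Ex_cst (c : R) : Ex (fun=> c) = c.
Proof. by rewrite /Ex Rintegral_cst//= [X in fine X]probability_setT mulr1. Qed.

Lemma ExD f g : itg f -> itg g -> Ex (fun x => f x + g x) = Ex f + Ex g.
Proof. exact: RintegralD. Qed.

Lemma ExB f g : itg f -> itg g -> Ex (fun x => f x - g x) = Ex f - Ex g.
Proof. exact: RintegralB. Qed.

Lemma ExZ c f : itg f -> Ex (fun x => c * f x) = c * Ex f.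
Proof. exact: RintegralZl. Qed.

Lemma Ex_sum (I : Type) (s : seq I) (F : I -> T -> R) :
  (forall i, itg (F i)) ->
  Ex (fun x => \sum_(i <- s) F i x) = \sum_(i <- s) Ex (F i).
Proof.
move=> h; elim: s => [|a s IH].
  by under eq_fun do rewrite big_nil; rewrite big_nil Ex_cst.
under eq_fun do rewrite big_cons.
by rewrite big_cons ExD ?IH//; exact: itg_sum.
Qed.

Lemma Ex_ge0 f : (forall x, 0 <= f x) -> 0 <= Ex f.
Proof. by move=> h; apply: Rintegral_ge0. Qed.

Lemma Ex_le f g : itg f -> itg g -> (forall x, f x <= g x) -> Ex f <= Ex g.
Proof. by move=> hf hg h; apply: le_Rintegral. Qed.

Lemma Ex_norm f : itg f -> `|Ex f| <= Ex (fun x => `|f x|).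
Proof. by move=> hf; apply: le_normr_Rintegral. Qed.

Lemma Ex_norm_le f g : itg f -> itg g -> (forall x, `|f x| <= g x) ->
  `|Ex f| <= Ex g.
Proof.
by move=> hf hg h; apply: le_trans (Ex_norm hf) (Ex_le (itg_norm hf) hg h).
Qed.

Definition sqi f := measurable_fun setT f /\ itg (fun x => f x ^+ 2).

Lemma sqi_meas f : sqi f -> measurable_fun setT f. Proof. by case. Qed.

Lemma sqiM f g : sqi f -> sqi g -> itg (fun x => f x * g x).
Proof.
move=> [mf sf] [mg sg]; apply: (itg_le _ (itgD sf sg)).
  exact: measurable_funM.
move=> x; rewrite normrM -(real_normK (num_real (f x))).
rewrite -(real_normK (num_real (g x))); nra.
Qed.

Lemma sqi_le f g : measurable_fun setT f -> sqi g ->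
  (forall x, `|f x| <= `|g x|) -> sqi f.
Proof.
move=> mf [mg sg] h; split=> //; apply: (itg_le _ sg).
  exact: measurable_funX.
move=> x; rewrite normrX -(real_normK (num_real (g x))).
by apply: lerXn2r => //; rewrite nnegrE.
Qed.

Lemma sqi_cst (c : R) : sqi (fun=> c).
Proof. by split=> //; exact: itg_cst. Qed.

Lemma sqiD f g : sqi f -> sqi g -> sqi (fun x => f x + g x).
Proof.
move=> hf hg; split; first by apply: measurable_funD; apply: sqi_meas.
under eq_fun do rewrite sqrrD -mulr_natl.
by apply: itgD; [apply: itgD; [case: hf|apply: itgZ; apply: sqiM]|case: hg].
Qed.

Lemma sqiZ c f : sqi f -> sqi (fun x => c * f x).
Proof.
move=> [mf sf]; split; first exact: measurable_funM.
by under eq_fun do rewrite exprMn; exact: itgZ.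
Qed.

Lemma sqiN f : sqi f -> sqi (fun x => - f x).
Proof.
by move=> /(sqiZ (-1)); congr sqi; apply/funext => x; rewrite mulN1r.
Qed.

Lemma sqiB f g : sqi f -> sqi g -> sqi (fun x => f x - g x).
Proof. by move=> hf hg; apply: sqiD => //; exact: sqiN. Qed.

Lemma sqi_sum (I : Type) (s : seq I) (F : I -> T -> R) :
  (forall i, sqi (F i)) -> sqi (fun x => \sum_(i <- s) F i x).
Proof.
move=> h; elim: s => [|a s IH].
  by under eq_fun do rewrite big_nil; exact: sqi_cst.
by under eq_fun do rewrite big_cons; exact: sqiD.
Qed.

Lemma sqi_bounded f (M : R) : measurable_fun setT f ->
  (forall x, `|f x| <= M) -> sqi f.
Proof.
move=> mf h; apply: (sqi_le mf (sqi_cst M)) => x.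
by rewrite (le_trans (h x))// ler_norm.
Qed.

Lemma sqi_itg f : sqi f -> itg f.
Proof.
by move=> hf; have := sqiM (sqi_cst 1) hf; under eq_fun do rewrite mul1r.
Qed.

Lemma sqr_Ex_le f : sqi f -> Ex f ^+ 2 <= Ex (fun x => f x ^+ 2).
Proof.
move=> hf; have h2 := sqi_itg hf; case: (hf) => _ h1.
set m := Ex f.
have : 0 <= Ex (fun x => f x ^+ 2 - (2 * m * f x - m ^+ 2)).
  apply: Ex_ge0 => x.
  have -> : f x ^+ 2 - (2 * m * f x - m ^+ 2) = (f x - m) ^+ 2 by ring.
  exact: sqr_ge0.
rewrite ExB//; last by apply: itgB; [exact: itgZ|exact: itg_cst].
rewrite ExB ?Ex_cst ?ExZ//; [rewrite -/m; nra|exact: itgZ|exact: itg_cst].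
Qed.

Lemma Ex_abs_le_sqrt f : sqi f ->
  Ex (fun x => `|f x|) <= Num.sqrt (Ex (fun x => f x ^+ 2)).
Proof.
move=> hf; have hn : sqi (fun x => `|f x|).
  by apply: (sqi_le _ hf); [apply: measurableT_comp => //; case: hf|move=> x; rewrite normr_id].
have := sqr_Ex_le hn.
under [X in _ <= Ex X]eq_fun do rewrite real_normK ?num_real//.
move=> h; rewrite -(ger0_norm (Ex_ge0 (fun x => normr_ge0 (f x)))) -sqrtr_sqr.
exact: ler_wsqrtr.
Qed.

Definition Cov f g : R := Ex (fun x => f x * g x) - Ex f * Ex g.

Lemma CovC f g : Cov f g = Cov g f.
Proof.
by rewrite /Cov mulrC; congr (Ex _ - _); apply/funext => x; rewrite mulrC.
Qed.

Lemma CovDl f g h : sqi f -> sqi g -> sqi h ->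
  Cov (fun x => f x + g x) h = Cov f h + Cov g h.
Proof.
move=> hf hg hh; rewrite /Cov; under [X in Ex X]eq_fun do rewrite mulrDl.
by rewrite !ExD; [ring|first [exact: sqiM|exact: sqi_itg]..].
Qed.

Lemma CovZl c f h : sqi f -> sqi h -> Cov (fun x => c * f x) h = c * Cov f h.
Proof.
move=> hf hh; rewrite /Cov; under [X in Ex X]eq_fun do rewrite -mulrA.
by rewrite !ExZ; [ring|first [exact: sqiM|exact: sqi_itg]..].
Qed.

Lemma CovNl f h : sqi f -> sqi h -> Cov (fun x => - f x) h = - Cov f h.
Proof.
move=> hf hh; rewrite -mulN1r -CovZl//; congr (Cov _ _).
by apply/funext => x; rewrite mulN1r.
Qed.

Lemma CovDr f g h : sqi f -> sqi g -> sqi h ->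
  Cov h (fun x => f x + g x) = Cov h f + Cov h g.
Proof. by move=> *; rewrite CovC CovDl// [Cov f _]CovC [Cov g _]CovC. Qed.

Lemma CovZr c f h : sqi f -> sqi h -> Cov h (fun x => c * f x) = c * Cov h f.
Proof. by move=> *; rewrite CovC CovZl// CovC. Qed.

Lemma CovNr f h : sqi f -> sqi h -> Cov h (fun x => - f x) = - Cov h f.
Proof. by move=> *; rewrite CovC CovNl// CovC. Qed.

Lemma CovBl f g h : sqi f -> sqi g -> sqi h ->
  Cov (fun x => f x - g x) h = Cov f h - Cov g h.
Proof. by move=> ? ? ?; rewrite CovDl ?CovNl//; exact: sqiN. Qed.

Lemma CovBr f g h : sqi f -> sqi g -> sqi h ->
  Cov h (fun x => f x - g x) = Cov h f - Cov h g.
Proof. by move=> ? ? ?; rewrite CovDr ?CovNr//; exact: sqiN. Qed.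

Lemma Cov_cstl c f : sqi f -> Cov (fun=> c) f = 0.
Proof. by move=> hf; rewrite /Cov Ex_cst ExZ ?subrr//; exact: sqi_itg. Qed.

Lemma Cov_suml (I : Type) (s : seq I) (F : I -> T -> R) h :
  (forall i, sqi (F i)) -> sqi h ->
  Cov (fun x => \sum_(i <- s) F i x) h = \sum_(i <- s) Cov (F i) h.
Proof.
move=> hF hh; elim: s => [|a s IH].
  by under eq_fun do rewrite big_nil; rewrite big_nil Cov_cstl.
under eq_fun do rewrite big_cons.
by rewrite big_cons CovDl ?IH//; exact: sqi_sum.
Qed.

Lemma Cov_sumr (I : Type) (s : seq I) (F : I -> T -> R) h :
  (forall i, sqi (F i)) -> sqi h ->
  Cov h (fun x => \sum_(i <- s) F i x) = \sum_(i <- s) Cov h (F i).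
Proof.
by move=> *; rewrite CovC Cov_suml//; apply: eq_bigr => i _; rewrite CovC.
Qed.

Lemma Cov_ge0_diag f : sqi f -> 0 <= Cov f f.
Proof.
move=> hf; rewrite /Cov subr_ge0 -expr2.
by under [X in _ <= Ex X]eq_fun do rewrite -expr2; exact: sqr_Ex_le.
Qed.

End expectation.

(** * Association and Harris' inequality *)

Section transfer.
Context d d' (T : measurableType d) (E : measurableType d') (R : realType).
Variables (P : probability T R) (mu : probability E R) (W : T -> E).
Hypothesis mW : measurable_fun setT W.
Hypothesis law : forall B, measurable B -> P (W @^-1` B) = mu B.

Lemma ge0_integral_law (f : E -> \bar R) : measurable_fun setT f ->
  (forall x, 0 <= f x)%E -> (\int[P]_x f (W x) = \int[mu]_x f x)%E.
Proof.
move=> mf f0; have := @ge0_integral_pushforward _ _ _ _ _ _ mW P setT f measurableT mf.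
rewrite preimage_setT => /= <-//.
by apply: eq_measure_integral => A mA _; exact: law.
Qed.

Lemma itg_law (f : E -> R) : measurable_fun setT f ->
  itg P (fun x => f (W x)) <-> itg mu f.
Proof.
move=> mf; have mfW : measurable_fun setT (fun x => f (W x)).
  exact: measurableT_comp mf mW.
have eqn : (\int[P]_x `|(f (W x))%:E| = \int[mu]_x `|(f x)%:E|)%E.
  apply: (@ge0_integral_law (fun x => `|(f x)%:E|%E)) => //.
  by apply: measurableT_comp => //; exact/measurable_EFinP.
split => /integrableP[_ h]; apply/integrableP; split.
- exact/measurable_EFinP.
- by rewrite /= -eqn.
- exact/measurable_EFinP.
- by rewrite /= eqn.
Qed.

Lemma Ex_law (f : E -> R) : itg mu f -> Ex P (fun x => f (W x)) = Ex mu f.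
Proof.
move=> hf; have mf := itg_meas hf; have hW := (itg_law mf).2 hf.
rewrite /Ex /Rintegral; congr fine.
have := @integral_pushforward _ _ _ _ _ _ mW P setT (EFin \o f).
rewrite preimage_setT => <-//; last exact/measurable_EFinP.
by apply: eq_measure_integral => A mA _; exact: law.
Qed.

End transfer.

Section convergence.
Context d (T : measurableType d) (R : realType) (P : probability T R).

Lemma Ex_cvg (F : nat -> T -> R) (f g : T -> R) :
  (forall n, measurable_fun setT (F n)) -> measurable_fun setT f ->
  itg P g -> (forall n x, `|F n x| <= g x) ->
  (forall x, F ^~ x @ \oo --> f x) -> (fun n => Ex P (F n)) @ \oo --> Ex P f.
Proof.
move=> mF mf ig Fg Ff.
have h1 n : measurable_fun setT (fun x => (F n x)%:E) by exact/measurable_EFinP.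
have h2 : measurable_fun setT (EFin \o f) by exact/measurable_EFinP.
have h3 : {ae P, forall x, setT x -> (fun n => (F n x)%:E) @ \oo --> (EFin \o f) x}.
  by apply: aeW => x _; apply: cvg_EFin; [exact: nearW|exact: Ff].
have h4 : {ae P, forall x n, setT x -> (`|(F n x)%:E| <= (EFin \o g) x)%E}.
  by apply: aeW => x n _ /=; rewrite lee_fin.
have [if_ _ h] := dominated_convergence measurableT h1 h2 h3 ig h4.
by apply: fine_cvg; rewrite /Ex /Rintegral fineK//; exact: integrable_fin_num.
Qed.

End convergence.

Section association.
Context d (E : measurableType d) (R : realType).
Variables (le : E -> E -> Prop) (mu : probability E R).

Definition nondecr (f : E -> R) := forall a b, le a b -> f a <= f b.

(** Bounded test functions make every expectation finite; unbounded variables are reached later by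
    clipping. The relation [le] is arbitrary, so that products can be formed inductively. *)
Definition associated := forall (f g : E -> R) (M : R),
  measurable_fun setT f -> measurable_fun setT g ->
  (forall x, `|f x| <= M) -> (forall x, `|g x| <= M) ->
  nondecr f -> nondecr g -> Ex mu f * Ex mu g <= Ex mu (fun x => f x * g x).

End association.

(** Chebyshev's argument: (f x - f y) (g x - g y) >= 0 on a totally ordered set, and this is
    integrated in x, then in y. *)
Lemma associated_real (R : realType) (mu : probability R R) :
  associated (fun a b : R => a <= b) mu.
Proof.
move=> f g M mf mg fM gM nf ng.
have itf := itg_bounded mu mf fM; have ig := itg_bounded mu mg gM.
have sf := sqi_bounded mu mf fM; have sg := sqi_bounded mu mg gM.
have ifg := sqiM sf sg.
have H y : 0 <= Ex mu (fun x => f x * g x) - f y * Ex mu g - g y * Ex mu f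
    + f y * g y.
  have -> : Ex mu (fun x => f x * g x) - f y * Ex mu g - g y * Ex mu f
    + f y * g y = Ex mu (fun x => f x * g x - f y * g x - g y * f x + f y * g y).
    rewrite ExD ?Ex_cst ?ExB ?ExZ//;
      by repeat first [assumption|exact: itg_cst|apply: itgB|apply: itgZ].
  apply: Ex_ge0 => x.
  have -> : f x * g x - f y * g x - g y * f x + f y * g y =
            (f x - f y) * (g x - g y) by ring.
  have [xy|yx] := leP x y.
    by apply: mulr_le0; rewrite subr_le0; [exact: nf|exact: ng].
  by apply: mulr_ge0; rewrite subr_ge0; [apply: nf|apply: ng]; exact: ltW.
have := Ex_ge0 mu H.
have -> : Ex mu (fun y => Ex mu (fun x => f x * g x) - f y * Ex mu g -
   g y * Ex mu f + f y * g y) =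
   Ex mu (fun y => Ex mu (fun x => f x * g x) - Ex mu g * f y -
   Ex mu f * g y + f y * g y).
  by congr (Ex _ _); apply/funext => y; ring.
rewrite ExD ?ExB ?ExZ ?Ex_cst//;
  try by repeat first [assumption|exact: itg_cst|apply: itgB|apply: itgZ].
lra.
Qed.

Section association_prod.
Context d (E : measurableType d) (R : realType).
Variables (le : E -> E -> Prop) (mu : probability E R) (nu : probability R R).
Hypothesis le_refl : forall a, le a a.

Definition le_prod (a b : E * R) := le a.1 b.1 /\ a.2 <= b.2.

Lemma Ex_prod (h : E * R -> R) (M : R) : measurable_fun setT h ->
  (forall z, `|h z| <= M) ->
  measurable_fun setT (fun y => Ex mu (fun x => h (x, y))) /\
  Ex (mu \x nu)%E h = Ex nu (fun y => Ex mu (fun x => h (x, y))).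
Proof.
move=> mh hM; have ih : itg (mu \x nu)%E h by apply: itg_bounded mh hM.
have fin y : (\int[mu]_x (h (x, y))%:E)%E = (Ex mu (fun x => h (x, y)))%:E.
  rewrite /Ex /Rintegral fineK// integrable_fin_num//.
  apply: (@itg_bounded _ _ _ mu _ M) => //.
  exact: (measurableT_comp mh (measurable_pair2 y)).
have FE : fubini_G mu (EFin \o h) = EFin \o (fun y => Ex mu (fun x => h (x, y))).
  by apply/funext => y; rewrite /fubini_G fin.
split; first by apply/measurable_EFinP; rewrite -FE; exact: (measurable_fubini_G ih).
by rewrite {1}/Ex /Rintegral -[in LHS](integral21_prod_meas1 ih) FE.
Qed.

(** The partial means F and G over the first coordinate are nondecreasing in y, so the
    one-dimensional inequality applies to them under [nu]; for each fixed y, association of [mu]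
    bounds F y * G y by the partial mean of the product. *)
Lemma associated_prod : associated le mu -> associated le_prod (mu \x nu)%E.
Proof.
move=> A f g M mf mg fM gM nf ng.
have mfg : measurable_fun setT (fun z => f z * g z) by exact: measurable_funM.
(* The bounds on f force M >= 0 as soon as E has a point, and it has one because [mu] has mass
   one. *)
have M0 : 0 <= M.
  have [z _] : exists z : R, True by exists 0.
  have := probability_setT mu.
  have [->|/set0P[a _]] := eqVneq (setT : set E) set0.
    by rewrite measure0 => /eqP; rewrite eq_sym onee_eq0.
  by move=> _; exact: le_trans (fM (a, z)).
have fgM z : `|f z * g z| <= M ^+ 2 by rewrite normrM expr2 ler_pM.
have [mF ->] := Ex_prod mf fM; have [mG ->] := Ex_prod mg gM.
have [mH ->] := Ex_prod mfg fgM.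
set F := fun y => Ex mu (fun x => f (x, y)) in mF *.
set G := fun y => Ex mu (fun x => g (x, y)) in mG *.
have bd (h : E * R -> R) (N : R) y : measurable_fun setT h ->
    (forall z, `|h z| <= N) ->
    itg mu (fun x => h (x, y)) /\ `|Ex mu (fun x => h (x, y))| <= N.
  move=> mh hN; have i1 : itg mu (fun x => h (x, y)).
    apply: itg_bounded => //.
    exact: (measurableT_comp mh (measurable_pair2 y)).
  by split=> //; rewrite -(Ex_cst mu N); apply: Ex_norm_le => //; exact: itg_cst.
have FM y : `|F y| <= M by have [] := bd f M y mf fM.
have GM y : `|G y| <= M by have [] := bd g M y mg gM.
have nF : nondecr (fun a b : R => a <= b) F.
  move=> y y' yy'; apply: Ex_le; [by have [] := bd f M y mf fM|
    by have [] := bd f M y' mf fM|by move=> x; apply: nf; split].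
have nG : nondecr (fun a b : R => a <= b) G.
  move=> y y' yy'; apply: Ex_le; [by have [] := bd g M y mg gM|
    by have [] := bd g M y' mg gM|by move=> x; apply: ng; split].
apply: (@le_trans _ _ (Ex nu (fun y => F y * G y))).
  exact: (@associated_real _ nu F G M mF mG FM GM nF nG).
apply: Ex_le.
- by apply: itg_bounded (M ^+ 2) _ _ => // [|y]; [exact: measurable_funM|
    rewrite normrM expr2 ler_pM].
- apply: itg_bounded (M ^+ 2) mH _ => y.
  by have [] := bd _ (M ^+ 2) y mfg fgM.
move=> y; apply: (A _ _ M) => //.
- exact: (measurableT_comp mf (measurable_pair2 y)).
- exact: (measurableT_comp mg (measurable_pair2 y)).
- by move=> a b ab; apply: nf; split=> /=.
- by move=> a b ab; apply: ng; split=> /=.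
Qed.

End association_prod.

(** * Independence from the past *)

Section past_sigma.
Context d (T : measurableType d) (R : realType) (P : probability T R).
Variable xi : int -> T -> R.
Hypothesis xi_meas : forall n, measurable_fun setT (xi n).

Lemma measurable_preimage d1 d2 (T1 : measurableType d1) (T2 : measurableType d2)
  (f : T1 -> T2) (B : set T2) : measurable_fun setT f -> measurable B ->
  measurable (f @^-1` B).
Proof. by move=> mf mB; rewrite -[X in measurable X]setTI; exact: mf. Qed.

Lemma past_sigma_algebra n : sigma_algebra setT (past_sigma xi n).
Proof. exact: smallest_sigma_algebra. Qed.

Lemma past_sigma_preimage n k (B : set R) : k <= n - 1 -> measurable B ->
  past_sigma xi n (xi k @^-1` B).
Proof. by move=> kn mB; apply: sub_sigma_algebra; exists k; split => //; exists B. Qed.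

Lemma past_sigma_mono n m : n <= m -> past_sigma xi n `<=` past_sigma xi m.
Proof.
move=> nm; apply: sub_sigma_algebra2 => A [k [kn h]]; exists k; split=> //.
by rewrite (le_trans kn)// lerD2r.
Qed.

Hypothesis xi_indep : mutually_independent P xi.

(** Dynkin's theorem: finite intersections of events on single past coordinates form a pi-system
    generating the past, and the events independent of a fixed one form a Dynkin system. *)
Lemma past_indep n A (B : set R) : past_sigma xi n A -> measurable B ->
  P (A `&` xi n @^-1` B) = (P A * P (xi n @^-1` B))%E.
Proof.
move=> + mB.
pose G : set (set T) := [set A | exists (I : seq int) (C : int -> set R),
  [/\ uniq I, forall i, i \in I -> i <= n - 1, forall i, measurable (C i) &
   A = \bigcap_(i in [set` I]) (xi i @^-1` C i)]].
have GI : setI_closed G.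
  move=> _ _ [I [C [uI In mC ->]]] [J [D [uJ Jn mD ->]]].
  (* The two index lists are merged; an index absent from one of them contributes no constraint
     there. *)
  exists (undup (I ++ J)), (fun i => (if i \in I then C i else setT) `&`
                                     (if i \in J then D i else setT)).
  split.
  - exact: undup_uniq.
  - by move=> i; rewrite mem_undup mem_cat => /orP[/In|/Jn].
  - by move=> i; apply: measurableI; case: ifP.
  apply/seteqP; split=> w.
    move=> [h1 h2] i /=; rewrite mem_undup mem_cat => _.
    by split; case: ifP => // ij; [exact: h1|exact: h2].
  move=> h; split=> i /= ij.
    by have /= := h i; rewrite mem_undup mem_cat ij => /(_ isT) [].
  by have /= := h i; rewrite mem_undup mem_cat ij orbT => /(_ isT) [].
set C := xi n @^-1` B.
have mC : measurable C by exact: measurable_preimage.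
pose Q := [set A | measurable A /\ P (A `&` C) = (P A * P C)%E].
suff GQ : <<s G >> `<=` Q.
  move=> hA; suff /GQ[] : <<s G >> A by [].
  move: hA; apply: sub_sigma_algebra2 => _ [k [kn [D [mD ->]]]].
  exists [:: k], (fun=> D); split => //.
    by move=> i; rewrite inE => /eqP ->.
  apply/seteqP; split=> w; first by move=> wD i /=; rewrite inE => /eqP ->.
  by apply => /=; rewrite inE.
have PCfin : P C \is a fin_num by exact: fin_num_measure.
rewrite -setI_closed_g_dynkin_g_sigma_algebra//; apply: smallest_sub.
  split.
  - by split; [exact: measurableT|rewrite setTI [P setT]probability_setT mul1e].
  - move=> A' [mA PA]; split; first exact: measurableC.
    have PAfin : P A' \is a fin_num by exact: fin_num_measure.
    rewrite [P (~` A')]probability_setC// muleBl// mul1e -PA setIC -setDE.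
    by rewrite measureD// ?(setIC C)// ltey_eq PCfin.
  - move=> F tF FQ.
    have mF i : measurable (F i) by have [] := FQ i.
    split; first exact: bigcup_measurable.
    rewrite setI_bigcupl measure_bigcup//; first last.
    + by apply: trivIset_setIr.
    + by move=> i _; exact: measurableI.
    rewrite measure_bigcup// [RHS]muleC -(fineK PCfin) -nneseriesZl//.
    by apply: eq_eseriesr => i _; rewrite fineK// muleC; exact: (FQ i).2.
move=> _ [I [D [uI In mD ->]]].
have mcap : measurable (\bigcap_(i in [set` I]) xi i @^-1` D i).
  by apply: fin_bigcap_measurable => // i _; exact: measurable_preimage.
split => //.
have nI : n \notin I by apply/negP => /In; lra.
(* With B placed at the fresh index n, both sides become instances of mutual independence, for n ::
   I and for I. *)
pose D' i := if i == n then B else D i.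
have eqD i : i \in I -> D' i = D i.
  by move=> iI; rewrite /D'; case: eqP => // e; rewrite -e iI in nI.
have -> : \bigcap_(i in [set` I]) xi i @^-1` D i `&` C =
          \bigcap_(i in [set` n :: I]) xi i @^-1` D' i.
  apply/seteqP; split=> w.
    move=> [h Cw] i /=; rewrite inE => /orP[/eqP ->|iI]; rewrite /D'.
      by rewrite eqxx.
    by have := h i iI; rewrite -{1}(eqD _ iI) /D'.
  move=> h; split.
    by move=> i /= iI; have := h i; rewrite /= inE iI orbT (eqD _ iI) => /(_ isT).
  by have := h n; rewrite /= inE eqxx /D' eqxx => /(_ isT).
rewrite xi_indep//=; [|by rewrite nI|by move=> i; rewrite /D'; case: ifP].
rewrite big_cons {1}/D' eqxx muleC xi_indep//; congr (_ * _)%E.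
by rewrite !big_seq; apply: eq_bigr => i iI; rewrite eqD.
Qed.

End past_sigma.

(** * Laws and measurability of pairs *)

Section joint_law.
Context d d' (T : measurableType d) (E : measurableType d') (R : realType).
Variable P : probability T R.

Lemma law_exists d1 (F : measurableType d1) (f : T -> F) :
  measurable_fun setT f ->
  exists mu : probability F R, forall B, measurable B -> P (f @^-1` B) = mu B.
Proof.
move=> mf; pose X : {mfun T >-> F} := mfun_Sub (mem_set mf).
by exists (distribution P X).
Qed.

Variables (mu : probability E R) (nu : probability R R).
Variables (W : T -> E) (Z : T -> R).
Hypothesis mW : measurable_fun setT W.
Hypothesis mZ : measurable_fun setT Z.
Hypothesis lawW : forall B, measurable B -> P (W @^-1` B) = mu B.
Hypothesis lawZ : forall B, measurable B -> P (Z @^-1` B) = nu B.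
Hypothesis indep : forall A B, measurable A -> measurable B ->
  P (W @^-1` A `&` Z @^-1` B) = (P (W @^-1` A) * P (Z @^-1` B))%E.

Lemma law_pair C : measurable C ->
  P ((fun w => (W w, Z w)) @^-1` C) = (mu \x nu)%E C.
Proof.
move=> mC; have mWZ := measurable_fun_pair mW mZ.
have [m' hm'] := law_exists mWZ.
rewrite hm'//; have -> // := @product_measure_unique _ _ _ _ _ mu nu m'.
move=> A B mA mB; apply: etrans (esym (hm' _ (measurableX mA mB))) _.
exact: etrans (indep mA mB) (f_equal2 mule (lawW mA) (lawZ mB)).
Qed.

End joint_law.

(** The past is a bare set of sets rather than the structure of a measurable type, so measurability
    of a pair is checked on rectangles and extended to the generated sigma-algebra. *)
Lemma sigma_algebra_pair d d1 d2 (T : measurableType d) (E : measurableType d1)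
  (F : measurableType d2) (S : set (set T)) (W : T -> E) (Z : T -> F) :
  sigma_algebra setT S -> (forall A, measurable A -> S (W @^-1` A)) ->
  (forall B, measurable B -> S (Z @^-1` B)) ->
  forall C, measurable C -> S ((fun w => (W w, Z w)) @^-1` C).
Proof.
move=> sS SW SZ C; have [S0 SC SU] := sS.
have SC' D : S D -> S (~` D) by move=> SD; rewrite -setTD; exact: SC.
have SI A B : S A -> S B -> S (A `&` B).
  move=> SA SB; rewrite -[A `&` B]setCK setCI; apply: (SC').
  rewrite -bigcup2E; apply: SU => k.
  case: k => [|[|k]]; rewrite /bigcup2/=.
  - exact: (SC' _ SA).
  - exact: (SC' _ SB).
  - exact: S0.
rewrite measurable_prod_measurableType; apply: (@smallest_sub _ _ _ [set D | S ((fun w => (W w, Z w)) @^-1` D)]).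
  split=> [|A SA|F' SF].
  - by rewrite /= preimage_set0.
  - by rewrite /= setTD preimage_setC; exact: SC'.
  - by rewrite /= preimage_bigcup; exact: SU.
move=> _ [A mA [B mB <-]] /=.
rewrite (_ : _ @^-1` _ = W @^-1` A `&` Z @^-1` B)//.
by apply: SI; [exact: SW|exact: SZ].
Qed.

(* [shrink s = s / (1 + s)] turns a variance into a bounded quantity, so that the
   generalized inverse of Lambda below is a supremum of a bounded set. *)
Section generalized_inverse.
Context (R : realType) (Lambda : R -> R).
Hypothesis Lambda_incr : forall x y, 0 <= x -> x < y -> Lambda x < Lambda y.

Definition shrink (s : R) : R := 1 - (1 + s)^-1.
Definition unshrink (z : R) : R := (1 - z) `^ (-1) - 1.
(** Adjoining 0 keeps the set nonempty when y lies below the range of [Lambda]; this makes [ginv]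
    nonnegative and nondecreasing on the whole line, hence measurable. *)
Definition ginv (y : R) : R :=
  sup [set z | z = 0 \/ exists x, [/\ 0 <= x, Lambda x <= y & z = shrink x]].

Lemma shrink_lt1 s : 0 <= s -> shrink s < 1.
Proof. by move=> s0; rewrite /shrink gtrBl invr_gt0 ltr_pwDl. Qed.

Lemma shrink_ge0 s : 0 <= s -> 0 <= shrink s.
Proof.
by move=> s0; rewrite /shrink subr_ge0 invf_le1 ?lerDl// ltr_pwDl.
Qed.

Lemma shrink_le s s' : 0 <= s -> s <= s' -> shrink s <= shrink s'.
Proof.
move=> s0 ss'; rewrite /shrink lerB// lef_pV2 ?lerD2l// posrE ltr_pwDl//.
exact: le_trans ss'.
Qed.

Lemma shrinkK s : 0 <= s -> unshrink (shrink s) = s.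
Proof.
move=> s0; rewrite /unshrink /shrink subKr powR_inv1; last first.
  by rewrite invr_ge0 addr_ge0.
by rewrite invrK addrC addKr.
Qed.

Lemma unshrink_le z z' : z <= z' -> z' < 1 -> unshrink z <= unshrink z'.
Proof.
move=> zz' z'1; have z1 := le_lt_trans zz' z'1.
have inv y : y < 1 -> (1 - y) `^ (-1) = (1 - y)^-1.
  by move=> y1; rewrite powR_inv1// subr_ge0 ltW.
by rewrite /unshrink lerD2r !inv// lef_pV2 ?posrE ?subr_gt0// lerB.
Qed.

Lemma unshrink_ge0 z : 0 <= z -> z < 1 -> 0 <= unshrink z.
Proof.
move=> z0 z1; apply: le_trans (unshrink_le z0 z1).
by rewrite /unshrink subr0 powR1 subrr.
Qed.

Lemma measurable_unshrink : measurable_fun setT unshrink.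
Proof.
apply: measurable_funB => //; apply: (measurableT_comp (measurable_powR _)).
exact: measurable_funB.
Qed.

Let gset y := [set z | z = 0 \/ exists x, [/\ 0 <= x, Lambda x <= y & z = shrink x]].

Let gset_ub y : ubound (gset y) 1.
Proof. by move=> z [->|[x [x0 _ ->]]]; rewrite ?ler01// ltW ?shrink_lt1. Qed.

Lemma ginv_ge0 y : 0 <= ginv y.
Proof. by apply: ub_le_sup; [exists 1; exact: gset_ub|left]. Qed.

Lemma ginv_le y y' : y <= y' -> ginv y <= ginv y'.
Proof.
move=> yy'; apply: ge_sup; first by exists 0; left.
move=> z zy; apply: ub_le_sup; first by exists 1; exact: gset_ub.
by case: zy => [->|[x [x0 xy ->]]]; [left|right; exists x; rewrite (le_trans xy)].
Qed.

Lemma measurable_ginv : measurable_fun setT ginv.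
Proof. by apply: nondecreasing_measurable => // y y'; exact: ginv_le. Qed.

(** Strict monotonicity makes s the largest x with Lambda x <= Lambda s, so the supremum is attained
    there. *)
Lemma ginvK s : 0 <= s -> ginv (Lambda s) = shrink s.
Proof.
move=> s0; apply/eqP; rewrite eq_le; apply/andP; split.
  apply: ge_sup; first by exists 0; left.
  move=> _ [->|[x [x0 xs ->]]]; first exact: shrink_ge0.
  apply: shrink_le => //; rewrite leNgt; apply/negP => /(Lambda_incr s0).
  by rewrite ltNge xs.
apply: ub_le_sup; first by exists 1; exact: gset_ub.
by right; exists s.
Qed.

End generalized_inverse.

(** * The GARCH recursion *)

Section garch_representation.
Context d (Omega : measurableType d) (R : realType) (P : probability Omega R).
Variables (xi sigma : int -> Omega -> R) (phi : R * R -> R) (Lambda : R -> R).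
Hypothesis xi_meas : forall n, measurable_fun setT (xi n).
Hypothesis xi_indep : mutually_independent P xi.
Hypothesis xi_ident : identically_distributed P xi.
Hypothesis sigma_meas : forall n, measurable_fun setT (sigma n).
Hypothesis sigma_stat : stationary P sigma.
Hypothesis sigma_past : forall n, measurable_wrt (past_sigma xi n) (sigma n).
Hypothesis phi_meas : measurable_fun setT phi.
Hypothesis phi_mono : forall a a' b b', a <= a' -> b <= b' ->
  phi (a, b) <= phi (a', b').
Hypothesis Lambda_meas : measurable_fun (`[0, +oo[%classic : set R) Lambda.
Hypothesis Lambda_incr : forall x y, 0 <= x -> x < y -> Lambda x < Lambda y.
Hypothesis rec : forall n w, Lambda (sigma n w ^+ 2) =
  phi (Lambda (sigma (n - 1) w ^+ 2), xi (n - 1) w ^+ 2).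

Let measurable_Lambda_sqr : measurable_fun setT (fun s : R => Lambda (s ^+ 2)).
Proof.
apply: (measurable_comp _ _ Lambda_meas (g := fun s : R => s ^+ 2)) => //.
by move=> _ [s _ <-] /=; rewrite in_itv/= andbT sqr_ge0.
Qed.

Let measurable_sqr : measurable_fun setT (fun s : R => s ^+ 2).
Proof. exact: measurable_funX. Qed.

(* A finite stretch of the process, of length n and with arbitrary starting
   point j, is a coordinatewise monotone image of a single associated law mu. *)
Lemma garch_representation (n : nat) :
  exists d' (E : measurableType d') (le : E -> E -> Prop) (mu : probability E R)
    (l : E -> R) (u x : nat -> E -> R),
  [/\ forall a, le a a, associated le mu,
    measurable_fun setT l /\ nondecr le l,
    forall k, (k < n)%N -> [/\ measurable_fun setT (u k), measurable_fun setT (x k),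
      nondecr le (u k), nondecr le (x k) & forall e, 0 <= u k e /\ 0 <= x k e] &
    forall j : int, exists W : Omega -> E,
    [/\ measurable_fun setT W,
      forall B, measurable B -> past_sigma xi (j + n%:Z) (W @^-1` B),
      forall B, measurable B -> P (W @^-1` B) = mu B,
      forall w, l (W w) = Lambda (sigma (j + n%:Z) w ^+ 2) &
      forall k, (k < n)%N -> forall w,
        u k (W w) = shrink (sigma (j + k%:Z) w ^+ 2) /\
        x k (W w) = xi (j + k%:Z) w ^+ 2]].
Proof.
(* For n = 0 the vector is Lambda(sigma_j^2) alone: its law is free of j by stationarity of [sigma],
   and every law on the line is associated. *)
elim: n => [|n [d' [E [le [mu [l [u [x [le_refl Amu [ml nl] ux HW]]]]]]]]].
  have mL j : measurable_fun setT (fun w => Lambda (sigma j w ^+ 2)).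
    exact: (measurableT_comp measurable_Lambda_sqr).
  have [mu lawmu] := law_exists P (mL 0).
  exists default_measure_display, R, (fun a b => a <= b), mu, id.
  exists (fun _ _ => 0), (fun _ _ => 0); split => //; [exact: associated_real|by split|].
  move=> j; exists (fun w => Lambda (sigma (j + 0%:Z) w ^+ 2)).
  have mB B : measurable B -> measurable ((fun s : R => Lambda (s ^+ 2)) @^-1` B).
    exact: measurable_preimage.
  split => //.
    by move=> B /mB /sigma_past.
  move=> B mB'; rewrite -lawmu//.
  have := @sigma_stat j [:: 0] (fun=> (fun s : R => Lambda (s ^+ 2)) @^-1` B) (fun=> mB _ mB').
  have -> : [set` [:: 0 : int]] = [set 0].
    by apply/seteqP; split=> i /=; rewrite inE; [move/eqP|move=> ->].
  by rewrite !bigcap_set1 add0r addr0.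
have mxi2 j : measurable_fun setT (fun w => xi j w ^+ 2).
  exact: (measurableT_comp measurable_sqr).
have [nu lawnu] := law_exists P (mxi2 0).
(* The squared innovation at time j + n becomes a new coordinate. The old [l] is
   Lambda(sigma_(j+n)^2), so [ginv] of it gives the new [u], while [phi] advances [l] by one step.
   The maximum with 0 keeps [x] nonnegative at points that a square never reaches. *)
exists _, (E * R)%type, (le_prod le), (mu \x nu)%E, (fun z => phi (l z.1, z.2)).
exists (fun k z => if (k < n)%N then u k z.1 else ginv Lambda (l z.1)).
exists (fun k z => if (k < n)%N then x k z.1 else Num.max z.2 0).
split.
- by move=> a; split.
- exact: associated_prod.
- split; last by move=> a b [ab1 ab2]; apply: phi_mono => //; exact: nl.
  apply: (measurableT_comp phi_meas); apply: measurable_fun_pair => //.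
  exact: (measurableT_comp ml).
- move=> k _; case: (ltnP k n) => kn.
    have [mu' mx nu' nx ge0] := ux k kn; split.
    + exact: (measurableT_comp mu').
    + exact: (measurableT_comp mx).
    + by move=> a b [ab _]; exact: nu'.
    + by move=> a b [ab _]; exact: nx.
    + by move=> e; exact: ge0.
  split.
  + apply: (measurableT_comp (measurable_ginv Lambda)); exact: (measurableT_comp ml).
  + exact: measurable_maxr.
  + by move=> a b [ab _]; apply: ginv_le; exact: nl.
  + by move=> a b [_ ab]; rewrite ge_max !le_max ab lexx !orbT.
  + by move=> e; rewrite ginv_ge0 le_max lexx orbT.
move=> j; have [W [mW pastW lawW lW uxW]] := HW j.
have jn : j + n.+1%:Z - 1 = j + n%:Z by rewrite -addn1 PoszD; ring.
have pastn : past_sigma xi (j + n%:Z) `<=` past_sigma xi (j + n.+1%:Z).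
  by apply: past_sigma_mono; rewrite lerD2l lez_nat.
exists (fun w => (W w, xi (j + n%:Z) w ^+ 2)); split.
- exact: measurable_fun_pair.
- apply: sigma_algebra_pair; first exact: past_sigma_algebra.
    by move=> B mB; apply: pastn; exact: pastW.
  move=> B mB.
  apply: (@past_sigma_preimage _ _ _ _ _ _ ((fun s => s ^+ 2) @^-1` B)).
    by rewrite jn.
  exact: measurable_preimage.
- apply: law_pair => //.
    move=> B mB; rewrite -lawnu//.
    exact: (xi_ident (j + n%:Z) (measurable_preimage measurable_sqr mB)).
  (* [W] depends only on innovations before time j + n, so it is independent of the one at j + n;
     the induction carries the past measurability of [W] for this purpose. *)
  move=> A B mA mB.
  exact: (past_indep xi_meas xi_indep (pastW _ mA) (measurable_preimage measurable_sqr mB)).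
- by move=> w /=; rewrite lW [RHS]rec jn.
- move=> k; rewrite ltnS => kn w /=; case: ifP => kn'; first exact: uxW.
  have -> : k = n by apply/eqP; rewrite eqn_leq kn leqNgt kn'.
  by rewrite lW ginvK ?sqr_ge0//; split=> //; apply: max_l; exact: sqr_ge0.
Qed.

End garch_representation.

(** * Covariances of increasing variables *)

Section clip.
Context (R : realType).

Definition clip (N x : R) : R := Num.max (- N) (Num.min x N).

Lemma clip_le N x y : x <= y -> clip N x <= clip N y.
Proof.
move=> xy; rewrite /clip ge_max !le_max lexx/=; apply/orP; right.
by rewrite le_min !ge_min lexx xy orbT.
Qed.

Lemma norm_clip_le N x : 0 <= N -> `|clip N x| <= N.
Proof.
move=> N0; rewrite ler_norml /clip le_max lexx/= ge_max ge_min lexx orbT andbT.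
lra.
Qed.

Lemma clip_id N x : `|x| <= N -> clip N x = x.
Proof. by rewrite ler_norml /clip => /andP[h1 h2]; rewrite min_l// max_r. Qed.

Lemma norm_clip_le_norm N x : 0 <= N -> `|clip N x| <= `|x|.
Proof.
move=> N0; have [h|h] := leP `|x| N; first by rewrite clip_id.
exact: le_trans (norm_clip_le x N0) (ltW h).
Qed.

Lemma measurable_clip N : measurable_fun setT (clip N).
Proof. by apply: measurable_maxr => //; exact: measurable_minr. Qed.

Lemma clip_cvg x : (fun n : nat => clip n%:R x) @ \oo --> x.
Proof.
have /archi_boundP := normr_ge0 x; set m := Num.bound _ => xm.
apply: cvg_near_cst; exists m => // n /= mn.
by rewrite clip_id// (le_trans (ltW xm))// ler_nat.
Qed.

End clip.

Section increasing_variables.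
Context d d' (T : measurableType d) (E : measurableType d') (R : realType).
Variables (P : probability T R) (mu : probability E R) (W : T -> E).
Variables (le : E -> E -> Prop) (h : E -> R).
Hypothesis mW : measurable_fun setT W.
Hypothesis lawW : forall B, measurable B -> P (W @^-1` B) = mu B.
Hypothesis Amu : associated le mu.
Hypothesis mh : measurable_fun setT h.
Hypothesis nh : nondecr le h.
Hypothesis hW : forall w, h (W w) < 1.

(* The range of W lies in the lower set [h < 1], outside of which the
   coordinates of interest need not be monotone. *)
Definition increasing (Z : T -> R) := exists z : E -> R,
  [/\ measurable_fun setT z, forall a b, le a b -> h b < 1 -> z a <= z b &
      forall w, Z w = z (W w)].

Lemma increasing_meas Z : increasing Z -> measurable_fun setT Z.
Proof.
move=> [z [mz _ Zz]]; rewrite (_ : Z = z \o W); last by apply/funext.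
exact: measurableT_comp.
Qed.

Lemma increasing_comp2 (F : R * R -> R) Z1 Z2 : measurable_fun setT F ->
  (forall a a' b b', a <= a' -> b <= b' -> F (a, b) <= F (a', b')) ->
  increasing Z1 -> increasing Z2 -> increasing (fun w => F (Z1 w, Z2 w)).
Proof.
move=> mF nF [z1 [m1 n1 e1]] [z2 [m2 n2 e2]].
exists (fun e => F (z1 e, z2 e)); split.
- by apply: (measurableT_comp mF); exact: measurable_fun_pair.
- by move=> a b ab hb; apply: nF; [exact: n1|exact: n2].
- by move=> w; rewrite e1 e2.
Qed.

(** As h is nondecreasing, h < 1 defines a lower set. Giving the maximal value N outside it turns a
    function monotone on this set into one monotone everywhere, with the same composite with [W]. *)
Let trunc (N : R) (z : E -> R) e := if h e < 1 then clip N (z e) else N.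

Let measurable_trunc N z : measurable_fun setT z -> measurable_fun setT (trunc N z).
Proof.
move=> mz; apply: measurable_fun_ifT => //.
  exact: measurable_fun_ltr.
exact: (measurableT_comp (measurable_clip N)).
Qed.

Let norm_trunc N z e : 0 <= N -> `|trunc N z e| <= N.
Proof.
by move=> N0; rewrite /trunc; case: ifP => _; rewrite ?norm_clip_le// ger0_norm.
Qed.

Let nondecr_trunc N z : 0 <= N ->
  (forall a b, le a b -> h b < 1 -> z a <= z b) -> nondecr le (trunc N z).
Proof.
move=> N0 nz a b ab; rewrite /trunc; case: (ltP (h b) 1) => hb.
  by rewrite (le_lt_trans (nh ab) hb); apply: clip_le; exact: nz.
case: ifP => // _; apply: le_trans (norm_clip_le (z a) N0); exact: ler_norm.
Qed.

(** Association applies to the truncations at level n; square integrability gives the domination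
    needed to let n tend to infinity. *)
Lemma Cov_increasing_ge0 Z1 Z2 : increasing Z1 -> increasing Z2 ->
  sqi P Z1 -> sqi P Z2 -> 0 <= Cov P Z1 Z2.
Proof.
move=> [z1 [mz1 nz1 e1]] [z2 [mz2 nz2 e2]] s1 s2.
have [m1 m2] := (sqi_meas s1, sqi_meas s2).
have mclip (Z : T -> R) (n : nat) : measurable_fun setT Z ->
    measurable_fun setT (fun w => clip n%:R (Z w)).
  exact: (measurableT_comp (measurable_clip n%:R)).
have key (n : nat) : Ex P (fun w => clip n%:R (Z1 w)) * Ex P (fun w => clip n%:R (Z2 w))
    <= Ex P (fun w => clip n%:R (Z1 w) * clip n%:R (Z2 w)).
  have n0 : 0 <= n%:R :> R by [].
  have t1 w : clip n%:R (Z1 w) = trunc n%:R z1 (W w) by rewrite /trunc hW e1.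
  have t2 w : clip n%:R (Z2 w) = trunc n%:R z2 (W w) by rewrite /trunc hW e2.
  under eq_fun do rewrite t1.
  under [X in _ * Ex _ X]eq_fun do rewrite t2.
  under [X in _ <= Ex _ X]eq_fun do rewrite t1 t2.
  have mt1 := measurable_trunc n%:R mz1; have mt2 := measurable_trunc n%:R mz2.
  rewrite (Ex_law mW lawW (f := trunc n%:R z1)); last first.
    by apply: itg_bounded mt1 _ => e; exact: norm_trunc.
  rewrite (Ex_law mW lawW (f := trunc n%:R z2)); last first.
    by apply: itg_bounded mt2 _ => e; exact: norm_trunc.
  rewrite (Ex_law mW lawW (f := fun e => trunc n%:R z1 e * trunc n%:R z2 e)).
    apply: (@Amu _ _ n%:R) => // [e|e||]; try exact: norm_trunc;
      exact: nondecr_trunc.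
  apply: sqiM; apply: (@sqi_bounded _ _ _ _ _ n%:R) => // e; exact: norm_trunc.
have c (Z : T -> R) : sqi P Z ->
    (fun n : nat => Ex P (fun w => clip n%:R (Z w))) @ \oo --> Ex P Z.
  move=> sZ; apply: (@Ex_cvg _ _ _ _ _ _ (fun w => `|Z w|)) => //.
  - by move=> n; apply: mclip; exact: sqi_meas sZ.
  - exact: sqi_meas sZ.
  - by apply: itg_norm; exact: sqi_itg.
  - by move=> n w; exact: norm_clip_le_norm.
  - by move=> w; exact: clip_cvg.
have c12 : (fun n : nat => Ex P (fun w => clip n%:R (Z1 w) * clip n%:R (Z2 w)))
    @ \oo --> Ex P (fun w => Z1 w * Z2 w).
  apply: (@Ex_cvg _ _ _ _ _ _ (fun w => `|Z1 w * Z2 w|)).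
  - by move=> n; apply: measurable_funM; exact: mclip.
  - exact: measurable_funM.
  - by apply: itg_norm; exact: sqiM.
  - by move=> n w; rewrite !normrM ler_pM// norm_clip_le_norm.
  - by move=> w; apply: cvgM; exact: clip_cvg.
rewrite subr_ge0; exact: (ler_cvg_to (cvgM (c _ s1) (c _ s2)) c12 (nearW _ key)).
Qed.

End increasing_variables.

(** * Association and stationarity in abstract form *)

Section interface.
Context d (T : measurableType d) (R : realType) (P : probability T R).

(* [C] stands for the nondecreasing measurable functions of the variables that
   belong to it. *)
Definition positively_correlated (C : (T -> R) -> Prop) :=
  [/\ forall Z, C Z -> measurable_fun setT Z,
      forall (F : R * R -> R) Z1 Z2, measurable_fun setT F ->
        (forall a a' b b', a <= a' -> b <= b' -> F (a, b) <= F (a', b')) ->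
        C Z1 -> C Z2 -> C (fun w => F (Z1 w, Z2 w)) &
      forall Z1 Z2, C Z1 -> C Z2 -> sqi P Z1 -> sqi P Z2 -> 0 <= Cov P Z1 Z2].

(** The class may depend on n: for the GARCH squares, the space on which the monotone functions live
    grows with the length of the stretch. *)
Definition associated_seq (Y : nat -> T -> R) := forall n : nat,
  exists2 C, positively_correlated C & forall k, (k < n)%N -> C (Y k).

(** Every stretch of length l is one fixed function of a vector whose law does not depend on the
    starting point, so expectations transfer by change of variables. *)
Definition stationary_seq (Q : int -> T -> R) := forall l : nat,
  exists d' (E : measurableType d') (mu : probability E R) (q : nat -> E -> R),
    (forall k, measurable_fun setT (q k)) /\
    forall j : int, exists W : T -> E,
    [/\ measurable_fun setT W, forall B, measurable B -> P (W @^-1` B) = mu B &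
      forall k, (k < l)%N -> forall w, Q (j + k%:Z) w = q k (W w)].

Lemma associated_seq_shift (Y : nat -> T -> R) (m : R) :
  associated_seq Y -> associated_seq (fun k w => Y k w - m).
Proof.
move=> AY n; have [C [mC compC covC] CY] := AY n; exists C => // k kn.
apply: (compC (fun z => z.1 - m) _ _ _ _ (CY k kn) (CY k kn)).
  exact: measurable_funB.
by move=> a a' b b' aa' _ /=; rewrite lerD2r.
Qed.

Section stationary.
Variable Q : int -> T -> R.
Hypothesis SQ : stationary_seq Q.

Lemma stationary_meas j : measurable_fun setT (Q j).
Proof.
have [d' [E [mu [q [mq HW]]]]] := SQ 1%N.
have [W [mW _ e]] := HW j; rewrite (_ : Q j = q 0%N \o W).
  exact: measurableT_comp.
by apply/funext => w; have := e 0%N isT w; rewrite addr0.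
Qed.

Lemma stationary_sum (l : nat) (i j : int) (F : R -> R) : measurable_fun setT F ->
  itg P (fun w => F (\sum_(k < l) Q (i + k%:Z) w)) ->
  itg P (fun w => F (\sum_(k < l) Q (j + k%:Z) w)) /\
  Ex P (fun w => F (\sum_(k < l) Q (j + k%:Z) w)) =
  Ex P (fun w => F (\sum_(k < l) Q (i + k%:Z) w)).
Proof.
move=> mF; have [d' [E [mu [q [mq HW]]]]] := SQ l.
have [Wi [mWi lawi ei]] := HW i; have [Wj [mWj lawj ej]] := HW j.
pose f e := F (\sum_(k < l) q k e).
have mf : measurable_fun setT f.
  by apply: (measurableT_comp mF); exact: measurable_sum.
have -> : (fun w => F (\sum_(k < l) Q (i + k%:Z) w)) = (fun w => f (Wi w)).
  by apply/funext => w; congr F; apply: eq_bigr => k _; exact: ei.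
have -> : (fun w => F (\sum_(k < l) Q (j + k%:Z) w)) = (fun w => f (Wj w)).
  by apply/funext => w; congr F; apply: eq_bigr => k _; exact: ej.
move=> /(itg_law mWi lawi mf).1 h; split; first exact/(itg_law mWj lawj mf).
by rewrite (Ex_law mWi lawi h) (Ex_law mWj lawj h).
Qed.

Lemma stationary_prod (k : nat) (i j : int) :
  itg P (fun w => Q i w * Q (i + k%:Z) w) ->
  itg P (fun w => Q j w * Q (j + k%:Z) w) /\
  Ex P (fun w => Q j w * Q (j + k%:Z) w) = Ex P (fun w => Q i w * Q (i + k%:Z) w).
Proof.
have [d' [E [mu [q [mq HW]]]]] := SQ k.+1.
have [Wi [mWi lawi ei]] := HW i; have [Wj [mWj lawj ej]] := HW j.
pose f e := q 0%N e * q k e.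
have mf : measurable_fun setT f by exact: measurable_funM.
have -> : (fun w => Q i w * Q (i + k%:Z) w) = (fun w => f (Wi w)).
  by apply/funext => w; rewrite /f -ei// -ei// addr0.
have -> : (fun w => Q j w * Q (j + k%:Z) w) = (fun w => f (Wj w)).
  by apply/funext => w; rewrite /f -ej// -ej// addr0.
move=> /(itg_law mWi lawi mf).1 h; split; first exact/(itg_law mWj lawj mf).
by rewrite (Ex_law mWi lawi h) (Ex_law mWj lawj h).
Qed.

Lemma stationary_one (i j : int) (F : R -> R) : measurable_fun setT F ->
  itg P (fun w => F (Q i w)) ->
  itg P (fun w => F (Q j w)) /\ Ex P (fun w => F (Q j w)) = Ex P (fun w => F (Q i w)).
Proof.
move=> mF; have := @stationary_sum 1 i j F mF.
by under eq_fun do rewrite big_ord1 addr0;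
  under [X in _ -> itg P X /\ Ex P X = _]eq_fun do rewrite big_ord1 addr0.
Qed.

End stationary.
End interface.

(** * The squared GARCH process is stationary and associated *)

Section garch.
Context d (Omega : measurableType d) (R : realType) (P : probability Omega R).
Variables (xi sigma X : int -> Omega -> R) (phi : R * R -> R) (Lambda : R -> R).
Hypothesis xi_meas : forall n, measurable_fun setT (xi n).
Hypothesis xi_indep : mutually_independent P xi.
Hypothesis xi_ident : identically_distributed P xi.
Hypothesis sigma_meas : forall n, measurable_fun setT (sigma n).
Hypothesis sigma_stat : stationary P sigma.
Hypothesis sigma_past : forall n, measurable_wrt (past_sigma xi n) (sigma n).
Hypothesis phi_meas : measurable_fun setT phi.
Hypothesis phi_mono : forall a a' b b', a <= a' -> b <= b' ->
  phi (a, b) <= phi (a', b').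
Hypothesis Lambda_meas : measurable_fun (`[0, +oo[%classic : set R) Lambda.
Hypothesis Lambda_incr : forall x y, 0 <= x -> x < y -> Lambda x < Lambda y.
Hypothesis rec : forall n w, Lambda (sigma n w ^+ 2) =
  phi (Lambda (sigma (n - 1) w ^+ 2), xi (n - 1) w ^+ 2).
Hypothesis X_def : forall n w, X n w = sigma n w * xi n w.

Let repr := garch_representation xi_meas xi_indep xi_ident sigma_meas
  sigma_stat sigma_past phi_meas phi_mono Lambda_meas Lambda_incr rec.

Let sqX j w (u x : R) : u = shrink (sigma j w ^+ 2) -> x = xi j w ^+ 2 ->
  X j w ^+ 2 = unshrink u * x.
Proof. by move=> -> ->; rewrite shrinkK ?sqr_ge0// X_def exprMn. Qed.

Lemma garch_stationary : stationary_seq P (fun j w => X j w ^+ 2).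
Proof.
move=> l; have [d' [E [le [mu [L [u [x [_ _ _ ux HW]]]]]]]] := repr l.
exists d', E, mu, (fun k e => if (k < l)%N then unshrink (u k e) * x k e else 0).
split.
  move=> k; case: (ltnP k l) => // /ux[mu' mx _ _ _]; apply: measurable_funM => //.
  exact: (measurableT_comp (@measurable_unshrink R)).
move=> j; have [W [mW _ lawW _ e]] := HW j; exists W; split => // k kl w.
by rewrite kl; have [e1 e2] := e k kl w; exact: sqX.
Qed.

Lemma garch_associated : associated_seq P (fun k w => X k.+1%:Z w ^+ 2).
Proof.
move=> n; have [d' [E [le [mu [L [u [x [_ Amu _ ux HW]]]]]]]] := repr n.
have [W [mW _ lawW _ e]] := HW 1.
(* The witness is the maximum of the [u k]. Where it is below 1, each [unshrink (u k)] is monotone;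
   on the range of [W] it is below 1 because every [u k] is a shrunk variance there. *)
have [h [mh nh uh hW]] : exists h : E -> R, [/\ measurable_fun setT h, nondecr le h,
    forall k, (k < n)%N -> forall e, u k e <= h e & forall w, h (W w) < 1].
  suff H m : (m <= n)%N -> exists h : E -> R, [/\ measurable_fun setT h,
    nondecr le h, forall k, (k < m)%N -> forall e, u k e <= h e &
    forall w, h (W w) < 1] by exact: H.
  elim: m => [_|m IH mn].
    by exists (fun=> 0); split => // ? ? _.
  have [h [mh nh uh hW]] := IH (ltnW mn); have [mum _ num _ _] := ux m mn.
  exists (fun e => Num.max (h e) (u m e)); split.
  - exact: measurable_maxr.
  - by move=> a b ab; rewrite ge_max !le_max (nh _ _ ab) (num _ _ ab) orbT.
  - move=> k; rewrite ltnS leq_eqVlt => /orP[/eqP ->|km] e'.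
      by rewrite le_max lexx orbT.
    by rewrite le_max uh.
  - move=> w; rewrite gt_max hW; have [-> _] := e m mn w.
    by apply: shrink_lt1; exact: sqr_ge0.
exists (increasing W le h).
  split.
  - by move=> Z; exact: increasing_meas.
  - by move=> F Z1 Z2; exact: increasing_comp2.
  - by move=> Z1 Z2; exact: (Cov_increasing_ge0 mW lawW Amu mh nh hW).
move=> k kn; have [mu' mx nu nx ge0] := ux k kn.
exists (fun e => unshrink (u k e) * x k e); split.
- apply: measurable_funM => //.
  exact: (measurableT_comp (@measurable_unshrink R)).
- move=> a b ab hb; have ub : u k b < 1 by apply: le_lt_trans hb; exact: uh.
  have [ua0 xa0] := ge0 a; apply: ler_pM => //; last exact: nx.
    by apply: unshrink_ge0 => //; apply: le_lt_trans ub; exact: nu.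
  by apply: unshrink_le => //; exact: nu.
- by move=> w; have [e1 e2] := e k kn w; apply: sqX; rewrite ?e1 ?e2// -addn1 PoszD addrC.
Qed.

End garch.

(** * Covariances of Lipschitz functions *)

Section lipschitz.
Context (R : realType).

Definition lip (K : R) (f : R -> R) := forall x y, `|f x - f y| <= K * `|x - y|.

Lemma lip_ge0 K f : lip K f -> 0 <= K.
Proof.
move=> h; have := h 1 0; rewrite subr0 normr1 mulr1; exact: le_trans.
Qed.

Lemma lip_continuous K f : lip K f -> continuous f.
Proof.
move=> h x; have K0 := lip_ge0 h; apply/cvgrPdist_lt => e e0; near=> y.
apply: le_lt_trans (h _ _) _; apply: (@le_lt_trans _ _ ((K + 1) * `|x - y|)).
  by rewrite ler_wpM2r// lerDl.
rewrite -ltr_pdivlMl ?ltr_wpDl// mulrC; near: y.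
by apply: cvgr_dist_lt; [exact: cvg_id|rewrite divr_gt0// ltr_wpDl].
Unshelve. all: end_near. Qed.

Lemma lip_measurable K f : lip K f -> measurable_fun setT f.
Proof. by move=> /lip_continuous; exact: continuous_measurable_fun. Qed.

Lemma lip_norm_le K f x : lip K f -> `|f x| <= `|f 0| + K * `|x|.
Proof.
move=> h; have := h x 0; rewrite subr0 => hx.
by rewrite -[f x](subrK (f 0)) (le_trans (ler_normD _ _))// addrC lerD2l.
Qed.

End lipschitz.

Section positive_correlation.
Context d (T : measurableType d) (R : realType) (P : probability T R).

Lemma sqi_lip K (f : R -> R) U : lip K f -> sqi P U -> sqi P (fun w => f (U w)).
Proof.
move=> lf sU; have K0 := lip_ge0 lf.
have sN : sqi P (fun w => `|U w|).
  apply: (sqi_le _ sU) => [|w]; last by rewrite normr_id.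
  by apply: measurableT_comp => //; exact: sqi_meas sU.
apply: (sqi_le _ (sqiD (sqi_cst P `|f 0|) (sqiZ K sN))).
  exact: (measurableT_comp (lip_measurable lf) (sqi_meas sU)).
move=> w; rewrite [leRHS]ger0_norm ?addr_ge0 ?mulr_ge0//.
exact: lip_norm_le.
Qed.

Variable C : (T -> R) -> Prop.
Hypothesis HC : positively_correlated P C.

Lemma pc_comp (f : R -> R) Z : measurable_fun setT f -> (forall x y, x <= y -> f x <= f y) ->
  C Z -> C (fun w => f (Z w)).
Proof.
have [_ comp _] := HC; move=> mf nf CZ.
apply: (comp (fun z => f z.1) _ _ _ _ CZ CZ).
  exact: (measurableT_comp mf).
by move=> a a' b b' aa' _; exact: nf.
Qed.

Lemma pc_add Z1 Z2 : C Z1 -> C Z2 -> C (fun w => Z1 w + Z2 w).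
Proof.
have [_ comp _] := HC; apply: (comp (fun z => z.1 + z.2)).
  exact: measurable_funD.
by move=> a a' b b' *; exact: lerD.
Qed.

Lemma pc_scale (c : R) Z : 0 <= c -> C Z -> C (fun w => c * Z w).
Proof.
move=> c0; apply: pc_comp; first exact: measurable_funM.
by move=> x y xy; exact: ler_wpM2l.
Qed.

(** The member Z accounts for the empty sum, since the zero function enters the class as 0 * Z. *)
Lemma pc_sum (N : nat) (F : nat -> T -> R) Z : C Z ->
  (forall i, (i < N)%N -> C (F i)) -> C (fun w => \sum_(i < N) F i w).
Proof.
move=> CZ; elim: N => [_|N IH CF].
  have /= := pc_scale (lexx 0) CZ.
  by under eq_fun do rewrite mul0r; under [X in _ -> C X]eq_fun do rewrite big_ord0.
under eq_fun do rewrite big_ord_recr.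
by apply: pc_add; [apply: IH => i iN; apply: CF; exact: ltnW|exact: CF].
Qed.

Let lip_up (K : R) (f : R -> R) : lip K f -> forall x y, x <= y -> K * x + f x <= K * y + f y.
Proof.
move=> lf x y xy; have := lf x y; rewrite distrC [`|x - y|]distrC.
rewrite [`|y - x|]ger0_norm ?subr_ge0// => /ler_normlP[h1 h2]; nra.
Qed.

Let lip_down (K : R) (f : R -> R) : lip K f -> forall x y, x <= y -> K * x - f x <= K * y - f y.
Proof.
move=> lf x y xy; have := lf x y; rewrite distrC [`|x - y|]distrC.
rewrite [`|y - x|]ger0_norm ?subr_ge0// => /ler_normlP[h1 h2]; nra.
Qed.

(* K U + f(U) and K U - f(U) are nondecreasing in U, so their covariances with
   M V - g(V) and M V + g(V) are nonnegative; add them up. *)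
Lemma Cov_lip (K M : R) (f g : R -> R) (U V : T -> R) : lip K f -> lip M g -> C U -> C V ->
  sqi P U -> sqi P V ->
  `|Cov P (fun w => f (U w)) (fun w => g (V w))| <= K * M * Cov P U V.
Proof.
move=> lf lg CU CV sU sV; have [_ _ pos] := HC.
have sF := sqi_lip lf sU; have sG := sqi_lip lg sV.
set F := fun w => f (U w) in sF *; set G := fun w => g (V w) in sG *.
have mup (L : R) (h : R -> R) : lip L h -> measurable_fun setT (fun x : R => L * x + h x).
  by move=> lh; apply: measurable_funD; [exact: measurable_funM|exact: lip_measurable lh].
have mdown (L : R) (h : R -> R) : lip L h -> measurable_fun setT (fun x : R => L * x - h x).
  by move=> lh; apply: measurable_funB; [exact: measurable_funM|exact: lip_measurable lh].
have C1 := pc_comp (mup _ _ lf) (lip_up lf) CU.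
have C2 := pc_comp (mdown _ _ lf) (lip_down lf) CU.
have C3 := pc_comp (mup _ _ lg) (lip_up lg) CV.
have C4 := pc_comp (mdown _ _ lg) (lip_down lg) CV.
have sKU := sqiZ K sU; have sMV := sqiZ M sV.
have s1 := sqiD sKU sF; have s2 := sqiB sKU sF.
have s3 := sqiD sMV sG; have s4 := sqiB sMV sG.
have := pos _ _ C1 C4 s1 s4; have := pos _ _ C2 C3 s2 s3.
have := pos _ _ C1 C3 s1 s3; have := pos _ _ C2 C4 s2 s4.
rewrite !(CovDl, CovDr, CovNl, CovNr, CovZl, CovZr); try by []; try exact: sqiN.
by move=> h1 h2 h3 h4; rewrite ler_norml -!mulrA -/F -/G; apply/andP; split; lra.
Qed.

End positive_correlation.

(** * Variance of partial sums *)

Section partial_sums.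
Context d (T : measurableType d) (R : realType) (P : probability T R).
Variable Y : nat -> T -> R.
Hypothesis Ysq : forall i, sqi P (Y i).
Hypothesis Ymean : forall i, Ex P (Y i) = 0.
Hypothesis AY : associated_seq P Y.
Hypothesis Ycov : forall i k, Cov P (Y i) (Y (i + k)%N) = Cov P (Y 0%N) (Y k).
Let c k := Cov P (Y 0%N) (Y k).
Hypothesis csum : cvgn (series c).

Definition psum (n : nat) (w : T) : R := \sum_(i < n) Y i w.
Definition nsum (n : nat) (w : T) : R := (Num.sqrt n%:R)^-1 * psum n w.
(** This is c_0 + 2 (c_1 + c_2 + ...), the limit of Var(psum n) / n. *)
Definition lim_var : R := 2 * limn (series c) - c 0%N.

Lemma Cov_seq_ge0 i j : 0 <= Cov P (Y i) (Y j).
Proof.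
have [C [_ _ pos] CY] := AY (maxn i j).+1.
by apply: pos => //; apply: CY; rewrite ltnS ?leq_maxl ?leq_maxr.
Qed.

Lemma Cov_seq_diff i j : (i <= j)%N -> Cov P (Y i) (Y j) = c (j - i)%N.
Proof. by move=> ij; rewrite -[in LHS](subnKC ij) Ycov. Qed.

Lemma sqi_psum n : sqi P (psum n).
Proof. exact: sqi_sum. Qed.

Lemma Ex_psum n : Ex P (psum n) = 0.
Proof.
rewrite Ex_sum => [|i]; last exact: sqi_itg.
by rewrite big1// => i _; exact: Ymean.
Qed.

Lemma sqi_nsum n : sqi P (nsum n).
Proof. by apply: sqiZ; exact: sqi_psum. Qed.

Lemma Ex_nsum n : Ex P (nsum n) = 0.
Proof. by rewrite ExZ ?Ex_psum ?mulr0//; apply: sqi_itg; exact: sqi_psum. Qed.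

Lemma series_c_le n : series c n <= limn (series c).
Proof.
apply: nondecreasing_cvgn_le => //; apply: nondecreasing_series => k _ _.
exact: Cov_seq_ge0.
Qed.

(** Covariances are nonnegative, so the range of summation may be enlarged to i + 1 + k. The indices
    up to i and those beyond i each contribute a partial sum of the covariance series, and c_0 is
    counted once. *)
Lemma Cov_seq_psum_le i k : Cov P (Y i) (psum k) <= lim_var.
Proof.
rewrite /psum Cov_sumr//.
apply: (@le_trans _ _ (\sum_(l < i.+1 + k) Cov P (Y i) (Y l))).
  rewrite -!(big_mkord xpredT (fun l => Cov P (Y i) (Y l))) addnC /index_iota !subn0.
  by rewrite iotaD big_cat/= lerDl; apply: sumr_ge0 => l _; exact: Cov_seq_ge0.
rewrite big_split_ord/=.
have -> : \sum_(l < i.+1) Cov P (Y i) (Y l) = series c i.+1.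
  rewrite /series/= big_mkord (reindex_inj rev_ord_inj)/=; apply: eq_bigr => l _.
  rewrite CovC Cov_seq_diff ?subSS ?leq_subr//.
  by rewrite subKn// -ltnS.
have -> : \sum_(l < k) Cov P (Y i) (Y (i.+1 + l)%N) = series c k.+1 - c 0%N.
  rewrite /series/= big_mkord big_ord_recl addrC addKr; apply: eq_bigr => l _.
  by rewrite addSnnS Ycov.
have := series_c_le i.+1; have := series_c_le k.+1; rewrite /lim_var; lra.
Qed.

(** The increment of the variance from n to n + 1. It tends to [lim_var] from below, hence so do its
    Cesàro means Var(psum n) / n. *)
Let b n := 2 * series c n.+1 - c 0%N.

Lemma Cov_psumS n : Cov P (psum n.+1) (psum n.+1) = Cov P (psum n) (psum n) + b n.
Proof.
have sn := sqi_psum n.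
have -> : psum n.+1 = (fun w => psum n w + Y n w).
  by apply/funext => w; rewrite /psum big_ord_recr.
rewrite CovDl ?CovDr//; try exact: sqiD.
rewrite [Cov P (psum n) (Y n)]CovC -[Cov P (Y n) (Y n)]/(Cov P (Y n) (Y n)).
have -> : Cov P (Y n) (psum n) = series c n.+1 - c 0%N.
  rewrite /psum Cov_sumr// /series/= big_mkord big_ord_recl addrC addKr.
  rewrite (reindex_inj rev_ord_inj)/=; apply: eq_bigr => l _.
  by rewrite CovC Cov_seq_diff ?leq_subr// subKn.
by rewrite Cov_seq_diff// subnn /b; ring.
Qed.

Lemma Cov_psumE n : Cov P (psum n) (psum n) = series b n.
Proof.
elim: n => [|n IH].
  rewrite /series/= big_geq//.
  have -> : psum 0 = fun=> 0 by apply/funext => w; rewrite /psum big_ord0.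
  by rewrite Cov_cstl//; exact: sqi_cst.
by rewrite Cov_psumS IH /series/= big_nat_recr.
Qed.

Lemma b_le n : b n <= lim_var.
Proof. by rewrite /b /lim_var lerD2r ler_pM2l// series_c_le. Qed.

Lemma var_psum_le n : Cov P (psum n) (psum n) <= n%:R * lim_var.
Proof.
rewrite Cov_psumE /series/= big_mkord -[n in n%:R]card_ord -sumr_const mulr_suml.
by apply: ler_sum => i _; rewrite mul1r; exact: b_le.
Qed.

Lemma var_psum_cvg :
  (fun n : nat => Cov P (psum n.+1) (psum n.+1) / n.+1%:R) @ \oo --> lim_var.
Proof.
have cb : b @ \oo --> lim_var.
  apply: cvgB; last exact: cvg_cst.
  apply: cvgM; first exact: cvg_cst.
  by move/cvg_ex: csum => [l cl]; rewrite (cvg_lim _ cl)//; move: cl; rewrite -(cvg_shiftS (series c)).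
rewrite (_ : (fun n : nat => _) = arithmetic_mean b); first exact: cesaro.
by apply/funext => n; rewrite Cov_psumE mulrC.
Qed.

(** The bound grows with the first index only, whatever k is. After normalization, sums at distant
    times therefore decorrelate like sqrt (j / k). *)
Lemma Cov_psum_le j k : Cov P (psum j) (psum k) <= j%:R * lim_var.
Proof.
have sk := sqi_psum k.
rewrite {1}/psum Cov_suml// -[j in j%:R]card_ord -sumr_const mulr_suml.
by apply: ler_sum => i _; rewrite mul1r Cov_seq_psum_le.
Qed.

Lemma Cov_psum_ge j k : (j <= k)%N ->
  Cov P (psum j) (psum j) <= Cov P (psum k) (psum j).
Proof.
move=> jk; have E n : Cov P (psum n) (psum j) = \sum_(0 <= i < n) Cov P (Y i) (psum j).
  by rewrite {1}/psum Cov_suml ?big_mkord//; exact: sqi_psum.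
rewrite !E [leRHS](big_cat_nat (n := j))//= lerDl; apply: sumr_ge0 => l _.
by rewrite Cov_sumr//; apply: sumr_ge0 => i _; exact: Cov_seq_ge0.
Qed.

Lemma lim_var_ge : c 0%N <= lim_var.
Proof.
have := series_c_le 1; rewrite /series/= big_nat1 /lim_var; lra.
Qed.

Lemma var_nsum n : Ex P (fun w => nsum n w ^+ 2) = Cov P (psum n) (psum n) / n%:R.
Proof.
have := sqi_psum n; rewrite /nsum /Cov Ex_psum => sn.
have -> : (fun w => ((Num.sqrt n%:R)^-1 * psum n w) ^+ 2) =
  (fun w => n%:R^-1 * (psum n w * psum n w)).
  by apply/funext => w; rewrite exprMn exprVn sqr_sqrtr// expr2.
by rewrite ExZ; [rewrite mul0r subr0 mulrC|exact: sqiM].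
Qed.

Lemma var_nsum_le n : Ex P (fun w => nsum n w ^+ 2) <= lim_var.
Proof.
have v0 : 0 <= lim_var.
  by apply: le_trans lim_var_ge; exact: Cov_seq_ge0.
rewrite var_nsum; case: n => [|n]; first by rewrite invr0 mulr0.
by rewrite ler_pdivrMr// mulrC var_psum_le.
Qed.

(** After expanding the square, the cross term is bounded below by Var(psum m), since the terms of
    index at least m are nonnegatively correlated with psum m. *)
Lemma var_nsum_diff n m : (m <= n)%N -> (0 < m)%N ->
  Ex P (fun w => (nsum n w - nsum m w) ^+ 2) <=
  Cov P (psum n) (psum n) / n%:R + Cov P (psum m) (psum m) / m%:R
   - 2 * (Cov P (psum m) (psum m) / m%:R) * Num.sqrt (m%:R / n%:R).
Proof.
move=> mn m0; have n0 : (0 < n)%N := leq_trans m0 mn.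
have [sn sm] := (sqi_psum n, sqi_psum m).
set x := (Num.sqrt n%:R)^-1 : R; set y := (Num.sqrt m%:R)^-1 : R.
have x0 : 0 <= x by rewrite invr_ge0.
have y0 : 0 <= y by rewrite invr_ge0.
have xx : x * x = n%:R^-1 by rewrite -expr2 exprVn sqr_sqrtr.
have yy : y * y = m%:R^-1 by rewrite -expr2 exprVn sqr_sqrtr.
have -> : (fun w => (nsum n w - nsum m w) ^+ 2) = (fun w => (nsum n w - nsum m w) * (nsum n w - nsum m w)).
  by apply/funext => w; rewrite expr2.
have sd := sqiB (sqi_nsum n) (sqi_nsum m).
have -> : Ex P (fun w => (nsum n w - nsum m w) * (nsum n w - nsum m w)) =
    Cov P (fun w => nsum n w - nsum m w) (fun w => nsum n w - nsum m w).
  by rewrite /Cov ExB ?Ex_nsum ?subr0 ?mulr0 ?subr0//; exact/sqi_itg/sqi_nsum.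
have [tn tm] := (sqi_nsum n, sqi_nsum m).
rewrite CovBl ?CovBr//.
rewrite /nsum !CovZl ?CovZr//; try exact: sqiZ.
rewrite -/x -/y [Cov P (psum m) (psum n)]CovC.
have -> : Num.sqrt (m%:R / n%:R) = m%:R * (x * y) :> R.
  have s0 : Num.sqrt m%:R != 0 :> R by rewrite gt_eqF// sqrtr_gt0 ltr0n.
  rewrite sqrtrM// sqrtrV// -/x mulrC mulrA [_ * x]mulrC -mulrA; congr (_ * _).
  by rewrite -{2}[m%:R]sqr_sqrtr// expr2 /y mulfK.
have mm : m%:R != 0 :> R by rewrite pnatr_eq0 -lt0n.
have -> : 2 * (Cov P (psum m) (psum m) / m%:R) * (m%:R * (x * y)) =
  2 * (x * y * Cov P (psum m) (psum m)) by field.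
have /(ler_wpM2l (mulr_ge0 x0 y0)) := Cov_psum_ge mn.
rewrite !mulrA xx yy; set u := Cov P _ _; set t := Cov P _ _; set s := Cov P _ _.
by rewrite [y * x]mulrC; move=> h; lra.
Qed.

End partial_sums.

(** * Stein's method for associated blocks *)

Section clip_sqr.
Context (R : realType).

Lemma lip_clip (K : R) : 0 <= K -> lip 1 (clip K).
Proof.
move=> K0 x y; rewrite mul1r.
wlog xy : x y / x <= y.
  move=> H; have [xy|/ltW yx] := leP x y; first exact: H.
  by rewrite distrC [leRHS]distrC; exact: H.
rewrite distrC [leRHS]distrC !ger0_norm ?subr_ge0//; last exact: clip_le.
by rewrite /clip /Order.max /Order.min; do !case: ifP; lra.
Qed.

Lemma lip_clip_sqr (K : R) : 0 <= K -> lip (2 * K) (fun x => clip K x ^+ 2).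
Proof.
move=> K0 x y; rewrite subr_sqr normrM mulrC; apply: ler_pM => //.
  apply: le_trans (ler_normD _ _) _.
  have := norm_clip_le x K0; have := norm_clip_le y K0; lra.
by have := lip_clip K0 x y; rewrite mul1r.
Qed.

Lemma clip_sqr_le (K x : R) : 0 <= K -> clip K x ^+ 2 <= x ^+ 2.
Proof.
move=> K0; rewrite -(real_normK (num_real (clip K x))) -(real_normK (num_real x)).
by apply: lerXn2r; rewrite ?nnegrE ?norm_clip_le_norm.
Qed.

End clip_sqr.

Section stein.
Context d (T : measurableType d) (R : realType) (P : probability T R).
Variables (C : (T -> R) -> Prop) (q : nat) (Z : nat -> T -> R).
Hypothesis HC : positively_correlated P C.
Hypothesis q_gt0 : (0 < q)%N.
Hypothesis CZ : forall i, (i < q)%N -> C (Z i).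
Hypothesis sZ : forall i, sqi P (Z i).
Hypothesis mZ : forall i, Ex P (Z i) = 0.
Hypothesis idZ : forall i (F : R -> R), measurable_fun setT F ->
  itg P (fun w => F (Z 0%N w)) -> itg P (fun w => F (Z i w)) /\
  Ex P (fun w => F (Z i w)) = Ex P (fun w => F (Z 0%N w)).
Variables (f f' : R -> R) (A B : R).
Hypothesis lf : lip A f.
Hypothesis f'A : forall x, `|f' x| <= A.
Hypothesis mf' : measurable_fun setT f'.
Hypothesis taylor : forall x y, `|f y - f x - (y - x) * f' x| <= B * (y - x) ^+ 2.

Let s : R := (Num.sqrt q%:R)^-1.
Let N (w : T) : R := s * \sum_(i < q) Z i w.
(** The sum without its i-th term; writing 0 * Z j for the missing term keeps each summand in the
    class C. *)
Let N' (i : nat) (w : T) : R := s * \sum_(j < q) (if j == i :> nat then 0 * Z j w else Z j w).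
Let r (i : nat) (w : T) : R := f (N' i w) - f (N w) + s * Z i w * f' (N w).
(** The remainder [r] has two bounds: the Lipschitz one keeps [rho] integrable with second moments
    only, and the Taylor one makes it vanish as s tends to 0. *)
Let rho (z : R) : R := z ^+ 2 * Num.min (2 * A) (B * (s * `|z|)).

Let A0 : 0 <= A := lip_ge0 lf.
Let s0 : 0 <= s. Proof. by rewrite invr_ge0. Qed.
Let ssq : s * s * q%:R = 1.
Proof. by rewrite -expr2 exprVn sqr_sqrtr// mulVf// pnatr_eq0 -lt0n. Qed.
Let B0 : 0 <= B.
Proof. have := taylor 0 1; rewrite subr0 expr1n mulr1; exact: le_trans. Qed.

Let sN : sqi P N. Proof. by apply: sqiZ; exact: sqi_sum. Qed.
Let mN : measurable_fun setT N. Proof. exact: sqi_meas sN. Qed.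

Let N'E i w : (i < q)%N -> N' i w = N w - s * Z i w.
Proof.
move=> iq; rewrite /N' /N -mulrBr; congr (_ * _).
rewrite (bigD1 (Ordinal iq))//= eqxx mul0r add0r [X in _ = X - _](bigD1 (Ordinal iq))//=.
rewrite addrC addrK; apply: eq_bigr => j ji; case: eqP => // e.
by move: ji; rewrite -val_eqE/= e eqxx.
Qed.

Let sN' i : sqi P (N' i).
Proof.
by apply: sqiZ; apply: sqi_sum => j; case: eqP => _ //; exact: sqiZ.
Qed.

Let CN' i : C (N' i).
Proof.
apply: (pc_scale HC s0); apply: (pc_sum HC (F := fun j w => if j == i then 0 * Z j w else Z j w) (CZ q_gt0)).
by move=> j jq; case: eqP => _; [apply: (pc_scale HC)|]; rewrite ?lexx//; exact: CZ.
Qed.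

Let itg_fN : sqi P (fun w => f (N w)). Proof. exact: sqi_lip lf sN. Qed.
Let itg_fN' i : sqi P (fun w => f (N' i w)). Proof. exact: sqi_lip lf (sN' i). Qed.

Let mf'N : measurable_fun setT (fun w => f' (N w)).
Proof. exact: (measurableT_comp mf' mN). Qed.

Let sZf' i : sqi P (fun w => s * Z i w * f' (N w)).
Proof.
apply: (sqi_le _ (sqiZ (s * A) (sZ i))).
  apply: measurable_funM => //; apply: measurable_funM => //; exact: sqi_meas (sZ i).
move=> w; rewrite !normrM (ger0_norm s0) (ger0_norm A0) -!mulrA ler_wpM2l//.
by rewrite mulrC ler_wpM2r.
Qed.

Let sr i : sqi P (r i).
Proof. by apply: sqiD; [exact: sqiB|exact: sZf']. Qed.

Let r_le i w : (i < q)%N -> `|s * (Z i w * r i w)| <= s * s * rho (Z i w).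
Proof.
move=> iq; have e := N'E w iq.
have r1 : `|r i w| <= 2 * A * (s * `|Z i w|).
  apply: le_trans (ler_normD _ _) _.
  have h1 := lf (N' i w) (N w).
  have h2 : `|s * Z i w * f' (N w)| <= A * (s * `|Z i w|).
    by rewrite !normrM (ger0_norm s0) mulrC ler_wpM2r// mulr_ge0.
  move: h1; rewrite {2}e addrAC subrr add0r normrN normrM (ger0_norm s0); lra.
have r2 : `|r i w| <= B * (s * `|Z i w|) * (s * `|Z i w|).
  have := taylor (N w) (N' i w); rewrite {2 3}e.
  have -> : N w - s * Z i w - N w = - (s * Z i w) by ring.
  rewrite mulNr opprK sqrrN exprMn -(real_normK (num_real (Z i w))).
  by move=> h; apply: le_trans h _; rewrite le_eqVlt; apply/orP; left; apply/eqP; ring.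
have r3 : `|r i w| <= Num.min (2 * A) (B * (s * `|Z i w|)) * (s * `|Z i w|).
  by rewrite /Order.min; case: ifP.
rewrite !normrM (ger0_norm s0) /rho -(real_normK (num_real (Z i w))).
apply: (@le_trans _ _ (s * (`|Z i w| * (Num.min (2 * A) (B * (s * `|Z i w|)) * (s * `|Z i w|))))).
  by rewrite ler_wpM2l// ler_wpM2l.
by rewrite le_eqVlt; apply/orP; left; apply/eqP; ring.
Qed.

Let mrho : measurable_fun setT rho.
Proof.
apply: measurable_funM; first exact: measurable_funX.
apply: measurable_minr => //; apply: measurable_funM => //; exact: measurable_funM.
Qed.

Let itg_rho0 : itg P (fun w => rho (Z 0%N w)).
Proof.
have [m0 i0] := sZ 0%N; apply: (itg_le _ (itgZ (2 * A) i0)).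
  exact: (measurableT_comp mrho m0).
move=> w; rewrite normrM ger0_norm ?sqr_ge0// mulrC ler_wpM2r ?sqr_ge0//.
rewrite ger0_norm ?ge_min ?lexx// le_min.
by rewrite !mulr_ge0.
Qed.

(** For independent Z_i every summand would vanish. Here each is a covariance bounded by A times
    Cov(Z_i, N'_i), and these off-diagonal covariances add up to Var(N) - E[Z_0^2]. *)
Let term1 : `|\sum_(i < q) s * Ex P (fun w => Z i w * f (N' i w))| <=
  A * (Cov P N N - Ex P (fun w => Z 0%N w ^+ 2)).
Proof.
apply: le_trans (ler_norm_sum _ _ _) _.
have step (i : 'I_q) : `|s * Ex P (fun w => Z i w * f (N' i w))| <=
    A * (s * Cov P (Z i) N - s * s * Ex P (fun w => Z 0%N w ^+ 2)).
  have iq := ltn_ord i.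
  have -> : Ex P (fun w => Z i w * f (N' i w)) = Cov P (Z i) (fun w => f (N' i w)).
    by rewrite /Cov mZ mul0r subr0.
  have lid : lip 1 (fun x : R => x) by move=> x y; rewrite mul1r.
  rewrite normrM (ger0_norm s0).
  have := Cov_lip HC lid lf (CZ iq) (CN' i) (sZ i) (sN' i).
  rewrite mul1r => /(ler_wpM2l s0)/le_trans; apply.
  have -> : N' i = (fun w => N w - s * Z i w) by apply/funext => w; exact: N'E.
  rewrite CovBr//; last exact: sqiZ.
  rewrite CovZr// le_eqVlt; apply/orP; left; apply/eqP.
  have -> : Cov P (Z i) (Z i) = Ex P (fun w => Z 0%N w ^+ 2).
    rewrite /Cov mZ mul0r subr0; have [_ i0] := sZ 0%N.
    have [_ <-] := @idZ i (fun z => z ^+ 2) (measurable_funX _ (@measurable_id _ _ _)) i0.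
    by under eq_fun do rewrite -expr2.
  ring.
apply: le_trans (ler_sum _ (fun i _ => step i)) _.
rewrite -mulr_sumr ler_wpM2l// sumrB sumr_const card_ord -mulr_sumr.
have -> : Cov P N N = s * \sum_(i < q) Cov P (Z i) N.
  by rewrite {1}/N CovZl ?Cov_suml//; exact: sqi_sum.
rewrite -[X in _ - X <= _]mulr_natr.
have -> : s * s * Ex P (fun w => Z 0%N w ^+ 2) * q%:R = Ex P (fun w => Z 0%N w ^+ 2).
  by rewrite mulrAC ssq mul1r.
exact: lexx.
Qed.

Variable K : R.
Hypothesis K0 : 0 <= K.
(** The square is not Lipschitz and Z_i^2 may have infinite variance; clipping at K yields a bounded
    function with Lipschitz constant 2K. *)
Let psi (x : R) : R := clip K x ^+ 2.
Let m : R := Ex P (fun w => psi (Z 0%N w)).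
Let v : R := Ex P (fun w => Z 0%N w ^+ 2).

Let lpsi : lip (2 * K) psi := lip_clip_sqr K0.
Let spsi i : sqi P (fun w => psi (Z i w)). Proof. exact: sqi_lip lpsi (sZ i). Qed.
Let Zsq i : itg P (fun w => Z i w ^+ 2) /\ Ex P (fun w => Z i w ^+ 2) = v.
Proof.
have [_ i0] := sZ 0%N.
exact: (@idZ i (fun z => z ^+ 2) (measurable_funX _ (@measurable_id _ _ _)) i0).
Qed.
Let psiE i : Ex P (fun w => psi (Z i w)) = m.
Proof. by have [] := idZ i (lip_measurable lpsi) (sqi_itg (spsi 0%N)). Qed.

(** The empirical variance minus v equals G + (H - (v - m)), with G centred and square integrable,
    and H nonnegative of mean v - m. *)
Let G w : R := s * s * \sum_(i < q) psi (Z i w) - m.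
Let H w : R := s * s * \sum_(i < q) (Z i w ^+ 2 - psi (Z i w)).

Let sPS : sqi P (fun w => s * s * \sum_(i < q) psi (Z i w)).
Proof. by apply: sqiZ; exact: (sqi_sum _ (fun i : 'I_q => spsi i)). Qed.

Let sG : sqi P G. Proof. by apply: sqiB => //; exact: sqi_cst. Qed.

Let itgH : itg P H.
Proof.
apply: itgZ; apply: (itg_sum _ (F := fun (i : 'I_q) w => Z i w ^+ 2 - psi (Z i w))) => i.
by apply: itgB; [exact: (Zsq i).1|exact: sqi_itg].
Qed.

Let ExH : Ex P H = v - m.
Proof.
have h i : itg P (fun w => Z i w ^+ 2 - psi (Z i w)).
  by apply: itgB; [exact: (Zsq i).1|exact: sqi_itg].
rewrite ExZ; last exact: (itg_sum _ (fun i : 'I_q => h i)).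
rewrite (Ex_sum _ (fun i : 'I_q => h i)).
under eq_bigr => i _.
  rewrite ExB ?psiE ?(Zsq i).2//; [|exact: (Zsq i).1|exact: sqi_itg].
  over.
by rewrite sumr_const card_ord -mulr_natr mulrA mulrAC ssq mul1r.
Qed.

(** A weak law of large numbers: association bounds the covariances of clipped squares by (2K)^2
    times those of the Z_i, and the normalization leaves a factor s * s = 1 / q. *)
Let ExG2 : Ex P (fun w => G w ^+ 2) <= 4 * K ^+ 2 * (s * s * Cov P N N).
Proof.
have G0 : Ex P G = 0.
  rewrite ExB ?Ex_cst; [|exact: sqi_itg|exact: itg_cst].
  rewrite ExZ; last by apply: itg_sum => i; exact/sqi_itg/spsi.
  rewrite (Ex_sum _ (fun i : 'I_q => sqi_itg (spsi i))).
  under eq_bigr do rewrite psiE.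
  by rewrite sumr_const card_ord -[m *+ q]mulr_natr mulrA mulrAC ssq mul1r subrr.
have -> : Ex P (fun w => G w ^+ 2) = Cov P G G.
  by rewrite /Cov G0 mul0r subr0; under eq_fun do rewrite expr2.
have sm : sqi P (fun=> m) := sqi_cst P m.
rewrite {1}/G CovBl// Cov_cstl// subr0 CovC CovBl// Cov_cstl// subr0.
have sS : sqi P (fun w => \sum_(i < q) psi (Z i w)) := sqi_sum _ (fun i : 'I_q => spsi i).
have sS' : sqi P (fun w => \sum_(i < q) Z i w) := sqi_sum _ (fun i : 'I_q => sZ i).
rewrite CovZl// CovZr// Cov_suml//.
rewrite /N CovZl// CovZr// Cov_suml//.
rewrite !mulrA -![s * s * s * s]mulrA.
apply: (@le_trans _ _ (s * s * (s * s) * \sum_(i < q) (4 * K ^+ 2 * Cov P (Z i) (fun w => \sum_(i < q) Z i w)))).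
  rewrite -!mulrA !ler_wpM2l//; apply: ler_sum => i _.
  rewrite !Cov_sumr// mulr_sumr; apply: ler_sum => j _.
  apply: le_trans (ler_norm _) _.
  have := Cov_lip HC lpsi lpsi (CZ (ltn_ord i)) (CZ (ltn_ord j)) (sZ i) (sZ j).
  by move=> /le_trans; apply; rewrite le_eqVlt; apply/orP; left; apply/eqP; ring.
by rewrite -mulr_sumr le_eqVlt; apply/orP; left; apply/eqP; ring.
Qed.

Let term2 : `|Ex P (fun w => (s * s * (\sum_(i < q) Z i w ^+ 2) - v) * f' (N w))| <=
  A * (Num.sqrt (4 * K ^+ 2 * (s * s * Cov P N N)) + 2 * (v - m)).
Proof.
have i1 : itg P (fun w => A * (`|G w| + (H w + (v - m)))).
  by apply: itgZ; apply: itgD; [apply: itg_norm; exact: sqi_itg|apply: itgD => //; exact: itg_cst].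
have vm : 0 <= v - m.
  rewrite subr_ge0; apply: Ex_le; [exact/sqi_itg/spsi|exact: (Zsq 0%N).1|].
  by move=> w; exact: clip_sqr_le.
have le w : `|(s * s * (\sum_(i < q) Z i w ^+ 2) - v) * f' (N w)| <=
    A * (`|G w| + (H w + (v - m))).
  rewrite normrM mulrC; apply: ler_pM => //.
  have -> : s * s * (\sum_(i < q) Z i w ^+ 2) - v = G w + (H w - (v - m)).
    by rewrite /G /H sumrB; ring.
  apply: le_trans (ler_normD _ _) _; rewrite lerD2l.
  apply: le_trans (ler_normB _ _) _.
  rewrite (ger0_norm vm) ger0_norm// mulr_ge0 ?mulr_ge0//.
  by apply: sumr_ge0 => i _; rewrite subr_ge0; exact: clip_sqr_le.
apply: le_trans (Ex_norm_le _ i1 le) _.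
  apply: (itg_le _ i1 le); apply: measurable_funM => //.
  apply: measurable_funB => //; apply: measurable_funM => //.
  by apply: measurable_sum => i; exact: itg_meas (Zsq i).1.
rewrite ExZ; last by apply: itgD; [apply: itg_norm; exact: sqi_itg|apply: itgD => //; exact: itg_cst].
rewrite ler_wpM2l// ExD; [|by apply: itg_norm; exact: sqi_itg|by apply: itgD => //; exact: itg_cst].
rewrite ExD ?Ex_cst ?ExH//; last exact: itg_cst.
have : Ex P (fun w => `|G w|) <= Num.sqrt (4 * K ^+ 2 * (s * s * Cov P N N)).
  by apply: le_trans (Ex_abs_le_sqrt sG) _; exact: ler_wsqrtr.
by move=> h; lra.
Qed.

(** The three errors come from the dependence between the Z_i, the fluctuation of the empirical
    variance around v, and the Taylor remainder. *)
Lemma stein_bound :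
  `|Ex P (fun w => N w * f (N w)) - v * Ex P (fun w => f' (N w))| <=
  A * (Cov P N N - v) +
  A * (Num.sqrt (4 * K ^+ 2 * (s * s * Cov P N N)) + 2 * (v - m)) +
  Ex P (fun w => rho (Z 0%N w)).
Proof.
have if' : itg P (fun w => f' (N w)) by exact: (itg_bounded P mf'N).
have i1 i : itg P (fun w => s * (Z i w * f (N' i w))).
  by apply: itgZ; exact: sqiM.
have i3 i : itg P (fun w => s * (Z i w * r i w)) by apply: itgZ; exact: sqiM.
have i2 : itg P (fun w => (s * s * (\sum_(i < q) Z i w ^+ 2) - v) * f' (N w)).
  have ib : itg P (fun w => s * s * (\sum_(i < q) Z i w ^+ 2) - v).
    by apply: itgB; [apply: itgZ; exact: (itg_sum _ (fun i : 'I_q => (Zsq i).1))|exact: itg_cst].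
  apply: (itg_le _ (itgZ A (itg_norm ib))).
    by apply: measurable_funM => //; exact: itg_meas ib.
  by move=> w; rewrite normrM mulrC ler_wpM2r.
(* In N f(N), the sum of the s Z_i f(N), each f(N) is replaced by f(N'_i) + s Z_i f'(N) - r_i. *)
have -> : Ex P (fun w => N w * f (N w)) - v * Ex P (fun w => f' (N w)) =
  Ex P (fun w => \sum_(i < q) s * (Z i w * f (N' i w)) +
    ((s * s * (\sum_(i < q) Z i w ^+ 2) - v) * f' (N w) -
     \sum_(i < q) s * (Z i w * r i w))).
  rewrite -ExZ// -ExB; [|exact: sqiM|exact: itgZ].
  congr (Ex _ _); apply/funext => w.
  rewrite addrCA -sumrB {1}/N -mulrA mulr_suml mulr_sumr mulrBl addrAC.
  congr (_ - _); rewrite [X in X + _](_ : _ = \sum_(i < q) s * s * Z i w ^+ 2 * f' (N w)).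
    rewrite -big_split/=; apply: eq_bigr => i _; rewrite /r; ring.
  by rewrite -mulr_suml -mulr_sumr.
have is1 := itg_sum (index_enum 'I_q) (fun i : 'I_q => i1 i).
have is3 := itg_sum (index_enum 'I_q) (fun i : 'I_q => i3 i).
rewrite (ExD is1); last exact: itgB.
rewrite ExB//; apply: le_trans (ler_normD _ _) _.
rewrite -addrA lerD//.
  rewrite (Ex_sum _ (fun i : 'I_q => i1 i)).
  rewrite (eq_bigr (fun i : 'I_q => s * Ex P (fun w => Z i w * f (N' i w)))).
    exact: term1.
  by move=> i _; rewrite ExZ//; exact: sqiM.
apply: le_trans (ler_normB _ _) _; rewrite lerD//.
rewrite (Ex_sum _ (fun i : 'I_q => i3 i)).
apply: le_trans (ler_norm_sum _ _ _) _.
have step (i : 'I_q) : `|Ex P (fun w => s * (Z i w * r i w))| <=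
    s * s * Ex P (fun w => rho (Z 0%N w)).
  have [ir <-] := idZ i mrho itg_rho0.
  rewrite -ExZ//; apply: Ex_norm_le => //; first exact: itgZ.
  by move=> w; apply: r_le.
apply: le_trans (ler_sum _ (fun i _ => step i)) _.
by rewrite sumr_const card_ord -mulr_natr mulrAC ssq mul1r.
Qed.

End stein.

(** * The Stein expression along partial sums *)

Section stein_limit.
Context d (T : measurableType d) (R : realType) (P : probability T R).
Variable Y : nat -> T -> R.
Hypothesis Ysq : forall i, sqi P (Y i).
Hypothesis Ymean : forall i, Ex P (Y i) = 0.
Hypothesis AY : associated_seq P Y.
Hypothesis Ycov : forall i k, Cov P (Y i) (Y (i + k)%N) = Cov P (Y 0%N) (Y k).
Hypothesis csum : cvgn (series (fun k => Cov P (Y 0%N) (Y k))).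
Hypothesis Ysum : forall (l j : nat) (F : R -> R), measurable_fun setT F ->
  itg P (fun w => F (\sum_(k < l) Y k w)) ->
  itg P (fun w => F (\sum_(k < l) Y (j + k)%N w)) /\
  Ex P (fun w => F (\sum_(k < l) Y (j + k)%N w)) =
  Ex P (fun w => F (\sum_(k < l) Y k w)).

Let v := lim_var P Y.
Let vn (n : nat) := Cov P (psum Y n) (psum Y n) / n%:R.

Let v_ge0 : 0 <= v.
Proof.
exact: le_trans (Cov_seq_ge0 Ysq AY 0 0) (lim_var_ge Ysq AY csum).
Qed.

Let vn_le n : vn n <= v.
Proof. by rewrite /vn -var_nsum//; exact: var_nsum_le. Qed.

Lemma vn_near (e : R) : 0 < e ->
  exists M : nat, forall n, (M <= n)%N -> (0 < n)%N -> v - e <= vn n.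
Proof.
move=> e0; have /cvgrPdist_le := var_psum_cvg Ysq Ycov csum.
move=> /(_ e e0) [M _ HM]; exists M.+1 => -[//|n] Mn _.
by have := HM n Mn => /ler_normlP[_ h]; rewrite lerBlDr -lerBlDl.
Qed.

Definition block (l i : nat) (w : T) : R :=
  (Num.sqrt l%:R)^-1 * \sum_(k < l) Y (i * l + k)%N w.

Lemma psum_blocks l q w : psum Y (q * l) w = \sum_(i < q) \sum_(k < l) Y (i * l + k)%N w.
Proof.
elim: q => [|q IH]; first by rewrite /psum !big_ord0.
by rewrite big_ord_recr/= -IH /psum mulSn addnC big_split_ord.
Qed.

Lemma nsum_blocks l q w :
  nsum Y (q * l) w = (Num.sqrt q%:R)^-1 * \sum_(i < q) block l i w.
Proof.
by rewrite /nsum psum_blocks natrM sqrtrM// invfM -mulrA -mulr_sumr.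
Qed.

Variables (f f' : R -> R) (A B : R).
Hypothesis lf : lip A f.
Hypothesis f'A : forall x, `|f' x| <= A.
Hypothesis mf' : measurable_fun setT f'.
Hypothesis taylor : forall x y, `|f y - f x - (y - x) * f' x| <= B * (y - x) ^+ 2.

Let A0 : 0 <= A := lip_ge0 lf.

Let sqi_block l i : sqi P (block l i).
Proof. by apply: sqiZ; exact: (sqi_sum _ (fun k : 'I_l => Ysq (i * l + k)%N)). Qed.

Let Ex_block l i : Ex P (block l i) = 0.
Proof.
have h k : itg P (Y (i * l + k)%N) by exact: sqi_itg.
rewrite ExZ; last exact: (itg_sum _ (fun k : 'I_l => h k)).
by rewrite (Ex_sum _ (fun k : 'I_l => h k)) big1 ?mulr0.
Qed.

Let block_id l i (F : R -> R) : measurable_fun setT F ->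
  itg P (fun w => F (block l 0 w)) -> itg P (fun w => F (block l i w)) /\
  Ex P (fun w => F (block l i w)) = Ex P (fun w => F (block l 0 w)).
Proof.
move=> mF; pose F' x := F ((Num.sqrt l%:R)^-1 * x).
have mF' : measurable_fun setT F'.
  by apply: (measurableT_comp mF); exact: measurable_funM.
exact: (@Ysum l (i * l) F' mF').
Qed.

Let stein_block l q (K : R) : (0 < l)%N -> (0 < q)%N -> 0 <= K ->
  `|Ex P (fun w => nsum Y (q * l) w * f (nsum Y (q * l) w))
    - v * Ex P (fun w => f' (nsum Y (q * l) w))| <=
  2 * A * (v - vn l) + A * Num.sqrt (4 * K ^+ 2 * (v / q%:R)) +
  2 * A * (vn l - Ex P (fun w => clip K (nsum Y l w) ^+ 2)) +
  Ex P (fun w => nsum Y l w ^+ 2 *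
     Num.min (2 * A) (B * ((Num.sqrt q%:R)^-1 * `|nsum Y l w|))).
Proof.
move=> l0 q0 K0; have [C HC CY] := AY (q * l)%N.
have CZ i : (i < q)%N -> C (block l i).
  move=> iq; apply: (pc_scale HC); first by rewrite invr_ge0.
  apply: (pc_sum HC (F := fun k => Y (i * l + k)%N) (CY 0%N _)); first by rewrite muln_gt0 q0.
  move=> k kl; apply: CY; apply: (@leq_trans (i * l + l)).
    by rewrite ltn_add2l.
  by rewrite -mulSnr leq_mul2r iq orbT.
have := stein_bound HC q0 CZ (sqi_block l) (Ex_block l) (@block_id l) lf f'A mf' taylor K0.
have -> : (fun w => (Num.sqrt q%:R)^-1 * \sum_(i < q) block l i w) = nsum Y (q * l).
  by apply/funext => w; rewrite nsum_blocks.
have eqN w : (Num.sqrt q%:R)^-1 * \sum_(i < q) block l i w = nsum Y (q * l) w.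
  by rewrite nsum_blocks.
under eq_fun do rewrite eqN.
under [X in _ * Ex _ X]eq_fun do rewrite eqN.
have -> : Ex P (fun w => block l 0 w ^+ 2) = vn l by exact: var_nsum.
have CovN : Cov P (nsum Y (q * l)) (nsum Y (q * l)) = vn (q * l).
  rewrite /vn -var_nsum// /Cov Ex_nsum// mul0r subr0.
  by under eq_fun do rewrite -expr2.
rewrite CovN.
set E1 := Ex P _; set E2 := Ex P _; set E3 := Ex P _; set E4 := Ex P _.
have f'2 : `|E2| <= A.
  have if' : itg P (fun w => f' (nsum Y (q * l) w)).
    apply: itg_bounded => [|w]; last exact: f'A.
    by apply: (measurableT_comp mf'); exact/sqi_meas/sqi_nsum.
  by rewrite -(Ex_cst P A); apply: Ex_norm_le => //; exact: itg_cst.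
move=> h.
(* Replacing the block variance by v costs A (v - vn l); bounding the variance of the whole sum by v
   costs the same again, whence the factor 2. *)
have -> : E1 - v * E2 = (E1 - vn l * E2) - (v - vn l) * E2 by ring.
apply: le_trans (ler_normB _ _) _.
have h2 : `|(v - vn l) * E2| <= A * (v - vn l).
  by rewrite normrM mulrC ler_pM// ger0_norm// subr_ge0.
have h3 : A * (vn (q * l) - vn l) <= A * (v - vn l) by rewrite ler_wpM2l// lerD2r.
have h4 : A * Num.sqrt (4 * K ^+ 2 * ((Num.sqrt q%:R)^-1 * (Num.sqrt q%:R)^-1 * vn (q * l)))
   <= A * Num.sqrt (4 * K ^+ 2 * (v / q%:R)).
  rewrite ler_wpM2l// ler_wsqrtr// ler_wpM2l ?mulr_ge0 ?sqr_ge0//.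
  by rewrite -expr2 exprVn sqr_sqrtr// mulrC ler_wpM2r.
rewrite mulrDr in h; lra.
Qed.

Let sqrt_inv_cvg0 : (fun q : nat => (Num.sqrt q.+1%:R)^-1 : R) @ \oo --> (0 : R).
Proof.
apply/cvgrPdist_le => e e0; have ei : 0 <= e^-1 by rewrite invr_ge0 ltW.
near=> q; rewrite sub0r normrN ger0_norm ?invr_ge0//.
rewrite invf_ple ?posrE ?sqrtr_gt0//.
rewrite -(ger0_norm ei) -sqrtr_sqr ler_wsqrtr//.
near: q; have /archi_boundP := sqr_ge0 (e^-1); set m := Num.bound _ => hm.
by exists m => // q /= mq; rewrite (le_trans (ltW hm))// ler_nat (leq_trans mq).
Unshelve. all: end_near. Qed.

Let rem_cvg0 l : (fun q : nat => Ex P (fun w => nsum Y l w ^+ 2 *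
     Num.min (2 * A) (B * ((Num.sqrt q.+1%:R)^-1 * `|nsum Y l w|)))) @ \oo --> (0 : R).
Proof.
have [mN iN] := sqi_nsum Ysq l.
have B0 : 0 <= B.
  by have := taylor 0 1; rewrite subr0 expr1n mulr1; exact: le_trans.
rewrite -(Ex_cst P 0); apply: (@Ex_cvg _ _ _ _ _ _ (fun w => 2 * A * nsum Y l w ^+ 2)) => //.
- move=> n; apply: measurable_funM; first exact: measurable_funX.
  apply: measurable_minr => //; apply: measurable_funM => //; apply: measurable_funM => //.
  exact: measurableT_comp.
- exact: itgZ.
- move=> n w; rewrite normrM ger0_norm ?sqr_ge0// mulrC ler_wpM2r ?sqr_ge0//.
  by rewrite ger0_norm ?ge_min ?lexx// le_min !mulr_ge0// invr_ge0.
move=> w; rewrite -(mulr0 (nsum Y l w ^+ 2)).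
apply: cvgM; first exact: cvg_cst.
apply: (@squeeze_cvgr _ _ _ _ (fun=> 0) (fun q : nat => B * ((Num.sqrt q.+1%:R)^-1 * `|nsum Y l w|))).
- by apply: nearW => n; rewrite le_min ge_min lexx orbT andbT !mulr_ge0// invr_ge0.
- exact: cvg_cst.
- rewrite -(mulr0 B) -(mul0r `|nsum Y l w|); apply: cvgM; first exact: cvg_cst.
  by apply: cvgM; [exact: sqrt_inv_cvg0|exact: cvg_cst].
Qed.

Let clip_var_cvg l : (fun n : nat => Ex P (fun w => clip n%:R (nsum Y l w) ^+ 2))
  @ \oo --> vn l.
Proof.
have [mN iN] := sqi_nsum Ysq l.
rewrite /vn -var_nsum//; apply: (@Ex_cvg _ _ _ _ _ _ (fun w => nsum Y l w ^+ 2)) => //.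
- move=> n; apply: measurable_funX; exact: (measurableT_comp (measurable_clip n%:R)).
- exact: measurable_funX.
- by move=> n w; rewrite ger0_norm ?sqr_ge0// clip_sqr_le.
- by move=> w; apply: cvgM; exact: clip_cvg.
Qed.

(** The order of choices matters: the block length l for the variance defect, then the clipping
    level K for this l, and finally the number of blocks q for the two terms depending on it. *)
Lemma stein_blocks_limit (e : R) : 0 < e -> exists2 l : nat, (0 < l)%N &
  exists q0 : nat, forall q, (q0 <= q)%N ->
  `|Ex P (fun w => nsum Y (q.+1 * l) w * f (nsum Y (q.+1 * l) w))
    - v * Ex P (fun w => f' (nsum Y (q.+1 * l) w))| <= e.
Proof.
(* Each of the four errors is to be at most e / 4, two of them in the form 2 A h; adding 1 to A
   avoids dividing by zero. *)
move=> e0; pose h := e / (8 * (A + 1)).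
have A1 : 0 < A + 1 by rewrite ltr_wpDl.
have h0 : 0 < h by rewrite divr_gt0// mulr_gt0.
have Ah : A * h <= e / 8.
  have -> : A * h = e / 8 * (A / (A + 1)) by rewrite /h; field; rewrite gt_eqF.
  by rewrite ler_piMr ?divr_ge0 ?(ltW e0)// ler_pdivrMr// mul1r lerDl.
have [M HM] := vn_near h0; exists M.+1 => //.
have hl : v - vn M.+1 <= h by have := HM M.+1 (leqnSn M) isT; lra.
have /cvgrPdist_le /(_ h h0) [K _ HK] := @clip_var_cvg M.+1.
have hK : vn M.+1 - Ex P (fun w => clip K%:R (nsum Y M.+1 w) ^+ 2) <= h.
  by have /ler_normlP[_] := HK K (leqnn K).
have e4 : 0 < e / 4 by rewrite divr_gt0.
have /cvgrPdist_le /(_ _ e4) [q1 _ Hq1] := @rem_cvg0 M.+1.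
have : (fun q : nat => A * Num.sqrt (4 * K%:R ^+ 2 * v) * (Num.sqrt q.+1%:R)^-1)
    @ \oo --> (0 : R).
  rewrite -(mulr0 (A * Num.sqrt (4 * K%:R ^+ 2 * v))).
  by apply: cvgM; [exact: cvg_cst|exact: sqrt_inv_cvg0].
move=> /cvgrPdist_le /(_ _ e4) [q2 _ Hq2].
exists (maxn q1 q2) => q; rewrite geq_max => /andP[q1q q2q].
apply: le_trans (@stein_block M.+1 q.+1 K%:R _ _ _) _ => //.
have := Hq1 q q1q => /ler_normlP[]; rewrite sub0r opprK => r1 _.
have r2 : A * Num.sqrt (4 * K%:R ^+ 2 * (v / q.+1%:R)) <= e / 4.
  have := Hq2 q q2q => /ler_normlP[]; rewrite sub0r opprK => h2 _.
  apply: le_trans _ h2; rewrite -[leRHS]mulrA -sqrtrV// -sqrtrM ?mulr_ge0 ?sqr_ge0//.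
  by rewrite mulrA.
have t1 : A * (v - vn M.+1) <= A * h by rewrite ler_wpM2l.
have t2 : A * (vn M.+1 - Ex P (fun w => clip K%:R (nsum Y M.+1 w) ^+ 2)) <= A * h.
  by rewrite ler_wpM2l.
rewrite -![2 * A * _]mulrA; lra.
Qed.

(** Fewer than l terms are dropped, and the variances at both times are near v, so the mean square
    of the difference is small. *)
Lemma nsum_dist (l : nat) (e : R) : (0 < l)%N -> 0 < e ->
  exists n0 : nat, forall n, (n0 <= n)%N ->
  Ex P (fun w => `|nsum Y n w - nsum Y ((n %/ l) * l) w|) <= e.
Proof.
move=> l0 e0; have e40 : 0 < e ^+ 2 / 4 by rewrite divr_gt0// exprn_gt0.
have [M HM] := vn_near e40.
have /archi_boundP := divr_ge0 (mulr_ge0 v_ge0 (ler0n R l)) (ltW e40).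
set k := Num.bound _ => hk.
(* These thresholds give m >= M, so that vn m is within e^2 / 4 of v; then v l / n <= e^2 / 4; and m
   > 0. The total is three quarters of e^2. *)
exists (maxn (M + l) (maxn k l)) => n; rewrite !geq_max => /and3P[Mn kn ln].
set m := (n %/ l * l)%N.
have mn : (m <= n)%N by exact: leq_trunc_div.
have m0 : (0 < m)%N by rewrite muln_gt0 divn_gt0// ln.
have n0 : (0 < n)%N := leq_trans m0 mn.
have nml : (n <= m + l)%N.
  by rewrite {1}(divn_eq n l) leq_add2l ltnW// ltn_mod.
have Mm : (M <= m)%N by rewrite -(leq_add2r l) (leq_trans Mn).
have nR : 0 < n%:R :> R by rewrite ltr0n.
apply: le_trans (Ex_abs_le_sqrt (sqiB (sqi_nsum Ysq n) (sqi_nsum Ysq m))) _.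
rewrite -(ger0_norm (ltW e0)) -sqrtr_sqr ler_wsqrtr//.
apply: le_trans (var_nsum_diff Ysq Ymean AY mn m0) _.
rewrite -/(vn n) -/(vn m).
have h1 := vn_le n; have h2 := vn_le m; have h3 := HM m Mm m0.
have vm0 : 0 <= vn m by rewrite /vn divr_ge0// Cov_ge0_diag//; exact: sqi_psum.
have mn1 : m%:R / n%:R <= 1 :> R by rewrite ler_pdivrMr// mul1r ler_nat.
have mn0 : 0 <= m%:R / n%:R :> R by rewrite divr_ge0.
have h4 : m%:R / n%:R <= Num.sqrt (m%:R / n%:R) :> R.
  rewrite -{1}(ger0_norm mn0) -sqrtr_sqr ler_wsqrtr// expr2.
  by rewrite -[leRHS]mulr1 ler_wpM2l.
have h5 : 1 - m%:R / n%:R <= l%:R / n%:R :> R.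
  by rewrite lerBlDr -mulrDl ler_pdivlMr// mul1r -natrD ler_nat addnC.
have h6 : v * (l%:R / n%:R) <= e ^+ 2 / 4.
  rewrite mulrA ler_pdivrMr// -ler_pdivrMl ?mulr_gt0// ?invr_gt0// mulrC.
  by apply: le_trans (ltW hk) _; rewrite ler_nat.
have h7 : vn m * (m%:R / n%:R) <= vn m * Num.sqrt (m%:R / n%:R) by rewrite ler_wpM2l.
have h8 : vn m * (1 - m%:R / n%:R) <= v * (l%:R / n%:R).
  by apply: ler_pM => //; rewrite subr_ge0.
lra.
Qed.

Variable L : R.
Hypothesis lk : lip L (fun x => v * f' x - x * f x).

(** A Lipschitz f need not make x f(x) Lipschitz; assuming this for the whole expression lets
    [nsum_dist] pass from multiples of l to every n. *)
Lemma stein_limit :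
  (fun n : nat => Ex P (fun w => v * f' (nsum Y n w) - nsum Y n w * f (nsum Y n w)))
  @ \oo --> (0 : R).
Proof.
apply/cvgrPdist_le => e e0; have e2 : 0 < e / 2 by rewrite divr_gt0.
have [l l0 [q0 Hq]] := stein_blocks_limit e2.
have L0 : 0 <= L := lip_ge0 lk.
have L1 : 0 < L + 1 by rewrite ltr_wpDl.
have eL : 0 < e / 2 / (L + 1) by rewrite divr_gt0.
have [n0 Hn] := nsum_dist l0 eL.
exists (maxn n0 (q0.+1 * l)) => // n /=; rewrite geq_max => /andP[n0n qn].
rewrite sub0r normrN.
pose k x := v * f' x - x * f x; have lk' : lip L k := lk.
rewrite -/(Ex P (fun w => k (nsum Y n w))).
have sk m : sqi P (fun w => k (nsum Y m w)) by apply: sqi_lip lk' _; exact: sqi_nsum.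
have ql : (q0 < n %/ l)%N by rewrite leq_divRL.
have := Hq (n %/ l).-1; rewrite -ltnS prednK; last exact: leq_ltn_trans ql.
move=> /(_ ql); set m := (n %/ l * l)%N => Hm.
have sNf : itg P (fun w => nsum Y m w * f (nsum Y m w)).
  by apply: sqiM; [exact: sqi_nsum|apply: sqi_lip lf _; exact: sqi_nsum].
have if' : itg P (fun w => f' (nsum Y m w)).
  apply: itg_bounded => [|w]; last exact: f'A.
  by apply: (measurableT_comp mf'); exact/sqi_meas/sqi_nsum.
have Em : `|Ex P (fun w => k (nsum Y m w))| <= e / 2.
  by rewrite /k ExB ?ExZ// 1?distrC//; exact: itgZ.
have Ed : `|Ex P (fun w => k (nsum Y n w) - k (nsum Y m w))| <= e / 2.
  have id : itg P (fun w => L * `|nsum Y n w - nsum Y m w|).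
    by apply: itgZ; apply: itg_norm; apply: sqi_itg; apply: sqiB; exact: sqi_nsum.
  apply: le_trans (Ex_norm_le _ id _) _.
  - by apply: itgB; exact: sqi_itg.
  - by move=> w; exact: lk'.
  rewrite ExZ; last by apply: itg_norm; apply: sqi_itg; apply: sqiB; exact: sqi_nsum.
  apply: le_trans (ler_wpM2l L0 (Hn n n0n)) _.
  have -> : L * (e / 2 / (L + 1)) = e / 2 * (L / (L + 1)) by field; rewrite gt_eqF.
  by rewrite ler_piMr ?(ltW e2)// ler_pdivrMr// mul1r lerDl.
rewrite ExB in Ed; [|exact: sqi_itg..].
have -> : Ex P (fun w => k (nsum Y n w)) = (Ex P (fun w => k (nsum Y n w)) -
   Ex P (fun w => k (nsum Y m w))) + Ex P (fun w => k (nsum Y m w)) by ring.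
by apply: le_trans (ler_normD _ _) _; lra.
Qed.

End stein_limit.

(** * Compactly supported Stein solutions *)

Section primitive.
Context (R : realType).
Notation mu := (@lebesgue_measure R).

Lemma is_derive_mvt (G h : R -> R) (a b : R) : (forall x : R, is_derive x (1 : R) G (h x)) ->
  a <= b -> exists2 c, a <= c <= b & G b - G a = h c * (b - a).
Proof.
move=> dG ab.
have cG : {within `[a, b], continuous G}.
  apply: continuous_subspaceT => x; apply: differentiable_continuous.
  by apply/derivable1_diffP; have [] := dG x.
have [c cab e] := MVT_segment ab (fun x _ => dG x) cG.
by exists c => //; move: cab; rewrite in_itv.
Qed.

Lemma lip_derive (G h : R -> R) (M : R) : (forall x : R, is_derive x (1 : R) G (h x)) ->
  (forall x, `|h x| <= M) -> lip M G.
Proof.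
move=> dG hM x y; wlog xy : x y / x <= y.
  move=> H; have [xy|/ltW yx] := leP x y; first exact: H.
  by rewrite distrC [`|x - y|]distrC; exact: H.
have [c _ e] := is_derive_mvt dG xy.
by rewrite distrC [`|x - y|]distrC e normrM ler_wpM2r.
Qed.

Variables (h : R -> R) (b : R).
Hypothesis ch : continuous h.
Hypothesis hb : forall x, b <= `|x| -> h x = 0.

Definition primitive (f : R -> R) (x : R) : R := \int[mu]_(t in `]-oo, x]) f t.

Lemma compact_support_integrable : mu.-integrable setT (EFin \o h).
Proof.
have i1 : mu.-integrable `[(- b), b] (EFin \o h).
  apply: continuous_compact_integrable; first exact: segment_compact.
  exact: continuous_subspaceT.
have mb : measurable (`[(- b), b]%classic : set (measurableTypeR R)) by [].
have := iffLR (integrable_mkcond _ mb) i1; congr (_.-integrable _ _).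
apply/funext => x; rewrite patchE; case: ifPn => //.
rewrite notin_setE /= in_itv/= => /negP; rewrite -ler_norml -ltNge => bx.
by rewrite hb// ltW.
Qed.

Lemma is_derive_primitive (x : R) : is_derive x (1 : R) (primitive h) (h x).
Proof.
have i1 : mu.-integrable `]-oo, (x + 1)] (EFin \o h).
  exact: integrableS compact_support_integrable.
have xx1 : x < x + 1 by rewrite ltrDl.
have FT := @continuous_FTC1 R h -oo%O x (x + 1) xx1 i1.
have [|d1 d2] := FT _ (@ch x); first by rewrite /Order.lt/=.
by apply: DeriveDef; [exact: d1|rewrite -derive1E; exact: d2].
Qed.

Lemma primitive_left x : x <= - b -> primitive h x = 0.
Proof.
move=> xb; rewrite /primitive /Rintegral (eq_integral (cst 0%E)) ?integral0//.
move=> t; rewrite inE /= in_itv/= => tx; rewrite hb//.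
by rewrite ler_normr; apply/orP; right; lra.
Qed.

Lemma primitive_right x : b <= x -> primitive h x = primitive h b.
Proof.
move=> bx; apply/eqP; rewrite -subr_eq0; have [c /andP[bc _] ->] := is_derive_mvt is_derive_primitive bx.
by rewrite hb ?mul0r// ler_normr bc.
Qed.

End primitive.

Section gaussian_test_function.
Context (R : realType) (v b : R).
Hypothesis v0 : 0 < v.
Hypothesis b0 : 0 < b.

Definition gweight (x : R) : R := expR (- (x ^+ 2 / (2 * v))).

Lemma gweight_gt0 x : 0 < gweight x. Proof. exact: expR_gt0. Qed.

Lemma gweight_le1 x : gweight x <= 1.
Proof.
by rewrite -expR0 ler_expR oppr_le0 divr_ge0 ?sqr_ge0// mulr_ge0// ltW.
Qed.

Lemma continuous_gweight : continuous gweight.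
Proof.
move=> x; apply: continuous_comp; last exact: continuous_expR.
apply: cvgN; apply: cvgM; last exact: cvg_cst.
exact: exprn_continuous.
Qed.

Let is_derive_gweightV (x : R) :
  is_derive x (1 : R) (fun y => (gweight y)^-1) (x / v * (gweight x)^-1).
Proof.
have -> : (fun y => (gweight y)^-1) = (expR \o (fun y : R => y ^+ 2 / (2 * v))).
  by apply/funext => y; rewrite /= /gweight expRN invrK.
have d2 : is_derive x (1 : R) (fun y : R => y ^+ 2 / (2 * v)) (x / v).
  have -> : (fun y : R => y ^+ 2 / (2 * v)) = (2 * v)^-1 \*: (id : R -> R) ^+ 2.
    by apply/funext => y; rewrite mulrC.
  have := is_deriveZ (2 * v)^-1 (is_deriveX 2 (is_derive_id x (1 : R))).
  move/is_derive_eq; apply; rewrite /GRing.scale /= expr1; field.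
  by rewrite gt_eqF.
have := @is_derive1_comp _ expR (fun y : R => y ^+ 2 / (2 * v)) _ _ _
  (is_derive_expR (x ^+ 2 / (2 * v))) d2.
by move/is_derive_eq; apply; rewrite /gweight expRN invrK mulrC.
Qed.

Variables (k : R -> R) (L : R).
Hypothesis lk : lip L k.
Hypothesis k1 : forall x, `|k x| <= 1.
Hypothesis kb : forall x, b <= `|x| -> k x = 0.
Hypothesis k_int : primitive (fun x => k x * gweight x) b = 0.

Let h (x : R) : R := k x * gweight x.
Let ch : continuous h.
Proof. by move=> x; apply: cvgM; [exact: lip_continuous lk _|exact: continuous_gweight]. Qed.
Let hb x : b <= `|x| -> h x = 0. Proof. by move=> bx; rewrite /h kb// mul0r. Qed.

(** The solution of v f' - x f = v k vanishing at minus infinity. Past b the numerator is constant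
    and [k_int] makes it 0, so f is supported in [-b, b], where the weight is bounded below. *)
Let f (x : R) : R := primitive h x / gweight x.
Let f' (x : R) : R := k x + x * f x / v.

Let is_derive_f (x : R) : is_derive x (1 : R) f (f' x).
Proof.
have := is_deriveM (is_derive_primitive ch hb x) (is_derive_gweightV x).
move/is_derive_eq; apply; rewrite /GRing.scale /= /f' /f /h.
by field; rewrite !gt_eqF// gweight_gt0.
Qed.

Let fb x : b <= `|x| -> f x = 0.
Proof.
rewrite ler_normr => /orP[bx|bx]; rewrite /f.
  by rewrite (primitive_right ch hb bx) k_int mul0r.
by rewrite (primitive_left hb) ?mul0r//; lra.
Qed.

(** The primitive of h is at most 2b on [-b, b], as |h| <= 1, and the weight there is at least
    [gweight b]. Then [A] bounds f' and [D] is a Lipschitz constant of f'. *)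
Let F0 : R := b * 2 / gweight b.
Let A : R := 1 + b * F0 / v.
Let D : R := L + (F0 + b * A) / v.

Let F0_ge0 : 0 <= F0. Proof. by rewrite divr_ge0 ?mulr_ge0//; apply: ltW => //; exact: gweight_gt0. Qed.
Let bF_ge0 : 0 <= b * F0 / v.
Proof.
apply: divr_ge0; last exact: ltW.
by apply: mulr_ge0; [exact: ltW|exact: F0_ge0].
Qed.
Let A_ge0 : 0 <= A. Proof. exact: addr_ge0. Qed.

Let f_le x : `|f x| <= F0.
Proof.
have [bx|xb] := leP b `|x|; first by rewrite fb// normr0.
rewrite /f normrM normfV (gtr0_norm (gweight_gt0 x)).
apply: ler_pM => //; first by rewrite invr_ge0 ltW// gweight_gt0.
  have lh : lip 1 (primitive h).
    apply: lip_derive (is_derive_primitive ch hb) _ => y.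
    rewrite normrM -[leRHS]mulr1 ler_pM// gtr0_norm ?gweight_gt0//; exact: gweight_le1.
  have := lh x (- b); rewrite (primitive_left hb (lexx _)) subr0 mul1r => /le_trans; apply.
  by apply: le_trans (ler_normB _ _) _; rewrite normrN (gtr0_norm b0); lra.
rewrite lef_pV2 ?posrE ?gweight_gt0// ler_expR lerN2 ler_pM2r ?invr_gt0 ?mulr_gt0//.
rewrite -(real_normK (num_real x)).
by apply: lerXn2r; rewrite ?nnegrE; [exact: normr_ge0|exact: ltW|exact: ltW].
Qed.

Let f'_le x : `|f' x| <= A.
Proof.
apply: le_trans (ler_normD _ _) _; apply: lerD => //.
have [bx|xb] := leP b `|x|; first by rewrite fb// mulr0 mul0r normr0.
rewrite 2!normrM normfV (gtr0_norm v0) ler_pM2r ?invr_gt0//.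
by apply: ler_pM => //; exact: ltW.
Qed.

Let lip_f : lip A f := lip_derive is_derive_f f'_le.

Let lip_f' : lip D f'.
Proof.
(* As k is only Lipschitz, f' need not be differentiable; its part x f / v is, and the two are
   treated separately. *)
have lx : lip ((F0 + b * A) / v) (fun x => x * f x / v).
  apply: (@lip_derive _ _ (fun x => (f x + x * f' x) / v)) => x.
    have dx : is_derive x (1 : R) (fun y : R => y) 1 by exact: is_derive_id.
    have := is_deriveM (is_deriveM dx (is_derive_f x)) (is_derive_cst (v^-1) x 1).
    move/is_derive_eq; apply; rewrite /GRing.scale /=; ring.
  rewrite normrM normfV (gtr0_norm v0) ler_pM2r ?invr_gt0//.
  apply: le_trans (ler_normD _ _) _; apply: lerD => //.
  have [bx|xb] := leP b `|x|.
    rewrite /f' kb// fb// mulr0 mul0r addr0 mulr0 normr0.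
    by apply: mulr_ge0; [exact: ltW|exact: A_ge0].
  by rewrite normrM; apply: ler_pM => //; exact: ltW.
move=> x y; rewrite /f' opprD addrACA /D mulrDl.
by apply: le_trans (ler_normD _ _) _; apply: lerD; [exact: lk|exact: lx].
Qed.

Lemma gaussian_test_function : exists (g g' : R -> R) (A B : R),
  [/\ lip A g, forall x, `|g' x| <= A, measurable_fun setT g',
    forall x y, `|g y - g x - (y - x) * g' x| <= B * (y - x) ^+ 2 &
    forall x, v * g' x - x * g x = v * k x].
Proof.
exists f, f', A, D; split => //.
- exact: lip_measurable lip_f'.
- move=> x y; have D0 := lip_ge0 lip_f'.
  have [c cxy ->] : exists2 c, `|c - x| <= `|y - x| & f y - f x = f' c * (y - x).
    have [xy|/ltW yx] := leP x y.
      have [c /andP[xc cy] e] := is_derive_mvt is_derive_f xy; exists c => //.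
      by rewrite !ger0_norm ?subr_ge0// lerD2r.
    have [c /andP[yc cx] e] := is_derive_mvt is_derive_f yx; exists c.
      by rewrite distrC [leRHS]distrC !ger0_norm ?subr_ge0// lerB.
    by rewrite -opprB e; ring.
  have -> : f' c * (y - x) - (y - x) * f' x = (f' c - f' x) * (y - x) by ring.
  rewrite normrM -(real_normK (num_real (y - x))) expr2 mulrA ler_wpM2r//.
  by apply: le_trans (lip_f' _ _) _; rewrite ler_wpM2l.
- by move=> x; rewrite /f'; field; rewrite gt_eqF.
Qed.

End gaussian_test_function.

(** * Ramps *)

Section ramps.
Context (R : realType).

Definition clamp (y : R) : R := Num.max 0 (Num.min 1 y).
Definition ramp (a e x : R) : R := clamp ((a + e - x) / e).
Definition trapezoid (b x : R) : R := clamp (b - `|x|).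

Lemma clamp_ge0 y : 0 <= clamp y. Proof. by rewrite le_max lexx. Qed.
Lemma clamp_le1 y : clamp y <= 1.
Proof. by rewrite ge_max ler01/= ge_min lexx. Qed.

Lemma clamp_eq1 y : 1 <= y -> clamp y = 1.
Proof. by move=> y1; rewrite /clamp min_l// max_r. Qed.

Lemma clamp_eq0 y : y <= 0 -> clamp y = 0.
Proof. by move=> y0; rewrite /clamp max_l// ge_min y0 orbT. Qed.

Lemma clamp_le x y : x <= y -> clamp x <= clamp y.
Proof.
move=> xy; rewrite /clamp ge_max !le_max lexx/=; apply/orP; right.
by rewrite le_min !ge_min lexx xy orbT.
Qed.

Lemma clamp_dist x y : `|clamp x - clamp y| <= `|x - y|.
Proof.
wlog xy : x y / x <= y.
  move=> H; have [xy|/ltW yx] := leP x y; first exact: H.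
  by rewrite distrC [leRHS]distrC; exact: H.
rewrite distrC [leRHS]distrC !ger0_norm ?subr_ge0//; last exact: clamp_le.
by rewrite /clamp /Order.max /Order.min; do !case: ifP; lra.
Qed.

Lemma ramp_ge0 a e x : 0 <= ramp a e x. Proof. exact: clamp_ge0. Qed.
Lemma ramp_le1 a e x : ramp a e x <= 1. Proof. exact: clamp_le1. Qed.

Lemma ramp_eq1 a e x : 0 < e -> x <= a -> ramp a e x = 1.
Proof. by move=> e0 xa; apply: clamp_eq1; rewrite ler_pdivlMr// mul1r; lra. Qed.

Lemma ramp_eq0 a e x : 0 < e -> a + e <= x -> ramp a e x = 0.
Proof. by move=> e0 xa; apply: clamp_eq0; rewrite ler_pdivrMr// mul0r; lra. Qed.

Lemma ramp_le_shift a a' e x : 0 < e -> a <= a' -> ramp a e x <= ramp a' e x.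
Proof.
by move=> e0 aa'; apply: clamp_le; rewrite ler_pM2r ?invr_gt0//; lra.
Qed.

Lemma lip_ramp a e : 0 < e -> lip e^-1 (ramp a e).
Proof.
move=> e0 x y; apply: le_trans (clamp_dist _ _) _.
rewrite -mulrBl normrM normfV (gtr0_norm e0) mulrC ler_pM2l ?invr_gt0//.
have -> : a + e - x - (a + e - y) = y - x by ring.
by rewrite distrC.
Qed.

Lemma lip_trapezoid b : lip 1 (trapezoid b).
Proof.
move=> x y; rewrite mul1r; apply: le_trans (clamp_dist _ _) _.
have -> : b - `|x| - (b - `|y|) = `|y| - `|x| by ring.
by rewrite [leRHS]distrC; exact: ler_dist_dist.
Qed.

Lemma trapezoid_eq0 b x : b <= `|x| -> trapezoid b x = 0.
Proof. by move=> bx; apply: clamp_eq0; rewrite subr_le0. Qed.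

Lemma trapezoid_eq1 b x : `|x| <= b - 1 -> trapezoid b x = 1.
Proof. by move=> xb; apply: clamp_eq1; lra. Qed.

(** Chebyshev's inequality before taking expectations; it controls the mass neglected by compact
    support through the variance alone. *)
Lemma trapezoid_compl_le b x : 1 < b -> 1 - trapezoid b x <= x ^+ 2 / (b - 1) ^+ 2.
Proof.
move=> b1; have [xb|bx] := leP `|x| (b - 1).
  by rewrite trapezoid_eq1// subrr divr_ge0 ?sqr_ge0.
apply: (@le_trans _ _ 1); first by rewrite gerBl clamp_ge0.
rewrite ler_pdivlMr ?exprn_gt0 ?subr_gt0// mul1r -(real_normK (num_real x)).
by apply: lerXn2r; rewrite ?nnegrE; [rewrite subr_ge0 ltW|exact: normr_ge0|exact: ltW].
Qed.

Lemma lip_mul_bounded (L1 L2 : R) (g1 g2 : R -> R) : lip L1 g1 -> lip L2 g2 ->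
  (forall x, `|g1 x| <= 1) -> (forall x, `|g2 x| <= 1) ->
  lip (L1 + L2) (fun x => g1 x * g2 x).
Proof.
move=> l1 l2 b1 b2 x y.
have -> : g1 x * g2 x - g1 y * g2 y = (g1 x - g1 y) * g2 x + g1 y * (g2 x - g2 y) by ring.
apply: le_trans (ler_normD _ _) _; rewrite [leRHS]mulrDl.
apply: lerD; rewrite normrM.
  by rewrite -[leRHS]mulr1 ler_pM.
by rewrite -[leRHS]mul1r ler_pM.
Qed.

End ramps.

(** * Means of ramps under a truncated Gaussian weight *)

Section ramp_means.
Context (R : realType) (v b e : R).
Hypothesis v0 : 0 < v.
Hypothesis b2 : 2 <= b.
Hypothesis e0 : 0 < e.

Let b0 : 0 < b. Proof. by apply: lt_le_trans b2. Qed.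
Let cg := continuous_gweight (v := v).
Let p := gweight v.

Let w (g : R -> R) x : R := trapezoid b x * g x * p x.
Let cw (g : R -> R) : continuous g -> continuous (w g).
Proof.
move=> hg x; apply: cvgM; last exact: cg.
by apply: cvgM; [exact: (lip_continuous (lip_trapezoid b))|exact: hg].
Qed.
Let wb (g : R -> R) x : b <= `|x| -> w g x = 0.
Proof. by move=> bx; rewrite /w trapezoid_eq0// !mul0r. Qed.

Let cone : continuous (fun _ : R => 1 : R). Proof. by move=> x; exact: cvg_cst. Qed.
Let cramp a : continuous (ramp a e).
Proof. exact: lip_continuous (lip_ramp a e0). Qed.

Let J (g : R -> R) : R := primitive (w g) b.

Let wle1 (g : R -> R) x : 0 <= g x -> g x <= 1 -> 0 <= w g x <= 1.
Proof.
move=> g0 g1; have := gweight_gt0 v x; have := gweight_le1 v0 x; rewrite -/(p x) => p1 p0.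
have := clamp_ge0 (b - `|x|); have := clamp_le1 (b - `|x|).
rewrite -/(trapezoid b x) => t1 t0.
rewrite /w !mulr_ge0//=; last exact: ltW.
have -> : 1 = 1 * 1 * 1 :> R by rewrite !mulr1.
by rewrite !ler_pM// ?mulr_ge0// ltW.
Qed.

Let mono (g : R -> R) : continuous g -> (forall x, 0 <= g x) -> forall x y, x <= y ->
  primitive (w g) x <= primitive (w g) y.
Proof.
move=> hg g0 x y xy; rewrite -subr_ge0.
have [c _ ->] := is_derive_mvt (is_derive_primitive (cw hg) (wb g)) xy.
rewrite mulr_ge0 ?subr_ge0// /w !mulr_ge0 ?clamp_ge0//.
by apply: ltW; exact: gweight_gt0.
Qed.

(** On [-1, 1] the trapezoid equals 1, because b >= 2, and the weight is at least p 1. The bound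
    does not involve b. *)
Let J1_ge : 2 * p 1 <= J (fun=> 1 : R).
Proof.
have m := mono cone (fun=> ler01).
have dP := is_derive_primitive (cw cone) (wb (fun=> 1 : R)).
have b1 : 1 <= b by apply: le_trans b2; rewrite ler1n.
have h1 := m _ _ b1.
have b1' : - b <= -1 by rewrite lerN2.
have h2 := m _ _ b1'.
rewrite (primitive_left (wb (fun=> 1 : R)) (lexx _)) in h2.
have N1 : -1 <= 1 :> R by lra.
have [c /andP[c1 c2] e1] := is_derive_mvt dP N1.
have wc : p 1 <= w (fun=> 1 : R) c.
  have nc : `|c| <= 1 by rewrite ler_norml c1.
  have tc : `|c| <= b - 1 by apply: le_trans nc _; rewrite lerBrDr; exact: b2.
  rewrite /w (trapezoid_eq1 tc) !mul1r.
  rewrite /p /gweight ler_expR lerN2 expr1n ler_pM2r ?invr_gt0 ?mulr_gt0//.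
  by rewrite -(real_normK (num_real c)) expr_le1.
rewrite /J; lra.
Qed.

Let J1_gt0 : 0 < J (fun=> 1 : R).
Proof. by apply: lt_le_trans J1_ge; rewrite mulr_gt0// gweight_gt0. Qed.

Let int (g : R -> R) : continuous g -> (@lebesgue_measure R).-integrable `]-oo, b] (EFin \o w g).
Proof.
move=> hg; apply: integrableS (compact_support_integrable (cw hg) (wb g)) => //.
Qed.

Let J_sub (g1 g2 : R -> R) : continuous g1 -> continuous g2 ->
  J (fun x => g1 x - g2 x) = J g1 - J g2.
Proof.
move=> h1 h2; rewrite /J /primitive -RintegralB//; [|exact: int..].
by congr (Rintegral _ _ _); apply/funext => x; rewrite /w; ring.
Qed.

Let J_scale (c : R) (g : R -> R) : continuous g -> J (fun x => c * g x) = c * J g.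
Proof.
move=> h1; rewrite /J /primitive -RintegralZl//; last exact: int.
by congr (Rintegral _ _ _); apply/funext => x; rewrite /w; ring.
Qed.

Let J_ge0 (g : R -> R) : continuous g -> (forall x, 0 <= g x) -> 0 <= J g.
Proof.
move=> hg g0; rewrite -(primitive_left (wb g) (lexx _)); apply: mono => //.
by rewrite ge0_cp// ltW.
Qed.

(** The constant c for which trapezoid * (ramp - c) * p has integral 0, as a compactly supported
    Stein solution requires. *)
Definition ramp_mean a : R := J (ramp a e) / J (fun=> 1 : R).

Lemma ramp_mean_ge0 a : 0 <= ramp_mean a.
Proof. by rewrite divr_ge0 ?(ltW J1_gt0)// J_ge0// => x; exact: ramp_ge0. Qed.

Lemma ramp_mean_le1 a : ramp_mean a <= 1.
Proof.
rewrite ler_pdivrMr// mul1r -subr_ge0 -J_sub//; apply: J_ge0.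
  by move=> x; apply: cvgB; [exact: cone|exact: cramp].
by move=> x; rewrite subr_ge0 ramp_le1.
Qed.

(** The two ramps differ by at most 1, and only on an interval of length 2e; the normalization is at
    least 2 p 1. *)
Lemma ramp_mean_diff a : ramp_mean a - ramp_mean (a - e) <= e / p 1.
Proof.
rewrite -mulrBl -J_sub//; set g := fun x => ramp a e x - ramp (a - e) e x.
have hg : continuous g by move=> x; apply: cvgB; exact: cramp.
have aea : a - e <= a by rewrite gerBl ltW.
have g0 x : 0 <= g x by rewrite subr_ge0; exact: ramp_le_shift.
have g1 x : g x <= 1.
  by rewrite /g; have := ramp_le1 a e x; have := ramp_ge0 (a - e) e x; lra.
have dP := is_derive_primitive (cw hg) (wb g).
have m := mono hg g0.
have gl x : x <= a - e -> g x = 0.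
  by move=> xa; rewrite /g !ramp_eq1 ?subrr//; lra.
have gr x : a + e <= x -> g x = 0.
  by move=> xa; rewrite /g !ramp_eq0 ?subrr//; lra.
have L x : x <= a - e -> primitive (w g) x = primitive (w g) (a - e).
  move=> xa; have [c /andP[_ c2] h] := is_derive_mvt dP xa.
  have wc : w g c = 0 by rewrite /w gl// mulr0 mul0r.
  by move: h; rewrite wc mul0r => /eqP; rewrite subr_eq0 => /eqP.
have U x : a + e <= x -> primitive (w g) x = primitive (w g) (a + e).
  move=> xa; have [c /andP[c1 _] h] := is_derive_mvt dP xa.
  have wc : w g c = 0 by rewrite /w gr// mulr0 mul0r.
  by move: h; rewrite wc mul0r => /eqP; rewrite subr_eq0 => /eqP.
(* The primitive is constant on either side of [a - e, a + e]; so, wherever -b and b lie, J g is at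
   most its increment over this interval. *)
have hu : primitive (w g) b <= primitive (w g) (a + e).
  rewrite -(U (Num.max b (a + e))); first by apply: m; rewrite le_max lexx.
  by rewrite le_max lexx orbT.
have hl : primitive (w g) (a - e) <= 0.
  rewrite -(primitive_left (wb g) (lexx _)) -(L (Num.min (- b) (a - e))).
    by apply: m; rewrite ge_min lexx.
  by rewrite ge_min lexx orbT.
have hd : primitive (w g) (a + e) - primitive (w g) (a - e) <= 2 * e.
  have aa : a - e <= a + e by lra.
  have [c _ ->] := is_derive_mvt dP aa.
  have /andP[_ w1] := wle1 (g0 c) (g1 c).
  have -> : a + e - (a - e) = 2 * e by ring.
  by rewrite -[leRHS]mul1r ler_wpM2r// mulr_ge0// ltW.
have Jg : J g <= 2 * e by rewrite /J; lra.
have p1 : 0 < p 1 := gweight_gt0 v 1.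
rewrite ler_pdivrMr// (le_trans Jg)//.
rewrite -mulrA -ler_pdivrMl// mulrC -mulrA mulfV ?gt_eqF// mulr1 ler_pdivlMl//.
by rewrite mulrC.
Qed.

Lemma ramp_test a : exists (g g' : R -> R) (A B L : R),
  [/\ [/\ lip A g, forall x, `|g' x| <= A, measurable_fun setT g' &
    forall x y, `|g y - g x - (y - x) * g' x| <= B * (y - x) ^+ 2],
    lip L (fun x => v * g' x - x * g x) &
    forall x, v * g' x - x * g x = v * (trapezoid b x * (ramp a e x - ramp_mean a))].
Proof.
pose k x := trapezoid b x * (ramp a e x - ramp_mean a).
have nr x : `|ramp a e x - ramp_mean a| <= 1.
  have := ramp_ge0 a e x; have := ramp_le1 a e x.
  have := ramp_mean_ge0 a; have := ramp_mean_le1 a => h1 h2 h3 h4.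
  by rewrite ler_norml; apply/andP; split; lra.
have nt x : `|trapezoid b x| <= 1 by rewrite ger0_norm ?clamp_ge0// clamp_le1.
have lr : lip e^-1 (fun x => ramp a e x - ramp_mean a).
  by move=> x y; rewrite opprB addrA subrK; exact: lip_ramp.
have lk : lip (1 + e^-1) k by exact: lip_mul_bounded (lip_trapezoid b) lr nt nr.
have k1 x : `|k x| <= 1 by rewrite normrM -[leRHS]mulr1 ler_pM.
have kb x : b <= `|x| -> k x = 0 by move=> bx; rewrite /k trapezoid_eq0// mul0r.
have k_int : primitive (fun x => k x * gweight v x) b = 0.
  have cc : continuous (fun x : R => ramp_mean a * 1) by move=> x; exact: cvg_cst.
  have -> : (fun x => k x * gweight v x) = w (fun x => ramp a e x - ramp_mean a * 1).
    by apply/funext => x; rewrite mulr1.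
  rewrite -/(J _) J_sub// J_scale// /ramp_mean divfK ?subrr//.
  by rewrite gt_eqF.
have [g [g' [A [B [h1 h2 h3 h4 h5]]]]] := gaussian_test_function v0 b0 lk k1 kb k_int.
exists g, g', A, B, (v * (1 + e^-1)); split => //.
by move=> x y; rewrite !h5 -mulrBr normrM (gtr0_norm v0) -mulrA ler_pM2l.
Qed.

End ramp_means.

Section ramp_clt.
Context d (T : measurableType d) (R : realType) (P : probability T R).
Variable Y : nat -> T -> R.
Hypothesis Ysq : forall i, sqi P (Y i).
Hypothesis Ymean : forall i, Ex P (Y i) = 0.
Hypothesis AY : associated_seq P Y.
Hypothesis Ycov : forall i k, Cov P (Y i) (Y (i + k)%N) = Cov P (Y 0%N) (Y k).
Hypothesis csum : cvgn (series (fun k => Cov P (Y 0%N) (Y k))).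
Hypothesis Ysum : forall (l j : nat) (F : R -> R), measurable_fun setT F ->
  itg P (fun w => F (\sum_(k < l) Y k w)) ->
  itg P (fun w => F (\sum_(k < l) Y (j + k)%N w)) /\
  Ex P (fun w => F (\sum_(k < l) Y (j + k)%N w)) =
  Ex P (fun w => F (\sum_(k < l) Y k w)).
Let v := lim_var P Y.
Hypothesis v0 : 0 < v.

(** Here ramp - c splits into k, whose mean tends to 0 by the Stein limit, and (1 - trapezoid) (ramp
    - c), whose mean is bounded by Chebyshev uniformly in n. *)
Lemma Ex_ramp_near_mean (b e a eta : R) : 2 <= b -> 0 < e -> 0 < eta ->
  exists N : nat, forall n, (N <= n)%N ->
  `|Ex P (fun w => ramp a e (nsum Y n w)) - ramp_mean v b e a| <=
  eta + v / (b - 1) ^+ 2.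
Proof.
move=> b2 e0 eta0; have b1 : 1 < b by apply: lt_le_trans b2; rewrite ltr1n.
have [g [g' [A [B [L [[h1 h2 h3 h4] h5 h6]]]]]] := ramp_test v0 b2 e0 a.
have := stein_limit Ysq Ymean AY Ycov csum Ysum h1 h2 h3 h4 h5.
rewrite -/v => /cvgrPdist_le /(_ (v * eta) (mulr_gt0 v0 eta0)) [N _ HN].
exists N => n Nn; have := HN n Nn; rewrite /= sub0r normrN.
under eq_fun do rewrite h6.
pose k x := trapezoid b x * (ramp a e x - ramp_mean v b e a).
pose rest x := (1 - trapezoid b x) * (ramp a e x - ramp_mean v b e a).
have sN := sqi_nsum Ysq n; have mN := sqi_meas sN.
have ir : itg P (fun w => ramp a e (nsum Y n w)).
  by apply: sqi_itg; exact: sqi_lip (lip_ramp a e0) sN.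
have mr : measurable_fun setT (fun w => ramp a e (nsum Y n w)) := itg_meas ir.
have mt : measurable_fun setT (fun w => trapezoid b (nsum Y n w)).
  exact: sqi_meas (sqi_lip (lip_trapezoid b) sN).
have nr x : `|ramp a e x - ramp_mean v b e a| <= 1.
  have := ramp_ge0 a e x; have := ramp_le1 a e x.
  have := ramp_mean_ge0 v0 b2 e0 a; have := ramp_mean_le1 v0 b2 e0 a => q1 q2 q3 q4.
  by rewrite ler_norml; apply/andP; split; lra.
have t0 x : 0 <= trapezoid b x by exact: clamp_ge0.
have t1 x : trapezoid b x <= 1 by exact: clamp_le1.
have mrm : measurable_fun setT (fun w => ramp a e (nsum Y n w) - ramp_mean v b e a).
  exact: measurable_funB.
have ik : itg P (fun w => k (nsum Y n w)).
  apply: (@itg_bounded _ _ _ _ _ 1) => [|w]; first exact: measurable_funM.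
  by rewrite normrM ger0_norm// -[leRHS]mulr1 ler_pM.
have irest : itg P (fun w => rest (nsum Y n w)).
  apply: (@itg_bounded _ _ _ _ _ 1) => [|w].
    by apply: measurable_funM => //; exact: measurable_funB.
  rewrite normrM ger0_norm ?subr_ge0// -[leRHS]mulr1 ler_pM ?subr_ge0//.
  by rewrite gerBl.
rewrite ExZ// normrM (gtr0_norm v0) ler_pM2l// => hk.
have -> : Ex P (fun w => ramp a e (nsum Y n w)) - ramp_mean v b e a =
    Ex P (fun w => k (nsum Y n w)) + Ex P (fun w => rest (nsum Y n w)).
  rewrite -ExD// -[X in _ - X](Ex_cst P) -ExB//; last exact: itg_cst.
  by congr (Ex _ _); apply/funext => w; rewrite /k /rest; ring.
apply: le_trans (ler_normD _ _) _; apply: lerD => //.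
have isq : itg P (fun w => ((b - 1) ^+ 2)^-1 * nsum Y n w ^+ 2).
  by apply: itgZ; exact: sN.2.
apply: le_trans (Ex_norm_le irest isq _) _.
  move=> w; rewrite normrM ger0_norm ?subr_ge0// -[leRHS]mulr1.
  rewrite ler_pM ?subr_ge0// mulrC; exact: trapezoid_compl_le.
rewrite ExZ; last exact: sN.2.
rewrite mulrC ler_pM2r ?invr_gt0 ?exprn_gt0 ?subr_gt0//.
exact: var_nsum_le.
Qed.

(** The times n and m are unrelated: this Cauchy-type estimate takes the place of convergence in
    law. *)
Lemma ramp_clt (t eta : R) : 0 < eta -> exists2 e : R, 0 < e &
  exists N : nat, forall n m, (N <= n)%N -> (N <= m)%N ->
  Ex P (fun w => ramp t e (nsum Y n w)) -
  Ex P (fun w => ramp (t - e) e (nsum Y m w)) <= eta.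
Proof.
move=> eta0; have e8 : 0 < eta / 8 by rewrite divr_gt0.
(* With z = 8 v / eta this gives (b - 1)^2 = (1 + z)^2 >= z, so the tail error v / (b - 1)^2 is at
   most eta / 8. The width e below makes the shift cost eta / 4. *)
pose b := 2 + v / (eta / 8).
have vb : 0 <= v / (eta / 8) by rewrite divr_ge0 ?ltW.
have b2 : 2 <= b by rewrite lerDl.
have hb : v / (b - 1) ^+ 2 <= eta / 8.
  have b1 : 0 < b - 1 by rewrite subr_gt0 (lt_le_trans _ b2)// ltr1n.
  rewrite ler_pdivrMr ?exprn_gt0// mulrC -ler_pdivrMr//.
  have -> : b - 1 = 1 + v / (eta / 8) by rewrite /b; ring.
  by set z := v / (eta / 8) in vb *; nra.
have p0 := gweight_gt0 v 1.
pose e := eta / 4 * gweight v 1.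
have e0 : 0 < e by rewrite mulr_gt0// divr_gt0.
exists e => //.
have [N1 H1] := Ex_ramp_near_mean t b2 e0 e8.
have [N2 H2] := Ex_ramp_near_mean (t - e) b2 e0 e8.
have hd := ramp_mean_diff v0 b2 e0 t.
have de : e / gweight v 1 = eta / 4 by rewrite /e mulfK// gt_eqF.
exists (maxn N1 N2) => n m; rewrite !geq_max => /andP[n1 _] /andP[_ m2].
have := H1 n n1 => /ler_normlP[_ h1]; have := H2 m m2 => /ler_normlP[h2 _].
rewrite de in hd; lra.
Qed.

End ramp_clt.

(** * Logarithmic averages *)

Section harmonic.
Context (R : realType).

Definition harm (n : nat) : R := \sum_(1 <= k < n.+1) k%:R^-1.

Lemma harm0 : harm 0 = 0. Proof. by rewrite /harm big_geq. Qed.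

Lemma harmS n : harm n.+1 = harm n + n.+1%:R^-1.
Proof. by rewrite /harm big_nat_recr. Qed.

Lemma harm1 : harm 1 = 1. Proof. by rewrite harmS harm0 invr1 add0r. Qed.

Lemma harm_ge0 n : 0 <= harm n.
Proof. by apply: sumr_ge0 => k _; rewrite invr_ge0. Qed.

Lemma inv_le_ln_diff (n : nat) : n.+2%:R^-1 <= ln (n.+2%:R) - ln (n.+1%:R) :> R.
Proof.
have n1 : 0 < n.+1%:R :> R by [].
have n2 : 0 < n.+2%:R :> R by [].
rewrite -lerN2 opprB -ln_div ?posrE//.
have -> : n.+1%:R / n.+2%:R = 1 + (- n.+2%:R^-1) :> R.
  rewrite -[n.+2%:R]natr1; set x := n.+1%:R in n1 *; field.
  by apply: lt0r_neq0; lra.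
apply: le_ln1Dx; rewrite ltrNl opprK invf_lt1// ltr1n//.
Qed.

Lemma ln_diff_le_inv (n : nat) : ln (n.+2%:R) - ln (n.+1%:R) <= n.+1%:R^-1 :> R.
Proof.
have n1 : 0 < n.+1%:R :> R by [].
rewrite -ln_div ?posrE//.
have -> : n.+2%:R / n.+1%:R = 1 + n.+1%:R^-1 :> R.
  by rewrite -[n.+2]addn1 natrD mulrDl mulfV ?gt_eqF// mul1r.
by apply: le_ln1Dx; apply: lt_trans (ltrN10 _) _; rewrite invr_gt0.
Qed.

Lemma harm_diff_le n m : (n <= m)%N ->
  harm m.+1 - harm n.+1 <= ln (m.+1%:R) - ln (n.+1%:R).
Proof.
move=> /subnKC <-; elim: (m - n)%N => [|l IH]; first by rewrite addn0 !subrr.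
rewrite addnS harmS; move: (inv_le_ln_diff (n + l)).
by set z : R := _.+2%:R^-1; move=> h; lra.
Qed.

Lemma harm_le_ln n : harm n.+1 <= 1 + ln (n.+1%:R).
Proof.
by have := harm_diff_le (leq0n n); rewrite harm1 ln1; lra.
Qed.

Lemma ln_le_harm n : ln (n.+1%:R) <= harm n.+1.
Proof.
suff : ln (n.+2%:R) <= harm n.+1.
  by apply: le_trans; rewrite ler_ln ?posrE// ler_nat.
elim: n => [|n IH].
  by have := ln_diff_le_inv 0; rewrite harm1 ln1 invr1; lra.
rewrite harmS; move: (ln_diff_le_inv n.+1).
by set z : R := _.+2%:R^-1; move=> h; lra.
Qed.

Lemma inv_sqrt_sum_le n : \sum_(1 <= k < n.+1) (Num.sqrt k%:R)^-1 <= 2 * Num.sqrt n%:R :> R.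
Proof.
elim: n => [|n IH]; first by rewrite big_geq// mulr_ge0.
rewrite big_nat_recr//=; set x := Num.sqrt n%:R in IH *; set y := Num.sqrt n.+1%:R.
have x2 : x ^+ 2 = n%:R by rewrite sqr_sqrtr.
have y2 : y ^+ 2 = x ^+ 2 + 1 by rewrite x2 sqr_sqrtr// natr1.
have y0 : 0 < y by rewrite sqrtr_gt0.
(* Since y^2 = x^2 + 1, multiplying by y reduces this to (y - x)^2 >= 0. *)
suff : y^-1 <= 2 * y - 2 * x by lra.
rewrite -(ler_pM2r y0) mulVf ?gt_eqF//; nra.
Qed.

End harmonic.

Section almost_sure.
Context d (T : measurableType d) (R : realType) (P : probability T R).

(** By monotone convergence the sum of the f m is integrable, hence almost everywhere finite, and
    the terms of a convergent series tend to 0. *)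
Lemma ae_cvg0_of_summable (f : nat -> T -> R) (C : R) :
  (forall m w, 0 <= f m w) -> (forall m, itg P (f m)) ->
  (forall n, \sum_(m < n) Ex P (f m) <= C) ->
  {ae P, forall w, (fun m => f m w) @ \oo --> (0 : R)}.
Proof.
move=> f0 itf fC.
pose S w := (\sum_(m <oo) (f m w)%:E)%E.
have S0 w : (0 <= S w)%E by apply: nneseries_ge0 => m _ _; rewrite lee_fin.
have mf m : measurable_fun setT (fun w => (f m w)%:E).
  by apply/measurable_EFinP; exact: itg_meas (itf m).
have mS : measurable_fun setT S.
  by apply: ge0_emeasurable_sum => // m w _ _; rewrite lee_fin.
have intS : (\int[P]_w S w <= C%:E)%E.
  rewrite /S integral_nneseries//; last by move=> m w _; rewrite lee_fin.
  apply: lime_le.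
    by apply: is_cvg_nneseries => m _ _; apply: integral_ge0 => w _; rewrite lee_fin.
  apply: nearW => n; rewrite big_mkord.
  rewrite (eq_bigr (fun m : 'I_n => (Ex P (f m))%:E)).
    by rewrite sumEFin lee_fin fC.
  move=> m _; rewrite /Ex /Rintegral fineK//.
  exact: (integrable_fin_num measurableT (itf m)).
have iS : P.-integrable setT S.
  apply/integrableP; split=> //.
  under eq_integral do rewrite gee0_abs//.
  by apply: le_lt_trans intS _; rewrite ltry.
apply: filterS (integrable_ae measurableT iS) => w /(_ I) finS.
apply: cvg_series_cvg_0; apply: nondecreasing_is_cvgn.
  by apply: nondecreasing_series => m _ _.
exists (fine (S w)) => _ [n _ <-].
rewrite -lee_fin fineK// /series/= -sumEFin.
by apply: nneseries_lim_ge => m _; rewrite lee_fin.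
Qed.

End almost_sure.

Section log_averages.
Context d (T : measurableType d) (R : realType) (P : probability T R).
Variable Y : nat -> T -> R.
Hypothesis Ysq : forall i, sqi P (Y i).
Hypothesis Ymean : forall i, Ex P (Y i) = 0.
Hypothesis AY : associated_seq P Y.
Hypothesis Ycov : forall i k, Cov P (Y i) (Y (i + k)%N) = Cov P (Y 0%N) (Y k).
Hypothesis csum : cvgn (series (fun k => Cov P (Y 0%N) (Y k))).
Let v := lim_var P Y.
Variables (K : R) (g : R -> R).
Hypothesis lg : lip K g.
Hypothesis g0 : forall x, 0 <= g x.
Hypothesis g1 : forall x, g x <= 1.

Let K0 : 0 <= K := lip_ge0 lg.
Let v_ge0 : 0 <= v.
Proof. exact: le_trans (Cov_seq_ge0 Ysq AY 0 0) (lim_var_ge Ysq AY csum). Qed.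

Let G (k : nat) (w : T) : R := g (nsum Y k w).
Let sG k : sqi P (G k). Proof. by apply: sqi_lip lg _; exact: sqi_nsum. Qed.

Let eta (k : nat) (w : T) : R := G k w - Ex P (G k).
Let seta k : sqi P (eta k). Proof. by apply: sqiB => //; exact: sqi_cst. Qed.

Let Ex_eta k : Ex P (eta k) = 0.
Proof. by rewrite ExB ?Ex_cst ?subrr//; [exact: sqi_itg|exact: itg_cst]. Qed.

Let eta_le k w : `|eta k w| <= 1.
Proof.
have h1 : 0 <= Ex P (G k) by apply: Ex_ge0 => x; exact: g0.
have h2 : Ex P (G k) <= 1.
  by rewrite -(Ex_cst P 1); apply: Ex_le; [exact: sqi_itg|exact: itg_cst|move=> x; exact: g1].
have := g0 (nsum Y k w); have := g1 (nsum Y k w) => h3 h4.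
by rewrite /eta /G ler_norml; apply/andP; split; lra.
Qed.

Let F (n : nat) (w : T) : R := \sum_(1 <= k < n.+1) k%:R^-1 * eta k w.
Let sF n : sqi P (F n).
Proof. by apply: (sqi_sum _ (F := fun k w => k%:R^-1 * eta k w)) => k; exact: sqiZ. Qed.

Let F_S n : F n.+1 = fun w => F n w + n.+1%:R^-1 * eta n.+1 w.
Proof. by apply/funext => w; rewrite /F big_nat_recr. Qed.

(** Association bounds the covariance of Lipschitz images by that of the sums, at most j v, which
    the normalization divides by sqrt j * sqrt k. *)
Let Cov_eta j k : (0 < j)%N -> (j <= k)%N ->
  Ex P (fun w => eta j w * eta k w) <=
  K ^+ 2 * v * (Num.sqrt j%:R / Num.sqrt k%:R).
Proof.
move=> j0 jk; have k0 := leq_trans j0 jk.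
have -> : Ex P (fun w => eta j w * eta k w) = Cov P (G j) (G k).
  have -> : Cov P (G j) (G k) = Cov P (eta j) (eta k).
    have sc c : sqi P (fun=> c : R) := sqi_cst P c.
    rewrite [RHS]CovBl// Cov_cstl// subr0 [RHS]CovC [RHS]CovBl// Cov_cstl// subr0.
    exact: CovC.
  by rewrite /Cov !Ex_eta mulr0 subr0.
have [C HC CY] := AY k.
have CN m : (m <= k)%N -> C (nsum Y m).
  move=> mk; apply: (pc_scale HC); first by rewrite invr_ge0.
  by apply: (pc_sum HC (CY 0%N k0)) => i im; apply: CY; exact: leq_trans mk.
have sN := sqi_nsum Ysq.
have := Cov_lip HC lg lg (CN j jk) (CN k (leqnn k)) (sN j) (sN k).
move=> /(le_trans (ler_norm _))/le_trans; apply.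
rewrite -expr2 -mulrA ler_wpM2l ?sqr_ge0//.
have [sj sk] := (sqi_psum Ysq j, sqi_psum Ysq k).
rewrite /nsum CovZl ?CovZr//; last exact: sqiZ.
have jj : 0 < Num.sqrt j%:R :> R by rewrite sqrtr_gt0 ltr0n.
have -> : v * (Num.sqrt j%:R / Num.sqrt k%:R) =
   (Num.sqrt j%:R)^-1 * ((Num.sqrt k%:R)^-1 * (j%:R * v)).
  have -> : j%:R = Num.sqrt j%:R * Num.sqrt j%:R :> R by rewrite -expr2 sqr_sqrtr.
  set x := Num.sqrt (_ * _); have -> : x = Num.sqrt j%:R.
    by rewrite /x -expr2 sqrtr_sqr gtr0_norm.
  by move: jj; set y := Num.sqrt j%:R; set z := _^-1 => jj; field; rewrite gt_eqF.
rewrite ler_pM2l ?invr_gt0// ler_wpM2l ?invr_ge0//.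
exact: Cov_psum_le.
Qed.

Let D : R := 4 * K ^+ 2 * v + 1.

(** The correlation of F_n with the next term is at most 2 K^2 v, because the sum of the 1 / sqrt k
    for k <= n is at most 2 sqrt n. Each step thus adds at most D / (n + 1), the 1 in [D] paying for
    the square of the new term. *)
Let var_F n : Ex P (fun w => F n w ^+ 2) <= D * harm R n.
Proof.
elim: n => [|n IH].
  rewrite harm0 mulr0 (_ : (fun w => _) = fun=> 0) ?Ex_cst//.
  by apply/funext => w; rewrite /F big_geq// expr0n.
have sFn := sF n; have s1 := sqiZ n.+1%:R^-1 (seta n.+1).
have h1 : Ex P (fun w => F n w * eta n.+1 w) <= 2 * (K ^+ 2 * v).
  have -> : (fun w => F n w * eta n.+1 w) =
    (fun w => \sum_(1 <= k < n.+1) k%:R^-1 * (eta k w * eta n.+1 w)).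
    by apply/funext => w; rewrite mulr_suml; apply: eq_bigr => k _; rewrite mulrA.
  have ik k : itg P (fun w => k%:R^-1 * (eta k w * eta n.+1 w)).
    by apply: itgZ; exact: sqiM.
  rewrite (Ex_sum _ ik).
  apply: (@le_trans _ _ (\sum_(1 <= k < n.+1) K ^+ 2 * v / Num.sqrt n.+1%:R * (Num.sqrt k%:R)^-1)).
    rewrite [leLHS]big_nat_cond [leRHS]big_nat_cond; apply: ler_sum => k; rewrite andbT => /andP[k1 kn].
    rewrite ExZ; last exact: sqiM.
    have := Cov_eta k1 (ltnW kn) => /(ler_wpM2l (_ : 0 <= k%:R^-1)) -/(_ _)/le_trans.
    apply; first by rewrite invr_ge0.
    have kk : 0 < Num.sqrt k%:R :> R by rewrite sqrtr_gt0 ltr0n.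
    have {1}-> : k%:R = Num.sqrt k%:R * Num.sqrt k%:R :> R by rewrite -expr2 sqr_sqrtr.
    move: kk; set y := Num.sqrt k%:R; set z := _^-1 => kk.
    rewrite le_eqVlt; apply/orP; left; apply/eqP; rewrite /z; field.
    by rewrite !gt_eqF// sqrtr_gt0 ltr0n.
  rewrite -mulr_sumr; set s := Num.sqrt n.+1%:R.
  have s0 : 0 < s by rewrite sqrtr_gt0 ltr0n.
  have sn : Num.sqrt n%:R <= s by rewrite ler_wsqrtr// ler_nat.
  have := inv_sqrt_sum_le R n => hs.
  have c0 : 0 <= K ^+ 2 * v / s.
    by apply: divr_ge0; [apply: mulr_ge0 => //; exact: sqr_ge0|exact: ltW].
  apply: le_trans (ler_wpM2l c0 hs) _.
  apply: (@le_trans _ _ (K ^+ 2 * v / s * (2 * s))); first by rewrite ler_wpM2l// ler_pM2l.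
  by rewrite le_eqVlt; apply/orP; left; apply/eqP; field; rewrite gt_eqF.
have h2 : Ex P (fun w => eta n.+1 w ^+ 2) <= 1.
  rewrite -(Ex_cst P 1); apply: Ex_le; [exact: (seta n.+1).2|exact: itg_cst|].
  by move=> w; rewrite -(real_normK (num_real (eta n.+1 w))) expr_le1.
set a := n.+1%:R^-1 in s1 *.
have a0 : 0 <= a by rewrite invr_ge0.
have a1 : a <= 1 by rewrite invf_le1// ler1n.
have -> : Ex P (fun w => F n.+1 w ^+ 2) = Ex P (fun w => F n w ^+ 2) +
   2 * a * Ex P (fun w => F n w * eta n.+1 w) + a ^+ 2 * Ex P (fun w => eta n.+1 w ^+ 2).
  have i1 : itg P (fun w => F n w * eta n.+1 w) by exact: sqiM.
  have i2 := (seta n.+1).2; have i3 := sFn.2.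
  rewrite -!ExZ// -!ExD//; try by [apply: itgZ|apply: itgD => //; exact: itgZ].
  by congr (Ex _ _); apply/funext => w; rewrite F_S -/a; ring.
rewrite harmS -/a mulrDr /D; set H := harm R n in IH *.
have h3 : 2 * a * Ex P (fun w => F n w * eta n.+1 w) <= 2 * a * (2 * (K ^+ 2 * v)).
  by rewrite ler_wpM2l// mulr_ge0.
have h4 : a ^+ 2 * Ex P (fun w => eta n.+1 w ^+ 2) <= a.
  apply: (@le_trans _ _ (a ^+ 2 * 1)); first by rewrite ler_wpM2l ?sqr_ge0.
  by rewrite mulr1 expr2 ler_piMr.
have -> : (4 * K ^+ 2 * v + 1) * a = 2 * a * (2 * (K ^+ 2 * v)) + a by ring.
rewrite -/D addrA; exact: (lerD (lerD IH h3) h4).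
Qed.

(* The variance of F_n / ln n is O(1 / ln n), which is summable along
   n = 2 ^ (m ^ 2); between consecutive such indices F_n / ln n hardly moves. *)
Let sub (m : nat) : nat := (2 ^ (m.+1 ^ 2))%N.

Let sub_gt0 m : (0 < sub m)%N. Proof. by rewrite expn_gt0. Qed.

Let ln_sub m : ln ((sub m)%:R) = m.+1%:R ^+ 2 * ln 2 :> R.
Proof. by rewrite /sub natrX lnXn// -[in RHS]natrX mulr_natl. Qed.

Let ln2_gt0 : 0 < ln 2 :> R. Proof. by rewrite ln_gt0// ltr1n. Qed.
Let ln2_le1 : ln 2 <= 1 :> R.
Proof.
have -> : 2 = 1 + 1 :> R by ring.
by apply: le_ln1Dx; apply: lt_trans (ltrN10 _) _.
Qed.

Let inv_sqr_sum n : \sum_(m < n) (m.+1%:R ^+ 2)^-1 <= 2 :> R.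
Proof.
case: n => [|n]; first by rewrite big_ord0.
(* The sharper bound telescopes, by 1 / (x + 1)^2 <= 1 / x - 1 / (x + 1). *)
suff : \sum_(m < n.+1) (m.+1%:R ^+ 2)^-1 <= 2 - n.+1%:R^-1 :> R.
  by move=> /le_trans; apply; rewrite gerBl invr_ge0.
elim: n => [|n IH]; first by rewrite big_ord1 expr1n invr1; lra.
rewrite big_ord_recr/=; set z := _^-1 in IH *.
suff : (n.+2%:R ^+ 2)^-1 <= z - n.+2%:R^-1.
  by set y := _^-1; set x := n.+2%:R^-1; lra.
have n1 : 0 < n.+1%:R :> R by [].
rewrite /z -[n.+2%:R]natr1; move: n1; set x := n.+1%:R => n1.
have -> : x^-1 - (x + 1)^-1 = (x * (x + 1))^-1.
  by field; apply/andP; split; apply: lt0r_neq0; lra.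
by rewrite lef_pV2 ?posrE ?exprn_gt0 ?mulr_gt0 ?addr_gt0// expr2 ler_wpM2r//; lra.
Qed.

(** The divisor (m + 1)^2 is ln (sub m) up to the factor ln 2; the second moments are then at most 2
    D / (m + 1)^2, which is summable. *)
Let sub_cvg : {ae P, forall w,
  (fun m => (F (sub m) w / m.+1%:R ^+ 2) ^+ 2) @ \oo --> (0 : R)}.
Proof.
have D0 : 0 <= D by rewrite addr_ge0// !mulr_ge0// sqr_ge0.
have FE m w : (F (sub m) w / m.+1%:R ^+ 2) ^+ 2 =
    ((m.+1%:R ^+ 2) ^+ 2)^-1 * F (sub m) w ^+ 2.
  by rewrite exprMn exprVn mulrC.
apply: (@ae_cvg0_of_summable _ _ _ _ _ (4 * D)) => [m w|m|n].
- exact: sqr_ge0.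
- by under eq_fun do rewrite FE; apply: itgZ; exact: (sF _).2.
have step (m : 'I_n) : Ex P (fun w => (F (sub m) w / m.+1%:R ^+ 2) ^+ 2) <=
    2 * D * (m.+1%:R ^+ 2)^-1.
  under eq_fun do rewrite FE.
  rewrite ExZ; last exact: (sF _).2.
  set x : R := m.+1%:R ^+ 2.
  have x1 : 1 <= x by rewrite /x -natrX ler1n expn_gt0.
  have x0 : 0 < x by apply: lt_le_trans x1.
  have hh : harm R (sub m) <= 2 * x.
    have := harm_le_ln R (sub m).-1; rewrite prednK// ln_sub -/x => /le_trans; apply.
    by have := ln2_le1; have := ln2_gt0; nra.
  apply: (@le_trans _ _ ((x ^+ 2)^-1 * (D * (2 * x)))).
    rewrite ler_wpM2l ?invr_ge0 ?sqr_ge0//.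
    by apply: le_trans (var_F _) _; rewrite ler_wpM2l.
  by rewrite le_eqVlt; apply/orP; left; apply/eqP; field; rewrite gt_eqF.
apply: le_trans (ler_sum _ (fun m _ => step m)) _.
rewrite -mulr_sumr.
have := inv_sqr_sum n; have -> : 4 * D = 2 * D * 2 by ring.
by apply: ler_wpM2l; rewrite mulr_ge0.
Qed.

Let F_diff n m w : (n <= m)%N -> `|F m.+1 w - F n.+1 w| <= ln (m.+1%:R) - ln (n.+1%:R).
Proof.
move=> nm; apply: le_trans (harm_diff_le R nm).
rewrite /F /harm (big_cat_nat (n := n.+2) (p := m.+2))//=.
rewrite [X in _ <= X - _](big_cat_nat (n := n.+2) (p := m.+2))//=.
rewrite !(addrC (\sum_(1 <= i < n.+2) _)) !addrK.
apply: le_trans (ler_norm_sum _ _ _) _; apply: ler_sum => k _.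
by rewrite normrM ger0_norm ?invr_ge0// ler_piMr ?invr_ge0.
Qed.

Let window n : (2 <= n)%N -> exists m, (sub m <= n < sub m.+1)%N.
Proof.
move=> n2; have ex : exists m, (sub m <= n)%N by exists 0%N.
have ub m : (sub m <= n)%N -> (m <= n)%N.
  move=> h; apply: leq_trans h; apply: ltnW; rewrite /sub.
  apply: leq_ltn_trans (ltn_expl (m.+1 ^ 2) (ltnSn 1)).
  by rewrite -mulnn (leq_trans (leqnSn m))// leq_pmulr.
case: (ex_maxnP ex ub) => m hm hmax; exists m; rewrite hm/= ltnNge.
by apply/negP => /hmax; rewrite ltnn.
Qed.

Lemma log_average_cvg0 : {ae P, forall w, (fun n => (ln n%:R)^-1 *
  \sum_(1 <= k < n.+1) k%:R^-1 * (g (nsum Y k w) - Ex P (fun w => g (nsum Y k w))))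
  @ \oo --> (0 : R)}.
Proof.
apply: filterS sub_cvg => w hw.
apply/cvgrPdist_le => e e0.
have e2 : 0 < (e / 2 * ln 2) ^+ 2 by rewrite exprn_gt0// mulr_gt0// divr_gt0.
move/cvgrPdist_le : hw => /(_ _ e2) [M1 _ H1].
(* With x = m + 1, F moves by at most ((x + 1)^2 - x^2) ln 2 <= 3 x ln 2 between consecutive
   indices; x >= 6 / e makes this at most half of e x^2 ln 2. *)
have h6 : 0 <= 6 / e by rewrite divr_ge0// ltW.
have /archi_boundP := h6; set M2 := Num.bound _ => H2.
pose M := maxn M1 M2.
exists (sub M).+1 => // n /= Mn; rewrite sub0r normrN.
have n2 : (2 <= n)%N.
  by apply: leq_trans Mn; rewrite ltnS.
have [m /andP[mn nm]] := window n2.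
have Mm : (M <= m)%N.
  rewrite leqNgt; apply/negP => mM; have : (sub m.+1 <= sub M)%N.
    by rewrite leq_exp2l// leq_exp2r// ltnS.
  by rewrite leqNgt (ltn_trans Mn nm).
set x : R := m.+1%:R.
have x1 : 1 <= x by rewrite ler1n.
have x6 : 6 / e <= x.
  by apply: le_trans (ltW H2) _; rewrite ler_nat (leq_trans _ (leqnSn m))// (leq_trans _ Mm)// leq_maxr.
have lnm := ln_sub m; have lnm' := ln_sub m.+1.
have [s0 s0'] := (sub_gt0 m, sub_gt0 m.+1).
have n0 : (0 < n)%N by apply: leq_trans n2.
have l1 : ln (sub m)%:R <= ln n%:R :> R by rewrite ler_ln ?posrE ?ltr0n// ler_nat.
have l2 : ln n%:R <= ln (sub m.+1)%:R :> R.
  by rewrite ler_ln ?posrE ?ltr0n// ler_nat ltnW.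
have Fd : `|F n w - F (sub m) w| <= ln n%:R - ln (sub m)%:R.
  have := @F_diff (sub m).-1 n.-1 w; rewrite !prednK//; apply.
  by rewrite -ltnS !prednK.
have Gm : `|F (sub m) w| <= e / 2 * ln 2 * x ^+ 2.
  have := H1 m (leq_trans (leq_maxl _ _) Mm); rewrite /= sub0r normrN normrX.
  have c0 : 0 <= e / 2 * ln 2 by rewrite mulr_ge0 ?divr_ge0// ltW.
  rewrite ler_pXn2r ?nnegrE// normrM normfV -/x.
  by rewrite (ger0_norm (sqr_ge0 x)) ler_pdivrMr// exprn_gt0// (lt_le_trans ltr01).
rewrite lnm -/x in Fd l1; rewrite lnm' -natr1 -/x in l2.
have lx0 : 0 < x ^+ 2 * ln 2 by rewrite mulr_gt0// exprn_gt0// (lt_le_trans ltr01).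
have ln0 : 0 < ln n%:R :> R by apply: lt_le_trans l1.
rewrite normrM normfV (gtr0_norm ln0) ler_pdivrMl// mulrC.
have hx : 6 <= e * x by rewrite -ler_pdivrMl// mulrC.
have h3 : 3 * x * ln 2 <= e / 2 * ln 2 * x ^+ 2.
  have -> : e / 2 * ln 2 * x ^+ 2 = (e * x) / 2 * x * ln 2 by ring.
  by rewrite ler_pM2r// ler_wpM2r ?(le_trans ler01)//; lra.
apply: (@le_trans _ _ (e * (x ^+ 2 * ln 2))); last by rewrite ler_wpM2l// ltW.
rewrite [X in `|X|](_ : _ = F n w)// -[F n w](subrK (F (sub m) w)); apply: le_trans (ler_normD _ _) _.
apply: (@le_trans _ _ (3 * x * ln 2 + e / 2 * ln 2 * x ^+ 2)); last by lra.
apply: lerD => //; apply: le_trans Fd _.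
apply: (@le_trans _ _ ((x + 1) ^+ 2 * ln 2 - x ^+ 2 * ln 2)); first by rewrite lerD2r.
rewrite -mulrBl ler_pM2r//; lra.
Qed.

End log_averages.

(** * Convergence of the logarithmic distribution *)

Section indicator_expectation.
Context d (T : measurableType d) (R : realType) (P : probability T R).
Variables (Z : T -> R) (t : R).
Hypothesis mZ : measurable_fun setT Z.

Lemma measurable_le_set : measurable [set w | Z w <= t].
Proof. by rewrite -[X in measurable X]setTI; exact: measurable_fun_le. Qed.

Lemma Ex_indic (A : set T) : measurable A -> Ex P \1_A = fine (P A).
Proof. by move=> mA; rewrite /Ex /Rintegral integral_indic// setIT. Qed.

Lemma fine_prob_le1 (A : set T) : measurable A -> 0 <= fine (P A) <= 1.
Proof.
move=> mA; rewrite fine_ge0//= -[leRHS]/(fine 1%E) fine_le//.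
  exact: fin_num_measure.
exact: probability_le1.
Qed.

Lemma prob_le_ramp (e : R) : 0 < e ->
  Ex P (fun w => ramp (t - e) e (Z w)) <= fine (P [set w | Z w <= t]) <=
  Ex P (fun w => ramp t e (Z w)).
Proof.
move=> e0; rewrite -(Ex_indic measurable_le_set).
have ir a : itg P (fun w => ramp a e (Z w)).
  apply: (@itg_bounded _ _ _ _ _ 1) => [|w]; last by rewrite ger0_norm ?ramp_ge0// ramp_le1.
  exact: (measurableT_comp (lip_measurable (lip_ramp a e0)) mZ).
have ii : itg P \1_[set w | Z w <= t].
  apply: (@itg_bounded _ _ _ _ _ 1) => [|w].
    by apply: measurable_indic; exact: measurable_le_set.
  by rewrite indicE; case: (_ \in _); rewrite ?normr1 ?normr0.
apply/andP; split; apply: Ex_le => // w; rewrite indicE.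
  have [wt|tw] := leP (Z w) t; first by rewrite mem_set// ramp_le1.
  by rewrite ramp_eq0 ?subrK// ltW.
have [wt|tw] := leP (Z w) t; first by rewrite ramp_eq1// lern1 leq_b1.
rewrite memNset ?ramp_ge0//=.
by apply/negP; rewrite -ltNge.
Qed.

End indicator_expectation.

Section weighted_sums.
Context (R : realType).

Lemma ln_unbounded (M : R) : exists N : nat, forall n, (N <= n)%N -> M <= ln n%:R.
Proof.
have /archi_boundP := expR_ge0 M; set N := Num.bound _ => hN.
exists N => n Nn; have h : expR M <= n%:R.
  by apply: le_trans (ltW hN) _; rewrite ler_nat.
by rewrite -[M]expRK ler_ln ?posrE ?expR_gt0// (lt_le_trans (expR_gt0 M)).
Qed.

(** The terms that may exceed c cost a constant, which later disappears after division by ln n. *)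
Lemma harm_sum_le (a : nat -> R) (c : R) (N n : nat) : 0 <= c -> (N <= n)%N ->
  (forall k, a k <= 1) -> (forall k, (N < k)%N -> a k <= c) ->
  \sum_(1 <= k < n.+1) k%:R^-1 * a k <= harm R N + c * harm R n.
Proof.
move=> c0 Nn a1 ac; rewrite (big_cat_nat (n := N.+1))//=; apply: lerD.
  by apply: ler_sum => k _; rewrite ler_piMr// invr_ge0.
apply: (@le_trans _ _ (c * \sum_(N.+1 <= k < n.+1) k%:R^-1)).
  rewrite mulr_sumr [leLHS]big_nat_cond [leRHS]big_nat_cond; apply: ler_sum => k.
  by rewrite andbT => /andP[Nk _]; rewrite mulrC ler_wpM2r ?invr_ge0// ac.
rewrite ler_wpM2l// /harm [leRHS](big_cat_nat (n := N.+1))//= lerDr.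
exact: harm_ge0.
Qed.

End weighted_sums.

Section log_distribution.
Context d (T : measurableType d) (R : realType) (P : probability T R).
Variable Y : nat -> T -> R.
Hypothesis Ysq : forall i, sqi P (Y i).
Hypothesis Ymean : forall i, Ex P (Y i) = 0.
Hypothesis AY : associated_seq P Y.
Hypothesis Ycov : forall i k, Cov P (Y i) (Y (i + k)%N) = Cov P (Y 0%N) (Y k).
Hypothesis csum : cvgn (series (fun k => Cov P (Y 0%N) (Y k))).
Hypothesis Ysum : forall (l j : nat) (F : R -> R), measurable_fun setT F ->
  itg P (fun w => F (\sum_(k < l) Y k w)) ->
  itg P (fun w => F (\sum_(k < l) Y (j + k)%N w)) /\
  Ex P (fun w => F (\sum_(k < l) Y (j + k)%N w)) =
  Ex P (fun w => F (\sum_(k < l) Y k w)).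
Variable t : R.

Let mN n : measurable_fun setT (nsum Y n). Proof. exact: sqi_meas (sqi_nsum Ysq n). Qed.
Let Pn n : R := fine (P [set w | nsum Y n w <= t]).
Let ind (k : nat) (w : T) : R := if nsum Y k w <= t then 1 else 0.

Let avg (g : R -> R) (n : nat) (w : T) : R := (ln n%:R)^-1 *
  \sum_(1 <= k < n.+1) k%:R^-1 * (g (nsum Y k w) - Ex P (fun w => g (nsum Y k w))).

Let Pn01 n : 0 <= Pn n <= 1.
Proof. by apply: fine_prob_le1; exact: measurable_le_set. Qed.

Lemma log_distribution_pos : 0 < lim_var P Y ->
  {ae P, forall w, (fun n : nat => `|Pn n - (ln n%:R)^-1 *
    \sum_(1 <= k < n.+1) k%:R^-1 * ind k w|) @ \oo --> (0 : R)}.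
Proof.
move=> v0.
(* One ramp width for each tolerance 1 / (p + 1): countably many, so that a single null set serves
   for all of them. *)
have /choice[e_ he] : forall p : nat, exists e : R, 0 < e /\
    exists N : nat, forall n m, (N <= n)%N -> (N <= m)%N ->
    Ex P (fun w => ramp t e (nsum Y n w)) -
    Ex P (fun w => ramp (t - e) e (nsum Y m w)) <= p.+1%:R^-1.
  move=> p; have p0 : 0 < p.+1%:R^-1 :> R by rewrite invr_gt0.
  by have [e e0 h] := ramp_clt Ysq Ymean AY Ycov csum Ysum v0 t p0; exists e.
have ae1 p : {ae P, forall w, avg (ramp t (e_ p)) ^~ w @ \oo --> (0 : R)}.
  have [ep _] := he p.
  apply: (log_average_cvg0 Ysq AY Ycov csum (lip_ramp t ep)).
    by move=> x; exact: ramp_ge0.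
  by move=> x; exact: ramp_le1.
have ae2 p : {ae P, forall w, avg (ramp (t - e_ p) (e_ p)) ^~ w @ \oo --> (0 : R)}.
  have [ep _] := he p.
  apply: (log_average_cvg0 Ysq AY Ycov csum (lip_ramp (t - e_ p) ep)).
    by move=> x; exact: ramp_ge0.
  by move=> x; exact: ramp_le1.
apply: filterS2 (ae_foralln ae1) (ae_foralln ae2) => w c1 c2.
apply/cvgrPdist_le => eps eps0; have e8 : 0 < eps / 8 by rewrite divr_gt0.
have e8' : 0 <= (eps / 8)^-1 by rewrite invr_ge0 ltW.
have /archi_boundP := e8'; set p := Num.bound _ => hp.
set eta : R := p.+1%:R^-1.
have eta0 : 0 < eta by rewrite invr_gt0.
have eta1 : eta <= 1 by rewrite invf_le1// ler1n.
have eta8 : eta <= eps / 8.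
  rewrite -[leRHS]invrK lef_pV2 ?posrE ?invr_gt0//.
  by apply: le_trans (ltW hp) _; rewrite ler_nat.
have [ep [N HN]] := he p.
move/cvgrPdist_le : (c1 p) => /(_ _ e8) [M1 _ H1].
move/cvgrPdist_le : (c2 p) => /(_ _ e8) [M2 _ H2].
(* From here on ln n dominates both the first N terms and the bounded error, at most 2, due to harm
   n <= 1 + ln n. *)
have [M3 H3] := ln_unbounded (1 + (harm R N + 2) * (eps / 8)^-1).
exists (maxn (maxn M1 M2) (maxn (maxn M3 N) 1)) => // n /=.
rewrite !geq_max => /andP[/andP[n1 n2] /andP[/andP[n3 nN] n0]].
have := H1 n n1 => /ler_normlP[]; rewrite sub0r opprK => a1 _.
have := H2 n n2 => /ler_normlP[_]; rewrite sub0r => a2.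
have hN0 := harm_ge0 R N.
have L3 := H3 n n3; have hN2 : 0 <= (harm R N + 2) * (eps / 8)^-1 by rewrite mulr_ge0// addr_ge0.
move: a1 a2; rewrite /avg; set L := ln n%:R in L3 *.
have L1 : 1 <= L by lra.
have L0 : 0 < L by apply: lt_le_trans L1.
have LN : harm R N + 2 <= eps / 8 * L.
  by rewrite mulrC -ler_pdivrMr//; lra.
have HL : L <= harm R n <= 1 + L.
  have := ln_le_harm R n.-1; have := harm_le_ln R n.-1.
  by rewrite prednK// => -> ->.
move: HL; set H := harm R n => /andP[LH HL].
have /andP[P0 P1] := Pn01 n.
have split1 (g : R -> R) : \sum_(1 <= k < n.+1) k%:R^-1 * (g (nsum Y k w) - Ex P (fun w => g (nsum Y k w)))
   = \sum_(1 <= k < n.+1) k%:R^-1 * g (nsum Y k w)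
   - \sum_(1 <= k < n.+1) k%:R^-1 * Ex P (fun w => g (nsum Y k w)).
  by rewrite -sumrB; apply: eq_bigr => k _; rewrite mulrBr.
rewrite !split1.
set R1 := \sum_(1 <= k < n.+1) k%:R^-1 * ramp t (e_ p) _.
set Q1 := \sum_(1 <= k < n.+1) k%:R^-1 * Ex P (fun w => ramp t _ _).
set R2 := \sum_(1 <= k < n.+1) k%:R^-1 * ramp (t - e_ p) (e_ p) _.
set Q2 := \sum_(1 <= k < n.+1) k%:R^-1 * Ex P (fun w => ramp (t - e_ p) _ _).
move=> a1 a2.
have s1 : R1 - Q1 <= eps / 8 * L by rewrite -ler_pdivrMr// [leLHS]mulrC.
have s2 : - (R2 - Q2) <= eps / 8 * L by rewrite -ler_pdivrMr// [leLHS]mulrC mulrN.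
set I := \sum_(1 <= k < n.+1) k%:R^-1 * ind k w.
have IR1 : I <= R1.
  apply: ler_sum => k _; rewrite ler_wpM2l ?invr_ge0// /ind.
  by case: ifP => [kt|_]; rewrite ?ramp_ge0// ramp_eq1.
have IR2 : R2 <= I.
  apply: ler_sum => k _; rewrite ler_wpM2l ?invr_ge0// /ind.
  have [kt|tk] := leP (nsum Y k w) t; first by rewrite ramp_le1.
  by rewrite ramp_eq0// subrK ltW.
have ir (g : R -> R) (k : nat) : (forall x, 0 <= g x) -> (forall x, g x <= 1) -> measurable_fun setT g ->
    0 <= Ex P (fun w => g (nsum Y k w)) <= 1.
  move=> g0 g1 mg; rewrite Ex_ge0//= -[leRHS](Ex_cst P); apply: Ex_le => //; last exact: itg_cst.
  apply: (@itg_bounded _ _ _ _ _ 1) => [|x]; last by rewrite ger0_norm.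
  exact: (measurableT_comp mg).
have ir1 (k : nat) := ir (ramp t (e_ p)) k (ramp_ge0 t (e_ p)) (ramp_le1 t (e_ p)) (lip_measurable (lip_ramp t ep)).
have ir2 (k : nat) := ir (ramp (t - e_ p) (e_ p)) k (ramp_ge0 (t - e_ p) (e_ p)) (ramp_le1 (t - e_ p) (e_ p))
  (lip_measurable (lip_ramp (t - e_ p) ep)).
have /andP[Pl Pu] := prob_le_ramp P t (mN n) ep.
rewrite -/(Pn n) in Pl Pu.
have q1 : Q1 <= harm R N + (Pn n + eta) * H.
  (* Beyond N, the upper ramp at time k has mean within eta of the lower ramp at time n, which is at
     most P(T_n <= t). *)
  apply: (harm_sum_le (a := fun k => Ex P (fun w => ramp t (e_ p) (nsum Y k w)))) => //.
  - by rewrite addr_ge0// ltW.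
  - by move=> k; have /andP[] := ir1 k.
  - by move=> k Nk; have := HN k n (ltnW Nk) nN; rewrite -/eta; lra.
(* A lower bound on Q2 is needed, so the same estimate is applied to the complements 1 - E[ramp]. *)
have q2 : H - Q2 <= harm R N + (1 - Pn n + eta) * H.
  have -> : H - Q2 = \sum_(1 <= k < n.+1) k%:R^-1 *
      (1 - Ex P (fun w => ramp (t - e_ p) (e_ p) (nsum Y k w))).
    by rewrite /H /harm -sumrB; apply: eq_bigr => k _; rewrite mulrBr mulr1.
  apply: (harm_sum_le (a := fun k => 1 - Ex P (fun w => ramp (t - e_ p) (e_ p) (nsum Y k w)))) => //.
  - by rewrite addr_ge0 ?subr_ge0// ltW.
  - by move=> k; rewrite gerBl; have /andP[] := ir2 k.
  - by move=> k Nk; have := HN n k nN (ltnW Nk); rewrite -/eta; lra.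
rewrite sub0r normrN normr_id.
have -> : Pn n - L^-1 * I = (Pn n * L - I) / L by field; rewrite gt_eqF.
rewrite normrM normfV (gtr0_norm L0) ler_pdivrMr//.
have m1 : Pn n * L <= Pn n * H by rewrite ler_wpM2l.
have m2 : eta * H <= eta * (1 + L) by rewrite ler_wpM2l// ltW.
have m3 : eta * L <= eps / 8 * L by rewrite ler_wpM2r// ltW.
have m4 : Pn n * H <= Pn n * (1 + L) by rewrite ler_wpM2l.
rewrite ler_norml; apply/andP; split; lra.
Qed.

(** Every T_n has variance at most [lim_var] = 0, so it vanishes almost surely, and probability and
    indicator are both 1 or both 0 according to the sign of t. *)
Lemma log_distribution_degenerate : lim_var P Y = 0 ->
  {ae P, forall w, (fun n : nat => `|Pn n - (ln n%:R)^-1 *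
    \sum_(1 <= k < n.+1) k%:R^-1 * ind k w|) @ \oo --> (0 : R)}.
Proof.
move=> v0.
have N0 n : {ae P, forall w, nsum Y n w = 0}.
  have sN := sqi_nsum Ysq n; have mN2 : measurable_fun setT (fun w => ((nsum Y n w) ^+ 2)%:E).
    by apply/measurable_EFinP; apply: measurable_funX.
  have := (ae_eq_integral_abs P measurableT mN2).1.
  case.
    under eq_integral do rewrite gee0_abs ?lee_fin ?sqr_ge0//.
    have fi := integrable_fin_num measurableT sN.2.
    rewrite -(fineK fi); congr EFin; apply/eqP; rewrite eq_le.
    have := var_nsum_le Ysq Ymean AY Ycov csum n; rewrite v0 => h.
    by apply/andP; split => //; apply: Ex_ge0 => w; exact: sqr_ge0.
  move=> A [mA PA hA]; exists A; split => // w /= hw; apply: hA => /= /(_ I) [] /eqP.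
  by rewrite sqrf_eq0 => /eqP.
have NP n : Pn n = if 0 <= t then 1 else 0.
  rewrite /Pn; have [A [mA PA hA]] := N0 n.
  have mS := @measurable_le_set _ _ _ (nsum Y n) t (mN n).
  case: ifP => t0.
    have : P (~` [set w | nsum Y n w <= t]) = 0%E.
      apply: (subset_measure0 _ mA _ PA); first exact: measurableC.
      by move=> w /= h; apply: hA => /= e; apply: h; rewrite e.
    rewrite probability_setC// => /eqP; rewrite sube_eq//.
      by rewrite add0e => /eqP <-.
  rewrite (@subset_measure0 _ _ _ P _ A)// => w /= h; apply: hA => /= e.
  by move: h; rewrite e t0.
apply: filterS (ae_foralln N0) => w hw.
have Ik k : ind k w = if 0 <= t then 1 else 0 by rewrite /ind hw.
under eq_fun => n.
  under eq_bigr do rewrite Ik.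
  rewrite NP -mulr_suml -/(harm R n); over.
case: ifP => _; last first.
  by under eq_fun do rewrite !mulr0 subrr normr0; exact: cvg_cst.
(* For t >= 0 there remains 1 - harm n / ln n, which is at most 1 / ln n in absolute value. *)
apply/cvgrPdist_le => eps eps0.
have [M HM] := ln_unbounded (1 + eps^-1).
exists (maxn M 1) => // n /=; rewrite geq_max => /andP[Mn n0].
have ei : 0 < eps^-1 by rewrite invr_gt0.
have L1 := HM n Mn; have L0 : 0 < ln n%:R :> R by lra.
rewrite sub0r normrN normr_id mulr1.
have := ln_le_harm R n.-1; have := harm_le_ln R n.-1; rewrite prednK//.
set L := ln n%:R in L0 L1 *; set H := harm R n => h1 h2.
have -> : 1 - L^-1 * H = (L - H) / L by field; rewrite gt_eqF.
rewrite normrM normfV (gtr0_norm L0) ler_pdivrMr// distrC ger0_norm ?subr_ge0//.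
have : eps * eps^-1 <= eps * L by rewrite ler_pM2l//; lra.
rewrite mulfV ?gt_eqF//; lra.
Qed.

Lemma log_distribution : {ae P, forall w, (fun n : nat => `|Pn n - (ln n%:R)^-1 *
    \sum_(1 <= k < n.+1) k%:R^-1 * ind k w|) @ \oo --> (0 : R)}.
Proof.
have : 0 <= lim_var P Y by exact: le_trans (Cov_seq_ge0 Ysq AY 0 0) (lim_var_ge Ysq AY csum).
rewrite le_eqVlt => /orP[/eqP e|]; last exact: log_distribution_pos.
exact: log_distribution_degenerate (esym e).
Qed.

End log_distribution.

Theorem theorem2p4 (d : measure_display) (Omega : measurableType d)
  (R : realType) (P : probability Omega R)
  (xi sigma X : int -> Omega -> R)
  (phi : R * R -> R) (Lambda : R -> R)
  (* the i.i.d. innovations *)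
  (xi_meas : forall n, measurable_fun setT (xi n))
  (xi_indep : mutually_independent P xi)
  (xi_ident : identically_distributed P xi)
  (xi_int : P.-integrable setT (fun w => (xi 0 w)%:E))
  (xi_mean : ('E_P[xi (0:int)] = 0)%E)
  (xi_var : ('E_P[xi (0:int) ^+ 2] = 1)%E)
  (* the volatility process *)
  (sigma_meas : forall n, measurable_fun setT (sigma n))
  (sigma_pos : forall n w, 0 < sigma n w)
  (sigma_stat : stationary P sigma)
  (sigma_past : forall n, measurable_wrt (past_sigma xi n) (sigma n))
  (* phi coordinatewise nondecreasing and measurable *)
  (phi_meas : measurable_fun setT phi)
  (phi_mono : forall a a' b b', a <= a' -> b <= b' -> phi (a, b) <= phi (a', b'))
  (* Lambda strictly increasing and measurable on R_+ = [0, +oo) *)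
  (Lambda_meas : measurable_fun (`[0, +oo[%classic : set R) Lambda)
  (Lambda_incr : forall x y, 0 <= x -> x < y -> Lambda x < Lambda y)
  (* the augmented GARCH(1,1) equations *)
  (X_def : forall n w, X n w = sigma n w * xi n w)
  (rec : forall n w, Lambda (sigma n w ^+ 2) =
           phi (Lambda (sigma (n - 1) w ^+ 2), xi (n - 1) w ^+ 2))
  (* moment and covariance assumptions *)
  (X_4 : ('E_P[X (0:int) ^+ 4] < +oo)%E)
  (cov_sum : cvgn (series (fun k : nat =>
             fine (covariance P (X (1:int) ^+ 2) (X k.+1%:Z ^+ 2)) : R) : R ^nat))
  (t : R) :
  let T_ (n : nat) (w : Omega) : R :=
    (Num.sqrt n%:R)^-1 *
      \sum_(1 <= k < n.+1) (X k%:Z w ^+ 2 - fine 'E_P[X (0:int) ^+ 2]) in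
  {ae P, forall w,
    (fun n : nat =>
       `| fine (P [set w' | T_ n w' <= t]) -
          (ln n%:R)^-1 * \sum_(1 <= k < n.+1) (k%:R)^-1 *
             (if T_ k w <= t then 1 else 0) |) @ \oo --> (0 : R)}.
Proof.
move=> T_.
pose Q (j : int) w := X j w ^+ 2.
have SQ : stationary_seq P Q.
  exact: (garch_stationary xi_meas xi_indep xi_ident sigma_meas sigma_stat
    sigma_past phi_meas phi_mono Lambda_meas Lambda_incr rec X_def).
have AQ : associated_seq P (fun k => Q k.+1%:Z).
  exact: (garch_associated xi_meas xi_indep xi_ident sigma_meas sigma_stat
    sigma_past phi_meas phi_mono Lambda_meas Lambda_incr rec X_def).
have mQ j : measurable_fun setT (Q j) := stationary_meas SQ j.
have sq_meas : measurable_fun setT (fun x : R => x ^+ 2) by exact: measurable_funX.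
have i0 : itg P (fun w => Q 0 w ^+ 2).
  apply/integrableP; split; first by apply/measurable_EFinP; exact: measurable_funX.
  move: X_4; rewrite unlock; apply: le_lt_trans; rewrite le_eqVlt; apply/orP; left.
  apply/eqP; apply: eq_integral => w _ /=; rewrite ger0_norm ?sqr_ge0//.
  by rewrite /Q -exprM.
have sQ j : sqi P (Q j).
  by split => //; exact: (stationary_one SQ j sq_meas i0).1.
pose m := Ex P (Q 0).
have EQ j : Ex P (Q j) = m.
  exact: (stationary_one SQ j (@measurable_id _ _ _) (sqi_itg (sQ 0))).2.
have EE j : fine 'E_P[X j ^+ 2] = m by rewrite -(EQ j) unlock.
(* The shift of index makes [psum Y n] the centred sum of X_1^2, ..., X_n^2. *)
pose Y (k : nat) w := Q k.+1%:Z w - m.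
have Ysq i : sqi P (Y i) by apply: sqiB => //; exact: sqi_cst.
have Ymean i : Ex P (Y i) = 0.
  by rewrite ExB ?Ex_cst ?EQ ?subrr//; [exact: sqi_itg|exact: itg_cst].
have AY : associated_seq P Y by exact: (associated_seq_shift m AQ).
have CovY i j : Cov P (Y i) (Y j) = Ex P (fun w => Q i.+1%:Z w * Q j.+1%:Z w) - m * m.
  have sc : sqi P (fun=> m) := sqi_cst P m.
  rewrite CovBl// Cov_cstl// subr0 CovC CovBl// Cov_cstl// subr0 CovC.
  by rewrite /Cov !EQ.
have Ycov i k : Cov P (Y i) (Y (i + k)%N) = Cov P (Y 0%N) (Y k).
  rewrite !CovY; congr (_ - _).
  have ip : itg P (fun w => Q 1 w * Q (1 + k%:Z) w) by exact: sqiM.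
  have [_] := stationary_prod SQ i.+1%:Z ip.
  by rewrite -!PoszD !addSn add0n.
have csum : cvgn (series (fun k => Cov P (Y 0%N) (Y k))).
  have <- // : (fun k : nat => fine (covariance P (X 1 ^+ 2) (X k.+1%:Z ^+ 2))) =
      (fun k => Cov P (Y 0%N) (Y k)).
  apply/funext => k; rewrite /Cov !Ymean mulr0 subr0 covariance.unlock !EE.
  by rewrite expectation.unlock.
have Ysum (l j : nat) (F : R -> R) : measurable_fun setT F ->
  itg P (fun w => F (\sum_(k < l) Y k w)) ->
  itg P (fun w => F (\sum_(k < l) Y (j + k)%N w)) /\
  Ex P (fun w => F (\sum_(k < l) Y (j + k)%N w)) =
  Ex P (fun w => F (\sum_(k < l) Y k w)).
  (* Stationarity is known for sums of the uncentred squares, so the centring of l terms is absorbed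
     into the test function. *)
  move=> mF; pose F' x := F (x - l%:R * m).
  have mF' : measurable_fun setT F' by apply: (measurableT_comp mF); exact: measurable_funB.
  have e (i : nat) w : \sum_(k < l) Y (i + k)%N w = \sum_(k < l) Q (i.+1%:Z + k%:Z) w - l%:R * m.
    rewrite sumrB sumr_const card_ord mulr_natl; congr (_ - _).
  have -> : (fun w => F (\sum_(k < l) Y k w)) =
      (fun w => F' (\sum_(k < l) Q (1 + k%:Z) w)).
    by apply/funext => w; rewrite /F' -(e 0%N).
  have -> : (fun w => F (\sum_(k < l) Y (j + k)%N w)) =
      (fun w => F' (\sum_(k < l) Q (j.+1%:Z + k%:Z) w)).
    by apply/funext => w; rewrite /F' -e.
  exact: (stationary_sum SQ).
have TE : T_ = nsum Y.
  apply/funext => n; apply/funext => w; rewrite /T_ /nsum /psum EE; congr (_ * _).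
  by rewrite big_add1/= big_mkord.
rewrite TE; exact: (log_distribution Ysq Ymean AY Ycov csum Ysum t).
Qed.
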